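(* Let $\beta=2/\log(e/2)\approx 6.51778$, and let $w(n)$ be any function with $w(n)\to\infty$. (i) If $p(n-1)=\beta(\log n-\tfrac12\log\log n)-w(n)$, then a.a.s. $\delta(\mathcal G(n,p))\le \lfloor m(\mathcal G(n,p))/(n-1)\rfloor$, and hence $T(\mathcal G(n,p))=\delta(\mathcal G(n,p))$. (ii) If $p(n-1)=\beta(\log n-\tfrac12\log\log n)+w(n)$, then a.a.s. $\delta(\mathcal G(n,p))> \lfloor m(\mathcal G(n,p))/(n-1)\rfloor$, and hence $T(\mathcal G(n,p))=\lfloor m(\mathcal G(n,p))/(n-1)\rfloor$.
   Context: $\mathcal G(n,p)$ is the Erdős–Rényi random graph on $[n]$ with each edge present independently with probability $p=p(n)$; ''a.a.s.'' means with probability tending to $1$ as $n\to\infty$; $\log$ is the natural logarithm. For a graph $G$, $m(G)$ is its number of edges, $\delta(G)$ its minimum degree, and $T(G)$ the maximum number of pairwise edge-disjoint spanning trees of $G$. *)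

(* Defs.v *)
From HB Require Import structures.
From mathcomp Require Import all_boot all_order all_algebra.
From mathcomp Require Import all_classical all_reals all_analysis.
Set Implicit Arguments. Unset Strict Implicit. Unset Printing Implicit Defensive.
Import Order.TTheory GRing.Theory Num.Theory.
Local Open Scope ring_scope.

(* Graphs on vertex set [n] = 'I_n are edge sets E : {set {set 'I_n}},
   each edge being a 2-element subset of 'I_n. *)
Definition pairs (n : nat) : {set {set 'I_n}} := [set e : {set 'I_n} | #|e| == 2%N].

Definition nedges (n : nat) (E : {set {set 'I_n}}) : nat := #|E|.

Definition deg (n : nat) (E : {set {set 'I_n}}) (v : 'I_n) : nat :=
  #|[set e in E | v \in e]|.

(* minimum degree delta(G) (for n >= 1; the seed n is irrelevant then since deg <= n-1) *)
Definition mindeg (n : nat) (E : {set {set 'I_n}}) : nat :=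
  \big[minn/n]_(v : 'I_n) deg E v.

Definition adj (n : nat) (F : {set {set 'I_n}}) : rel 'I_n :=
  fun x y => (x != y) && ([set x; y] \in F).

Definition connectedb (n : nat) (F : {set {set 'I_n}}) : bool :=
  [forall u, forall v, connect (adj F) u v].

(* F is (the edge set of) a spanning tree of the graph E:
   F is a set of edges of E, (V, F) is connected, and acyclic
   (every edge of F is a bridge: removing it disconnects (V, F)). *)
Definition spanning_tree (n : nat) (E F : {set {set 'I_n}}) : bool :=
  [&& F \subset E, connectedb F & [forall e in F, ~~ connectedb (F :\ e)]].

Definition has_disj_trees (n : nat) (E : {set {set 'I_n}}) (k : nat) : bool :=
  [exists Fs : {ffun 'I_k -> {set {set 'I_n}}},
     [forall i, spanning_tree E (Fs i)] &&
     [forall i, forall j, (i != j) ==> [disjoint Fs i & Fs j]]].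

(* T(G): maximum number of pairwise edge-disjoint spanning trees.
   For n >= 2 every spanning tree has >= 1 edge, so k <= #|E| and the
   bounded maximum below is the true maximum. *)
Definition Tnum (n : nat) (E : {set {set 'I_n}}) : nat :=
  \max_(k < #|E|.+2 | has_disj_trees E k) k.

Definition Pr (R : realType) (n : nat) (p : R) (P : pred {set {set 'I_n}}) : R :=
  \sum_(E : {set {set 'I_n}} | (E \subset pairs n) && P E)
     p ^+ #|E| * (1 - p) ^+ (#|pairs n| - #|E|).

Definition beta (R : realType) : R := 2 / ln (expR 1 / 2).

Definition event_i (n : nat) : pred {set {set 'I_n}} :=
  fun E => (mindeg E <= (nedges E %/ n.-1)%N)%N && (Tnum E == mindeg E).

Definition event_ii (n : nat) : pred {set {set 'I_n}} :=
  fun E => ((nedges E %/ n.-1)%N < mindeg E)%N && (Tnum E == (nedges E %/ n.-1)%N).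

(* Main.v *)
(** Write d = p (n - 1) and k = min(delta, floor(m / (n - 1))); clearly T <= k.

    Tree packing.  Suppose that every nonempty vertex set X spans at most
    k (|X| - 1) edges and that there are k (n - 1) edges in all.  Grow a tree A
    with vertex set W from a root, keeping e(X) + |X \cap W| + k - 1 <= k |X|
    for all X, where e counts the edges outside A: a minimal tight set not
    contained in W always provides an edge to add, and at the end what remains
    satisfies the hypothesis for k - 1.  In a general graph take a maximal
    subgraph with the sparsity property; its maximal tight sets partition the
    vertices, and the subgraph has fewer than k (n - 1) edges only if too few
    edges of the graph cross this partition.

    Random graph.  That obstruction is excluded a.a.s. since small sets span
    few edges, sets of size up to (1 - eps) n are not much denser than the
    whole graph, and vertices of degree not much above k are pairwise neither
    adjacent nor joined to a common neighbour.  Hence T = k.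

    Threshold.  The two cases differ by whether some vertex has degree at most
    m / (n - 1), which is close to d / 2.  By Stirling, P(Bin(n - 1, p) <= d / 2)
    is of order exp(- d / beta) / sqrt d, so the expected number of such
    vertices tends to 0 or to infinity; in the latter case a second moment
    argument applies. *)
Require Import Defs.
From HB Require Import structures.
From mathcomp Require Import all_boot all_order all_algebra.
From mathcomp Require Import all_classical all_reals all_analysis.
From mathcomp Require Import zify ring lra.
Set Implicit Arguments. Unset Strict Implicit. Unset Printing Implicit Defensive.
Import Order.TTheory GRing.Theory Num.Theory.
Import numFieldNormedType.Exports.
From mathcomp Require Import fintype finset.

(** * Tree packing *)

(** Packing needs the vertices of degree below k plus a small multiple of d to be far apart. The
    union bound for this costs a factor n times a power of d and gains only the square of a lower
    tail, so the tail at that level must be well below n^(-1/2). Above the threshold the tail at d /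
    2 is at most about 1 / n, which leaves ample room. Below it w is arbitrary, d may be much
    smaller than beta log n, and the tail at d / 2 can be too large. The minimum degree is then
    compared with a lower degree j, chosen so that vertices of degree at most j exist while those of
    degree slightly above j are still rare. For d at most 0.8 log n an isolated vertex settles the
    claim. At the other end d is unbounded; beyond 20 log n a crude estimate of m suffices, because
    all degrees exceed d / 2 by a fixed proportion. The estimates are uniform in p for large x = log
    n, with w replaced by a constant W that is made large only at the end. *)

Section TreePacking.
Variable n : nat.
Implicit Types (E F A : {set {set 'I_n}}) (X Y W U : {set 'I_n}).

Definition ind E X : nat := #|[set e in E | e \subset X]|.

Lemma ind_supermodular E X Y :
  ind E X + ind E Y <= ind E (X :|: Y) + ind E (X :&: Y).
Proof.
rewrite /ind -cardsUI leq_add // subset_leq_card //; apply/subsetP => e; rewrite !inE -?andb_orr.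
  case/andP => -> /= /orP[eX|eX]; first exact: subset_trans eX (subsetUl _ _).
  exact: subset_trans eX (subsetUr _ _).
by case/andP => /andP[-> eX] /andP[_ eY]; rewrite subsetI eX.
Qed.

Lemma indT E : ind E setT = #|E|.
Proof. by apply: eq_card => e; rewrite !inE subsetT andbT. Qed.

Lemma ind_leq_card E X : ind E X <= #|E|.
Proof. by apply/subset_leq_card/subsetP => e; rewrite inE => /andP[]. Qed.

Lemma ind_sub E F X : F \subset E -> ind F X <= ind E X.
Proof.
by move=> /subsetP sFE; apply/subset_leq_card/subsetP => e; rewrite !inE => /andP[/sFE -> ->].
Qed.

Lemma indD E F X : F \subset E -> ind E X = ind F X + ind (E :\: F) X.
Proof.
move=> /subsetP sFE; rewrite /ind -cardsUI [X in _ + X](_ : _ = 0) ?addn0.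
  by apply: eq_card => e; rewrite !inE; case eF: (e \in F); rewrite ?(sFE _ eF) /= ?orbF.
by apply/eqP; rewrite cards_eq0; apply/eqP/setP => e; rewrite !inE; case: (e \in F); rewrite /= ?andbF.
Qed.

Lemma indU1 E e X : e \notin E -> ind (e |: E) X = ind E X + (e \subset X).
Proof.
move=> eE; rewrite (@indD _ E) ?subsetUr //; congr (_ + _).
rewrite (_ : _ :\: _ = [set e]); last first.
  by apply/setP => f; rewrite !inE; case: eqP => [->|_]; rewrite ?eE //=; case: (f \in E).
case: (boolP (e \subset X)) => eX; rewrite /ind.
  apply/eqP/cards1P; exists e; apply/setP => f; rewrite !inE; case: eqP => [->|] //=.
apply/eqP; rewrite cards_eq0; apply/eqP/setP => f; rewrite !inE.
by case: eqP => [->|] //=; rewrite (negbTE eX).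
Qed.

Lemma ind1 E x : E \subset pairs n -> ind E [set x] = 0.
Proof.
move=> /subsetP sE; apply/eqP; rewrite cards_eq0; apply/eqP/setP => e; rewrite !inE.
apply/negbTE/negP => /andP[/sE]; rewrite inE => /eqP ce /subset_leq_card; rewrite cards1 ce //.
Qed.

Lemma pairsP E e : E \subset pairs n -> e \in E ->
  exists x y, x != y /\ e = [set x; y].
Proof.
move=> /subsetP sE /sE; rewrite inE => /cards2P[x [y [xy ->]]]; by exists x, y.
Qed.

Definition cut_size E W : nat := #|[set e in E | ~~ (e \subset W) && ~~ (e \subset ~: W)]|.

Lemma cut_sizeE E W : E \subset pairs n -> #|E| = ind E W + ind E (~: W) + cut_size E W.
Proof.
move=> sE; rewrite -[LHS](cardsID [set e : {set 'I_n} | e \subset W]) -addnA; congr (_ + _).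
  by apply: eq_card => e; rewrite !inE.
rewrite -[LHS](cardsID [set e : {set 'I_n} | e \subset ~: W]); congr (_ + _).
  apply: eq_card => e; rewrite !inE; case eE : (e \in E); rewrite ?andbF //=.
  case eW : (e \subset ~: W) => //=; rewrite ?andbF // andbT.
  have [x [y [xy ee]]] := pairsP sE eE.
  move: eW; rewrite ee !subUset !sub1set !inE; by case/andP => /negbTE ->.
by apply: eq_card => e; rewrite !inE andbC -andbA andbC -andbA; congr (_ && _); rewrite andbC.
Qed.

Lemma cut_size_edge E W : E \subset pairs n -> 0 < cut_size E W ->
  exists u v, [/\ u \in W, v \notin W & [set u; v] \in E].
Proof.
move=> sE; rewrite card_gt0 => /set0Pn[e]; rewrite inE => /andP[eE].
have [x [y [xy ee]]] := pairsP sE eE; subst e.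
rewrite !subUset !sub1set !inE.
case xW : (x \in W) => /=; case yW : (y \in W) => //= _.
  by exists x, y; rewrite xW yW.
by exists y, x; rewrite xW yW setUC.
Qed.

Lemma connected_edge F W u : connectedb F -> u \in W -> W != setT ->
  exists x y, [/\ x \in W, y \notin W & [set x; y] \in F].
Proof.
move=> /forallP cF uW WT.
have [v vW] : exists v, v \notin W.
  by apply/existsP; rewrite -negb_forall; apply: contra WT => /forallP h; apply/eqP/setP => x; rewrite inE h.
have /connectP[s ps lv] := forallP (cF u) v.
elim: s u uW ps lv => [|a s IH] u uW /=; first by move=> _ ev; rewrite ev uW in vW.
case/andP => /andP[_ ua] ps lv; case aW : (a \in W); first exact: (IH a).
by exists u, a; rewrite uW aW.
Qed.

(** A vertex set grown from one vertex always has an edge of [F] leaving it, and that edge is inside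
    the next set but not inside the previous one. *)
Lemma connected_card F : connectedb F -> n.-1 <= #|F|.
Proof.
move=> cF; have [n0|n0] := posnP n; first by rewrite {1}n0.
suff [W [W0 cW iW]] : exists W, [/\ 0 < #|W|, #|W| = n & #|W|.-1 <= ind F W].
  by move: iW; rewrite cW => iW; apply: leq_trans iW (ind_leq_card _ _).
suff H i : i < n -> exists W, [/\ 0 < #|W|, #|W| = i.+1 & i <= ind F W].
  have /H[W [W0 cW iW]] : n.-1 < n by rewrite prednK.
  by exists W; split => //; rewrite cW prednK.
elim: i => [|i IH] ilt.
  by exists [set Ordinal n0]; rewrite cards1.
have [W [W0 cW iW]] := IH (ltnW ilt).
have /set0Pn[u uW] : W != set0 by rewrite -card_gt0.
have WT : W != setT by apply/eqP => WT; move: ilt; rewrite -cW WT cardsT card_ord ltnn.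
have [x [y [xW yW xyF]]] := connected_edge cF uW WT.
exists (y |: W); rewrite cardsU1 yW cW; split => //.
rewrite -addn1; apply: leq_trans (leq_add iW (leqnn 1)) _.
rewrite addn1; apply: proper_card; apply/properP; split.
  by apply/subsetP => e; rewrite !inE => /andP[-> /= eW]; apply: subset_trans eW (subsetUr _ _).
exists [set x; y]; rewrite !inE xyF /= ?subUset ?sub1set ?inE ?xW ?eqxx ?orbT //.
Qed.

(** The Nash-Williams condition for [E] to be a union of [k] forests. *)
Definition sparse k E := [forall X, (X != set0) ==> (ind E X <= k * #|X|.-1)].

Lemma sparseP k E : reflect (forall X, X != set0 -> ind E X <= k * #|X|.-1) (sparse k E).
Proof. by apply: (iffP forallP) => h X; [move/implyP: (h X)|apply/implyP/h]. Qed.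

Lemma spanning_treeI E F : F \subset E -> connectedb F -> #|F| = n.-1 -> 0 < #|F| ->
  spanning_tree E F.
Proof.
move=> sFE cF cardF F0; apply/and3P; split => //.
apply/forall_inP => e eF; apply/negP => /connected_card.
by rewrite -cardF (cardsD1 e F) eF add1n ltnn.
Qed.

Lemma adj_subrel F F' : F \subset F' -> forall x y, connect (adj F) x y -> connect (adj F') x y.
Proof.
move=> /subsetP sF; apply: connect_sub => x y /andP[xy /sF h]; apply: connect1; by rewrite /adj xy h.
Qed.

Lemma adj_connect_sym F : connect_sym (adj F).
Proof. by apply: sym_connect_sym => x y; rewrite /adj eq_sym setUC. Qed.

(** The invariant interpolates: for [X] inside [W] it is the bound of [sparse k], wanted at the end;
    for [X] disjoint from [W] it is weaker by one than that of [sparse k.+1]. The induction is on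
    the number of vertices not yet reached. *)
Lemma peel_tree_aux k E r m W A : E \subset pairs n ->
  sparse k.+1 E -> #|E| = k.+1 * n.-1 -> #|~: W| = m ->
  A \subset E -> (forall e, e \in A -> e \subset W) -> r \in W ->
  (forall x, x \in W -> connect (adj A) r x) -> #|A| = #|W|.-1 ->
  (forall X, X != set0 -> ind (E :\: A) X + #|X :&: W| + k <= k.+1 * #|X|) ->
  exists F, [/\ F \subset E, connectedb F, #|F| = n.-1 & sparse k (E :\: F)].
Proof.
move=> sE /sparseP spE cE; elim: m W A => [|m IH] W A cW sA AW rW conn cA inv.
  have WT : W = setT by apply/eqP; rewrite -subTset -setCS setCT subset0 -cards_eq0 cW.
  exists A; split => //.
  - apply/forallP => u; apply/forallP => v.
    apply: (@connect_trans _ _ r); last by apply: conn; rewrite WT inE.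
    by rewrite adj_connect_sym; apply: conn; rewrite WT inE.
  - by rewrite cA WT cardsT card_ord.
  - apply/sparseP => X X0; have := inv X X0; rewrite WT setIT.
    have : 0 < #|X| by rewrite card_gt0.
    case: #|X| => // x _ /=; nia.
(* Adding [v] to [W] costs one unit for each set containing [v], refunded if the new edge lies in
   the set. Only sets with equality in the invariant that reach outside [W] are at risk. *)
pose crit X := [&& X != set0, ~~ (X \subset W) & k.+1 * #|X| <= ind (E :\: A) X + #|X :&: W| + k].
have W0 : 0 < #|W| by rewrite card_gt0; apply/set0Pn; exists r.
have cWn := cardsCs W; rewrite cW card_ord in cWn.
(* The edge count [k.+1 * n.-1] makes the whole vertex set tight, whatever tree has been built so
   far. *)
have critT : crit setT.
  apply/and3P; split.
  - by apply/set0Pn; exists r.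
  - by rewrite subTset; apply/negP => /eqP WT; move: cW; rewrite WT setCT cards0.
  - rewrite indT setTI cardsT card_ord cardsD (setIidPr sA) cE cA.
    have : #|W| <= n by rewrite -[X in _ <= X]card_ord max_card.
    move: #|W| W0 => w; case: (n) => [|n'] /=; nia.
have [X /minsetP[Xc minX]] := ex_minset (ex_intro crit _ critT).
have /and3P[X0 XW Xcr] := Xc.
have Xcr' := inv X X0.
pose V := X :\: W; pose Z := X :&: W.
have V0 : V != set0 by rewrite setD_eq0.
have cX : #|X| = #|Z| + #|V| by rewrite cardsID.
have indV : ind (E :\: A) V <= k.+1 * #|V|.-1.
  apply: leq_trans (spE V V0); exact: ind_sub (subsetDl _ _).
have V0' : 0 < #|V| by rewrite card_gt0.
(* Without a crossing edge, [ind X] splits over [Z] and [V]; the invariant on [Z] and the sparsity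
   of [V] then contradict the tightness of [X]. *)
have : exists u v, [/\ u \in Z, v \in V & [set u; v] \in E :\: A].
  pose EX := [set e in E :\: A | e \subset X].
  have sEX : EX \subset pairs n.
    by apply: subset_trans sE; apply/subsetP => e; rewrite !inE => /andP[/andP[]].
  have cr : 0 < cut_size EX W.
    have /= := @cut_sizeE EX W sEX.
    have -> : ind EX W = ind (E :\: A) Z.
      by apply: eq_card => e; rewrite !inE subsetI -!andbA.
    have -> : ind EX (~: W) = ind (E :\: A) V.
      by apply: eq_card => e; rewrite !inE /V setDE subsetI -!andbA.
    rewrite (_ : #|EX| = ind (E :\: A) X) // => eqX.
    case: (posnP (cut_size EX W)) => // c0; exfalso; rewrite c0 addn0 in eqX.
    have [Z0|Z0] := eqVneq Z set0.
      have ZI : ind (E :\: A) Z = 0.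
        rewrite Z0; apply/eqP; rewrite cards_eq0; apply/eqP/setP => e; rewrite !inE.
        apply/negbTE/negP => /andP[/andP[_ eE]]; rewrite subset0 => /eqP e0.
        by move/subsetP/(_ e eE): sE; rewrite e0 inE cards0.
      move: cX Xcr; rewrite -/Z eqX Z0 cards0 -Z0 ZI; move: (ind _ _) (#|V|) #|X| indV V0' => a [|v] y //=; clear; nia.
    have := inv Z Z0; rewrite {2}/Z -setIA setIid -/Z.
    have Z0' : 0 < #|Z| by rewrite card_gt0.
    move: cX Xcr Z0' indV V0'; rewrite -/Z eqX => ->; move: (ind _ V) (ind _ Z) #|Z| #|V|.
    by move=> a b z [|v] //=; clear; nia.
  have [u [v [uW vW]]] := cut_size_edge sEX cr.
  rewrite !inE subUset !sub1set => /andP[/andP[uvA uvE] /andP[uX vX]].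
  by exists u, v; rewrite !inE uX uW vW vX uvA uvE.
move=> [u [v [uZ vV uvE]]].
have [uX uW] := setIP uZ; have [vX vW] := setDP vV.
have /setDP[uvE' uvA] := uvE.
have uv : u != v by apply: contra vW => /eqP <-.
have sA' : [set u; v] |: A \subset E by rewrite subUset sub1set uvE' sA.
apply: (IH (v |: W) ([set u; v] |: A)).
- apply/eqP; rewrite -eqSS -cW (cardsD1 v (~: W)) inE vW add1n; apply/eqP; congr (_.+1).
  by apply: eq_card => x; rewrite !inE negb_or.
- exact: sA'.
- move=> e; rewrite !inE => /orP[/eqP ->|/AW eW]; last by apply: subset_trans eW (subsetUr _ _).
  by rewrite subUset !sub1set !inE uW eqxx orbT.
- by rewrite !inE rW orbT.
- have cu : forall x, x \in W -> connect (adj ([set u; v] |: A)) r x.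
    by move=> x /conn; apply: adj_subrel; exact: subsetUr.
  move=> x; rewrite !inE => /orP[/eqP ->|/cu //].
  apply: (connect_trans (cu u uW)); apply: connect1; by rewrite /adj uv !inE eqxx.
- rewrite !cardsU1 uvA vW cA; by case: #|W| W0.
- move=> Y Y0.
  have eE : E :\: A = [set u; v] |: (E :\: ([set u; v] |: A)).
    by apply/setP => e; rewrite !inE; case: (eqVneq e [set u; v]) => [->|//]; rewrite uvA uvE'.
  have := inv Y Y0; rewrite {1}eE indU1; last by rewrite !inE eqxx.
  have -> : #|Y :&: (v |: W)| = (v \in Y) + #|Y :&: W|.
    rewrite (cardsD1 v) !inE eqxx andbT; congr (_ + _).
    apply: eq_card => x; rewrite !inE; case: (eqVneq x v) => [->|//]; by rewrite (negbTE vW) andbF.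
  rewrite subUset !sub1set; case vY : (v \in Y) => /= h; last first.
    by rewrite andbF addn0 in h; rewrite add0n.
  move: h; rewrite andbT; case uY : (u \in Y) => /= h.
    by move: h; move: (ind _ _) (#|_|) => a b; clear; lia.
  rewrite addn0 in h.
  (* Equality for a set [Y] containing [v] but not [u] would pass to [X :&: Y] by supermodularity,
     against the minimality of [X], which contains [u]. *)
  suff : ind (E :\: A) Y + #|Y :&: W| + k < k.+1 * #|Y|.
    rewrite eE indU1; last by rewrite !inE eqxx.
    rewrite subUset !sub1set uY /= addn0.
    by move: (ind _ _) (#|_|) => a b; clear; lia.
  rewrite ltnNge; apply/negP => Ycr.
  have XY : crit (X :&: Y).
    have XY0 : X :&: Y != set0 by apply/set0Pn; exists v; rewrite inE vX vY.
    apply/and3P; split => //.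
      by apply/subsetPn; exists v; rewrite // inE vX vY.
    have XUY0 : X :|: Y != set0 by apply/set0Pn; exists v; rewrite inE vX.
    have := inv _ XUY0.
    have := ind_supermodular (E :\: A) X Y.
    have := cardsUI X Y.
    have := cardsUI (X :&: W) (Y :&: W).
    rewrite -setIUl setIACA setIid -/Z.
    move: Xcr Ycr.
    move: (ind _ (X :|: Y)) (ind _ (X :&: Y)) (ind _ X) (ind _ Y) => a b c d.
    move: #|Z| #|Y :&: W| #|(X :|: Y) :&: W| #|X :&: Y :&: W| #|X| #|Y| #|X :|: Y| #|X :&: Y|.
    by clear; nia.
  have /setP/(_ u) := minX _ XY (subsetIl _ _).
  by rewrite inE uX uY.
Qed.

Lemma peel_tree k E : 0 < n -> E \subset pairs n -> sparse k.+1 E -> #|E| = k.+1 * n.-1 ->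
  exists F, [/\ F \subset E, connectedb F, #|F| = n.-1 & sparse k (E :\: F)].
Proof.
move=> n0 sE spE cE; pose r := Ordinal n0.
apply: (@peel_tree_aux k E r #|~: [set r]| [set r] set0) => //.
- exact: sub0set.
- by move=> e; rewrite inE.
- by rewrite inE.
- by move=> x; rewrite inE => /eqP ->.
- by rewrite cards0 cards1.
- move=> X X0; rewrite setD0.
  have := sparseP _ _ spE X X0.
  have : #|X :&: [set r]| <= 1 by rewrite -(cards1 r) subset_leq_card // subsetIr.
  have : 0 < #|X| by rewrite card_gt0.
  case: #|X| => // x _ /=; nia.
Qed.

Lemma sparse_trees k E : 1 < n -> E \subset pairs n -> sparse k E -> #|E| = k * n.-1 ->
  has_disj_trees E k.
Proof.
move=> n1; elim: k E => [|k IH] E sE spE cE.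
  apply/existsP; exists [ffun => set0]; apply/andP; split; apply/forallP => -[].
  by [].
  by [].
have [F [sF cF cardF spF]] := peel_tree (ltnW n1) sE spE cE.
have sD : E :\: F \subset pairs n by apply: subset_trans sE; apply: subsetDl.
have cD : #|E :\: F| = k * n.-1 by rewrite cardsD (setIidPr sF) cE cardF mulSn addKn.
have /existsP[Fs /andP[/forallP st /forallP dj]] := IH _ sD spF cD.
apply/existsP; exists [ffun i : 'I_k.+1 => if unlift ord0 i is Some j then Fs j else F].
apply/andP; split.
  apply/forallP => i; rewrite ffunE; case: unliftP => [j _|_].
    have /and3P[s1 s2 s3] := st j; apply/and3P; split => //.
    by apply: subset_trans s1 (subsetDl _ _).
  by apply: spanning_treeI => //; rewrite cardF; case: (n) n1 => [|[]].
have dF j : [disjoint F & Fs j].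
  have /and3P[s1 _ _] := st j; rewrite disjoint_sym.
  apply: disjointWl s1 _; by rewrite disjoint_subset; apply/subsetP => e; rewrite !inE => /andP[].
apply/forallP => i; apply/forallP => j; apply/implyP; rewrite !ffunE.
case: unliftP => [i' ->|->]; case: unliftP => [j' ->|->] // ij.
- have := forallP (dj i') j'; move/implyP; apply; by apply: contra ij => /eqP ->.
- by rewrite disjoint_sym.
Qed.

Lemma has_disj_trees_sub E E' k : E' \subset E -> has_disj_trees E' k -> has_disj_trees E k.
Proof.
move=> sE /existsP[Fs /andP[/forallP st dj]]; apply/existsP; exists Fs; rewrite dj andbT.
apply/forallP => i; have /and3P[s1 s2 s3] := st i; apply/and3P; split => //.
exact: subset_trans s1 sE.
Qed.

(** For a maximal sparse [E'], each omitted edge lies inside a block of the partition into maximal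
    tight sets, and each block [X] holds exactly [k * #|X|.-1] edges of [E']. The hypothesis for
    this partition then forces the count. *)
Lemma max_sparse k E : 0 < n -> E \subset pairs n ->
  (forall P, partition P [set: 'I_n] -> k * #|P|.-1 + \sum_(X in P) ind E X <= #|E|) ->
  exists E', [/\ E' \subset E, sparse k E' & #|E'| = k * n.-1].
Proof.
move=> n0 sE hP.
pose good E' := (E' \subset E) && sparse k E'.
have good0 : exists E', good E'.
  exists set0; rewrite /good sub0set; apply/sparseP => X _.
  by rewrite (leq_trans (ind_leq_card _ _)) // cards0.
have [E' /maxsetP[/andP[sE' /[dup] spE' /sparseP spE'P] maxE']] := ex_maxset good0.
exists E'; split => //.
pose tight X := (X != set0) && (ind E' X == k * #|X|.-1).
have tight1 v : tight [set v].
  rewrite /tight ind1 ?cards1 ?muln0 ?eqxx ?andbT; first by apply/set0Pn; exists v; rewrite inE.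
  exact: subset_trans sE' sE.
have tightU X Y : tight X -> tight Y -> X :&: Y != set0 -> tight (X :|: Y).
  move=> /andP[X0 /eqP tX] /andP[Y0 /eqP tY] XY0; rewrite /tight.
  have XUY0 : X :|: Y != set0 by rewrite setU_eq0 negb_and X0.
  rewrite XUY0 eqn_leq spE'P //=.
  have := ind_supermodular E' X Y; have := spE'P _ XY0; have := cardsUI X Y.
  move: X0 Y0 XY0 XUY0; rewrite -!card_gt0 tX tY.
  case: #|X| => [|x] //; case: #|Y| => [|y] //; case: #|_ :&: _| => [|z] //; case: #|_ :|: _| => [|u] //=.
  nia.
(* Singletons are tight, so a largest tight set around [v] exists; by [tightU] any two of these are
   equal or disjoint. *)
pose B v := [arg max_(X > [set v] | tight X && (v \in X)) #|X|].
have BP v : [/\ tight (B v), v \in B v & forall Y, tight Y -> v \in Y -> #|Y| <= #|B v|].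
  rewrite /B; case: arg_maxnP => [|X /andP[tX vX] mX]; first by rewrite tight1 inE eqxx.
  by split => // Y tY vY; apply: mX; rewrite tY.
have Bmax v Y : tight Y -> Y :&: B v != set0 -> Y \subset B v.
  move=> tY YB; have [tB vB mB] := BP v.
  have tU := tightU _ _ tY tB YB.
  have cU := mB _ tU; rewrite inE vB orbT in cU.
  suff -> : B v = Y :|: B v by apply: subsetUl.
  by apply/eqP; rewrite eqEcard subsetUr cU.
pose P := [set B v | v in [set: 'I_n]].
have Ppart : partition P [set: 'I_n].
  apply/and3P; split.
  - rewrite eqEsubset subsetT; apply/subsetP => v _; apply/bigcupP; exists (B v).
      by apply: imset_f.
    by case: (BP v).
  - apply/trivIsetP => _ _ /imsetP[u _ ->] /imsetP[v _ ->]; apply: contraNT => nd.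
    have nd' : B u :&: B v != set0 by rewrite -setI_eq0 in nd.
    rewrite eqEsubset Bmax //; last by case: (BP u).
    by rewrite Bmax //; [case: (BP v)|rewrite setIC].
  - by apply/imsetP => -[v _ v0]; case: (BP v); rewrite -v0 inE.
(* A rejected edge would violate sparsity on some [X]; this [X] contains the edge and is already
   tight. *)
have inner e : e \in E :\: E' -> exists2 X, X \in P & e \subset X.
  rewrite inE => /andP[eE' eE].
  have : ~~ good (e |: E').
    apply/negP => g; have /setP/(_ e) := maxE' _ g (subsetUr _ _).
    by rewrite !inE eqxx (negbTE eE').
  rewrite /good subUset sub1set eE sE' /= => /forallPn[X]; rewrite negb_imply => /andP[X0].
  rewrite -ltnNge indU1 // => lt.
  have le := spE'P X X0.
  have eX : e \subset X by case: (e \subset X) lt => //; rewrite addn0 ltnNge le.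
  have tX : tight X by rewrite /tight X0 eqn_leq le /=; move: lt; rewrite eX addn1 ltnS.
  have [a [b [ab ee]]] := pairsP sE eE.
  have aX : a \in X by move: eX; rewrite ee subUset !sub1set => /andP[].
  exists (B a); first exact: imset_f.
  apply: subset_trans eX _; apply: Bmax => //; apply/set0Pn; exists a; rewrite inE aX.
  by case: (BP a).
have cD : #|E :\: E'| <= \sum_(X in P) ind (E :\: E') X.
  apply: leq_trans (_ : #|\bigcup_(X in P) [set e in E :\: E' | e \subset X]| <= _).
    apply/subset_leq_card/subsetP => e /[dup] /inner[X XP eX] eD.
    by apply/bigcupP; exists X => //; rewrite inE eD.
  elim/big_rec2: _ => [|X y A XP IH]; first by rewrite cards0.
  by apply: leq_trans (leq_card_setU _ _) _; rewrite leq_add2l.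
have Tsum : \sum_(X in P) ind E X = \sum_(X in P) ind E' X + \sum_(X in P) ind (E :\: E') X.
  by rewrite -big_split; apply: eq_bigr => X _; apply: indD.
have tsum : \sum_(X in P) ind E' X + k * #|P| = k * n.
  rewrite -[X in _ = _ * X](card_ord n) -cardsT (card_partition Ppart) big_distrr /=.
  rewrite -sum1_card big_distrr -big_split /=; apply: eq_bigr => _ /imsetP[v _ ->].
  have [/andP[B0 /eqP ->] _ _] := BP v.
  by rewrite -mulnDr addn1 prednK // card_gt0.
have P0 : 0 < #|P|.
  rewrite card_gt0; apply/set0Pn; exists (B (Ordinal n0)); exact: imset_f.
have nX0 : [set: 'I_n] != set0 by apply/set0Pn; exists (Ordinal n0).
have := spE'P _ nX0; rewrite indT cardsT card_ord => up.
apply/eqP; rewrite eqn_leq up /=.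
have := hP _ Ppart; rewrite Tsum.
have := cardsD E E'; rewrite (setIidPr sE').
have := subset_leq_card sE'.
move: P0 cD tsum up; move: #|P| (\sum_(_ in _) _) (\sum_(_ in _) ind (_ :\: _) _) #|E :\: E'| #|E| #|E'| => q a b c d e.
case: q => [|q] //= _; move: n n0 => [|n'] //= _; clear; nia.
Qed.

Lemma tree_packing k E : 1 < n -> E \subset pairs n ->
  (forall P, partition P [set: 'I_n] -> k * #|P|.-1 + \sum_(X in P) ind E X <= #|E|) ->
  has_disj_trees E k.
Proof.
move=> n1 sE hP; have [E' [sE' spE' cE']] := max_sparse (ltnW n1) sE hP.
apply: (has_disj_trees_sub sE'); apply: sparse_trees => //.
exact: subset_trans sE' sE.
Qed.

End TreePacking.

(** * Trees from sparse parts and well separated low degree vertices *)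

Section Packing.
Variable n : nat.
Implicit Types (E F L H : {set {set 'I_n}}) (X Y W U : {set 'I_n}).

(** Double counting: an edge lies in at most one member of the family. With [D] a star this bounds
    [k] by a degree, with [D] everything by the number of edges. *)
Lemma disjoint_family_card k E (D : {set {set 'I_n}}) (Fs : 'I_k -> {set {set 'I_n}}) :
  (forall i, Fs i \subset E) -> (forall i j, i != j -> [disjoint Fs i & Fs j]) ->
  \sum_i #|Fs i :&: D| <= #|E :&: D|.
Proof.
move=> sF dF; under eq_bigr do rewrite -sum1_card big_mkcond /=.
rewrite exchange_big /= -sum1_card [X in _ <= X]big_mkcond leq_sum // => e _.
case: (pickP [pred i | e \in Fs i]) => [i /= ei|h]; last first.
  by rewrite big1 // => i _; rewrite inE; have /= -> := h i.
rewrite (bigD1 i) //= big1 ?addn0; last first.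
  move=> j ji; rewrite inE; case ej: (e \in Fs j) => //=.
  by have /disjointFr/(_ ej) := dF j i ji; rewrite ei.
by rewrite !inE ei /= (subsetP (sF i) _ ei).
Qed.

Lemma has_disj_trees_deg k E v : 1 < n -> has_disj_trees E k -> k <= deg E v.
Proof.
move=> n1 /existsP[Fs /andP[/forallP st /forallP dj]].
pose D := [set e : {set 'I_n} | v \in e].
have -> : deg E v = #|E :&: D| by apply: eq_card => e; rewrite !inE.
apply: leq_trans (@disjoint_family_card k E D Fs _ _); first last.
- by move=> i j ij; apply: (implyP (forallP (dj i) j)).
- by move=> i; case/and3P: (st i).
rewrite -[X in X <= _](card_ord k) -sum1_card; apply: leq_sum => i _.
have /and3P[_ cF _] := st i.
have [||x [y [xv _ xyF]]] := @connected_edge _ _ [set v] v cF; first by rewrite inE.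
  by apply/eqP => /(congr1 (fun X : {set 'I_n} => #|X|)); rewrite cards1 cardsT card_ord => n1'; rewrite -n1' in n1.
rewrite card_gt0; apply/set0Pn; exists [set x; y]; rewrite !inE xyF /=.
by move: xv; rewrite inE => /eqP ->; rewrite eqxx.
Qed.

Lemma has_disj_trees_card k E : has_disj_trees E k -> k * n.-1 <= #|E|.
Proof.
move=> /existsP[Fs /andP[/forallP st /forallP dj]].
rewrite -[E in X in _ <= X]setIT; apply: leq_trans (@disjoint_family_card k E setT Fs _ _); first last.
- by move=> i j ij; apply: (implyP (forallP (dj i) j)).
- by move=> i; case/and3P: (st i).
rewrite -[X in X * _](card_ord k) -sum_nat_const; apply: leq_sum => i _.
by rewrite setIT; have /and3P[_ cF _] := st i; apply: connected_card.
Qed.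

Lemma mindeg_le E v : mindeg E <= deg E v.
Proof.
rewrite /mindeg; have : v \in index_enum 'I_n by rewrite mem_index_enum.
elim: (index_enum _) => // a s IH; rewrite inE big_cons geq_min => /orP[/eqP ->|/IH ->].
  by rewrite leqnn.
by rewrite orbT.
Qed.

(** The assumption [k <= n] takes care of the seed [n] of the minimum. *)
Lemma mindeg_ge E k : k <= n -> (forall v, k <= deg E v) -> k <= mindeg E.
Proof. by move=> kn h; rewrite /mindeg; elim/big_ind: _ => // x y kx ky; rewrite leq_min kx. Qed.

Lemma card_star v : #|[set e in pairs n | v \in e]| = n.-1.
Proof.
have -> : [set e in pairs n | v \in e] = [set [set v; w] | w in [set~ v]].
  apply/setP => e; rewrite !inE; apply/andP/imsetP => [[/cards2P[x [y [xy ->]]]]|[w]].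
    rewrite !inE => /orP[/eqP ->|/eqP ->]; first by exists y; rewrite // !inE eq_sym.
    by exists x; rewrite ?inE // setUC.
  by rewrite !inE => wv ->; rewrite cards2 (eq_sym v) wv !inE eqxx.
rewrite card_in_imset; first by rewrite cardsC1 card_ord.
move=> x y; rewrite !inE => xv yv /setP/(_ x).
by rewrite !inE eqxx orbT (negbTE xv) => /esym/eqP.
Qed.

Lemma deg_lt E v : E \subset pairs n -> deg E v < n.
Proof.
move=> /subsetP sE; have n0 : 0 < n by case: (n) v => [[]|].
rewrite -[X in _ < X](prednK n0) ltnS -(card_star v); apply/subset_leq_card/subsetP => e.
by rewrite !inE => /andP[/sE]; rewrite inE => -> ->.
Qed.

Lemma Tnum_le_mindeg E : 1 < n -> E \subset pairs n -> Tnum E <= mindeg E.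
Proof.
move=> n1 sE; apply/bigmax_leqP => k hk.
apply: mindeg_ge => [|v]; last exact: has_disj_trees_deg.
apply: leq_trans (has_disj_trees_deg (Ordinal n1) n1 hk) (ltnW (deg_lt _ sE)).
Qed.

Lemma Tnum_le_density E : 1 < n -> Tnum E <= #|E| %/ n.-1.
Proof.
move=> n1; apply/bigmax_leqP => k hk; rewrite leq_divRL; first exact: has_disj_trees_card.
by case: (n) n1 => [|[]].
Qed.

Lemma Tnum_ge E k : 1 < n -> has_disj_trees E k -> k <= Tnum E.
Proof.
(* The index range in [Tnum] is wide enough because [k <= k * n.-1 <= #|E|]. *)
move=> n1 hk; have kE : k < #|E|.+2.
  rewrite ltnS; apply: leqW; apply: leq_trans (has_disj_trees_card hk).
  by rewrite leq_pmulr //; case: (n) n1 => [|[]].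
exact: (@leq_bigmax_cond _ _ (fun i : 'I_#|E|.+2 => i : nat) (Ordinal kE)).
Qed.

Lemma sum_deg E U : E \subset pairs n -> \sum_(v in U) deg E v = 2 * ind E U + cut_size E U.
Proof.
move=> sE; rewrite /deg; under eq_bigr do rewrite -sum1_card big_mkcond /=.
rewrite exchange_big /= /ind /cut_size -!sum1_card big_distrr /= [X in _ = X + _]big_mkcond /=.
rewrite [X in _ = _ + X]big_mkcond -big_split /=; apply: eq_bigr => e _.
rewrite -big_mkcondr /= !inE; case eE : (e \in E) => /=; last first.
  by rewrite big_pred0 // => v; rewrite !inE eE andbF.
have [x [y [xy ee]]] := pairsP sE eE.
rewrite {2 3 4}ee !subUset !sub1set !inE.
rewrite (eq_bigl (fun v => (v \in U) && ((v == x) || (v == y)))); last first.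
  by move=> v; rewrite inE eE ee !inE.
rewrite big_mkcondl /= (bigD1 x) ?eqxx //= (bigD1 y) /=; last by rewrite eqxx orbT eq_sym xy.
rewrite big1 => [|v /andP[/andP[/orP[->//|/eqP ->] _]]]; last by rewrite eqxx.
by case: (x \in U); case: (y \in U).
Qed.

Lemma cut_sizeC E X : cut_size E (~: X) = cut_size E X.
Proof. by apply: eq_card => e; rewrite !inE setCK andbCA andbC -andbA andbC; case: (e \in E); case: (e \subset X); case: (e \subset ~: X). Qed.

Lemma sum_ind_le E (P : {set {set 'I_n}}) : E \subset pairs n -> trivIset P ->
  \sum_(Y in P) ind E Y <= ind E (cover P).
Proof.
move=> sE tP; rewrite /ind; under eq_bigr do rewrite -sum1_card big_mkcond /=.
rewrite exchange_big /= -sum1_card [X in _ <= X]big_mkcond; apply: leq_sum => e _.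
rewrite !inE; case eE : (e \in E) => /=; last by rewrite big1 // => Y _; rewrite inE eE.
have [x [y [xy ee]]] := pairsP sE eE.
have [Y YP|h] := pickP [pred Y | (Y \in P) && (e \subset Y)]; last first.
  by rewrite big1 // => Y YP; rewrite inE eE /=; have := h Y; rewrite /= YP /= => ->.
have /andP[/= YP' eY] := YP.
rewrite (bigD1 Y) //= big1 ?addn0 => [|Z /andP[ZP ZY]].
  rewrite inE eE eY; apply: leq_trans (_ : 1 <= _) => //; rewrite ifT //.
  by apply: subset_trans eY _; apply: (bigcup_max Y).
rewrite inE eE /=; case: ifP => // eZ.
have := trivIsetP tP _ _ YP' ZP; rewrite eq_sym ZY => /(_ isT)/disjointFr.
move: eY eZ; rewrite ee !subUset !sub1set => /andP[xY _] /andP[xZ _].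
by move=> /(_ _ xY); rewrite xZ.
Qed.

Definition isolated_low E (theta : nat) :=
  (forall u v, deg E u < theta -> deg E v < theta -> u != v -> [set u; v] \notin E) /\
  (forall u v w, deg E u < theta -> deg E v < theta -> u != v ->
     [set u; w] \in E -> [set v; w] \notin E).

(** A high vertex of [U] has at most one low neighbour and low vertices are not adjacent, so [U]
    spans at most [(t + 1) * #|Hi|] edges. The surplus [2 * t + 2] in the degree of each high vertex
    pays for counting these twice. *)
Lemma cut_size_ge E k t U : E \subset pairs n -> (forall v, k <= deg E v) ->
  (forall X, #|X| <= #|U| -> ind E X <= t * #|X|) ->
  isolated_low E (k + 2 * t + 2) -> k * #|U| <= cut_size E U.
Proof.
move=> sE kdeg small [nadj nocom].
pose th := k + 2 * t + 2.
pose Lo := U :&: [set v | deg E v < th]; pose Hi := U :\: [set v | deg E v < th].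
have cU : #|U| = #|Lo| + #|Hi| by rewrite cardsID.
have sumU : k * #|Lo| + th * #|Hi| <= \sum_(v in U) deg E v.
  rewrite (bigID (mem [set v | deg E v < th])) /= ![_ * #|_|]mulnC -!sum_nat_const.
  apply: leq_add.
    rewrite [X in _ <= X](eq_bigl (mem Lo)); first by apply: leq_sum => v _.
    by move=> v; rewrite !inE.
  rewrite [X in _ <= X](eq_bigl (mem Hi)); last by move=> v; rewrite !inE andbC.
  by apply: leq_sum => v; rewrite !inE -leqNgt => /andP[].
have indU : ind E U <= ind E Hi + #|Hi|.
  pose C (h : 'I_n) := [set e in E | (h \in e) && [exists l in Lo, l \in e]].
  have C1 h : h \in Hi -> #|C h| <= 1.
    move=> hHi; apply/card_le1_eqP.
    have low e : e \in C h -> exists2 l, deg E l < th & e = [set l; h].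
      rewrite inE => /and3P[eE he /exists_inP[l]]; rewrite !inE => /andP[lU lth] le.
      exists l => //; have [x [y [xy ee]]] := pairsP sE eE.
      have hl : (h == l) = false by apply/eqP => hl; move: hHi; rewrite !inE hl lth.
      move: he le hl; rewrite ee !inE => /orP[] /eqP -> /orP[] /eqP ->; rewrite ?eqxx //.
      by rewrite setUC.
    move=> e f eC fC; have [l lth el] := low e eC; have [l' lth' fl] := low f fC.
    rewrite el fl; have [->//|ll'] := eqVneq l l'.
    have eE : [set l; h] \in E by rewrite -el; move: eC; rewrite inE => /andP[].
    have fE : [set l'; h] \in E by rewrite -fl; move: fC; rewrite inE => /andP[].
    by have := nocom _ _ _ lth lth' ll' eE; rewrite fE.
  have sub : [set e in E | e \subset U] \subset
      [set e in E | e \subset Hi] :|: \bigcup_(h in Hi) C h.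
    apply/subsetP => e; rewrite !inE => /andP[eE eU]; rewrite eE /=.
    have [//|/= eHi] := boolP (e \subset Hi).
    have [x [y [xy ee]]] := pairsP sE eE.
    have key a b : a != b -> e = [set a; b] -> a \notin Hi -> e \in \bigcup_(h in Hi) C h.
      move=> ab eab aHi; move: eU; rewrite eab subUset !sub1set => /andP[aU bU].
      have alo : deg E a < th by move: aHi; rewrite !inE aU andbT negbK.
      have bHi : b \in Hi.
        rewrite !inE bU andbT; apply/negP => blo.
        by have := nadj _ _ alo blo ab; rewrite -eab eE.
      apply/bigcupP; exists b => //; rewrite inE -eab eE /=; apply/andP; split.
        by rewrite eab !inE eqxx orbT.
      by apply/exists_inP; exists a; rewrite ?eab !inE ?aU ?alo ?eqxx.
    move: eHi; rewrite {1}ee subUset !sub1set negb_and => /orP[xHi|yHi]; first exact: key ee xHi.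
    by apply: key yHi; [rewrite eq_sym; exact: xy|rewrite setUC].
  apply: leq_trans (subset_leq_card sub) _.
  apply: leq_trans (leq_card_setU _ _) _; rewrite leq_add2l -[#|Hi|]sum1_card.
  elim/big_rec2: _ => [|h y A hHi IH]; first by rewrite cards0.
  by apply: leq_trans (leq_card_setU _ _) _; apply: leq_add (C1 h hHi) IH.
have := small Hi _; rewrite subset_leq_card ?subsetDl // => /(_ isT) indHi.
move: sumU indU indHi; rewrite sum_deg // cU /th.
move: (cut_size _ _) (ind _ _) (ind _ _) #|Lo| #|Hi| => a b c x y; clear; nia.
Qed.

(** If some part has more than [n - s0] vertices, its complement [U] is small, the remaining parts
    number at most [#|U|], and [k * #|U|] edges leave [U]. Otherwise the density bound applies to
    every part and is summed. *)
Lemma packing_criterion E k t s0 : 1 < n -> E \subset pairs n ->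
  k * n.-1 <= #|E| -> (forall v, k <= deg E v) ->
  (forall X, #|X| <= s0 -> ind E X <= t * #|X|) ->
  (forall X, X != set0 -> #|X| <= n - s0 -> ind E X * n.-1 <= #|E| * #|X|.-1) ->
  isolated_low E (k + 2 * t + 2) -> has_disj_trees E k.
Proof.
move=> n1 sE kE kdeg small mid iso; apply: tree_packing => // P Ppart.
have /and3P[/eqP covP tP P0] := Ppart.
have sumn := card_partition Ppart; rewrite cardsT card_ord in sumn.
have [X /andP[XP Xbig]|nobig] := pickP [pred X | (X \in P) && (n - s0 < #|X|)].
  have Pd : partition (P :\ X) (~: X).
    have := partitionD1 Ppart XP; by rewrite setTD.
  have := card_partition Pd => sumX.
  have le1 : #|P|.-1 <= #|~: X|.
    rewrite (cardsD1 X) XP add1n /= sumX -sum1_card; apply: leq_sum => Y.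
    rewrite inE => /andP[_ YP]; rewrite card_gt0; apply: contra P0 => /eqP <-.
    exact: YP.
  have cX := cardsCs X; rewrite card_ord in cX.
  have Xn : #|X| <= n by rewrite -[X in _ <= X]card_ord max_card.
  have cU : #|~: X| <= s0 by rewrite cX in Xbig Xn; move: Xbig; move: #|~: X| => c; clear; lia.
  have crsU : k * #|~: X| <= cut_size E (~: X).
    by apply: (@cut_size_ge E k t) => // Y YX; apply: small; apply: leq_trans YX cU.
  rewrite (bigD1 X) //= [#|E|](cut_sizeE X sE) -cut_sizeC.
  have : \sum_(Y in P | Y != X) ind E Y <= ind E (~: X).
    have /and3P[/eqP <- tPd _] := Pd.
    apply: leq_trans (sum_ind_le sE tPd).
    by rewrite leq_eqVlt; apply/orP; left; apply/eqP/eq_bigl => Y; rewrite !inE andbC.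
  have : k * #|P|.-1 <= k * #|~: X| by rewrite leq_mul2l le1 orbT.
  move: crsU; move: (k * _) (k * _) (cut_size _ _) (ind _ _) (ind _ _) (\sum_(_ in _ | _) _); clear; lia.
(* With no huge part, the parts together span at most the fraction [(n - #|P|) / n.-1] of the edges;
   the rest is at least [k * #|P|.-1] since [k * n.-1 <= #|E|]. *)
have n1' : 0 < n.-1 by case: (n) n1 => [|[]].
rewrite -(leq_pmul2r n1') mulnDl big_distrl /=.
have le2 : \sum_(X in P) ind E X * n.-1 <= \sum_(X in P) #|E| * #|X|.-1.
  apply: leq_sum => X XP; apply: mid; first by apply: contra P0 => /eqP <-.
  by rewrite leqNgt; have := nobig X; rewrite /= XP /= => ->.
have e2 : \sum_(X in P) #|E| * #|X|.-1 + #|E| * #|P| = #|E| * \sum_(X in P) #|X|.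
  rewrite -[#|P|]sum1_card big_distrr -big_split /= big_distrr /=.
  apply: eq_bigr => X XP; rewrite -mulnDr addn1 prednK // card_gt0.
  by apply: contra P0 => /eqP <-.
have Pn0 : 0 < #|P|.
  rewrite card_gt0; apply/eqP => Pe; move: sumn; rewrite Pe big_set0 => n00; by rewrite n00 in n1.
have e3 : k * n.-1 * #|P|.-1 <= #|E| * #|P|.-1 by rewrite leq_mul2r kE orbT.
move: le2 e2 e3; rewrite -sumn mulnAC; move: (\sum_(_ in _) _) (\sum_(_ in _) _) => a b.
move: (k * _ * _) => c; move: #|P| Pn0 #|E| => q q0 e.
move: n n1' => [|n'] //= _; move: q q0 => [|q] //= _; clear; nia.
Qed.

End Packing.

(** * Random subsets *)

Local Open Scope ring_scope.

Section Bernoulli.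
Variables (R : realType) (p : R).

(** The ground set is explicit so that independence becomes a splitting of [A] into disjoint
    pieces. *)
Definition expect (T : finType) (A : {set T}) (f : {set T} -> R) : R :=
  \sum_(E : {set T} | E \subset A) p ^+ #|E| * (1 - p) ^+ (#|A| - #|E|) * f E.

Definition bin (N i : nat) : R := 'C(N, i)%:R * p ^+ i * (1 - p) ^+ (N - i).

(** The inequality is strict: this is P(Bin(N, p) < j), so [cdf N j.+1] includes the value [j]. *)
Definition cdf (N j : nat) : R := \sum_(i < j) bin N i.

Section General.
Variable T : finType.
Implicit Types (A B E F S : {set T}) (f g : {set T} -> R).

Lemma eq_expect A f g : (forall E, E \subset A -> f E = g E) -> expect A f = expect A g.
Proof. by move=> fg; apply: eq_bigr => E EA; rewrite fg. Qed.

Lemma expectD A f g : expect A (fun E => f E + g E) = expect A f + expect A g.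
Proof. by rewrite -big_split; apply: eq_bigr => E _; rewrite mulrDr. Qed.

Lemma expectZ A c f : expect A (fun E => c * f E) = c * expect A f.
Proof. by rewrite big_distrr; apply: eq_bigr => E _ /=; rewrite mulrCA. Qed.

Lemma expect_sum A (I : Type) (r : seq I) (P : pred I) (F : I -> {set T} -> R) :
  expect A (fun E => \sum_(i <- r | P i) F i E) = \sum_(i <- r | P i) expect A (F i).
Proof.
rewrite /expect exchange_big /=; apply: eq_bigr => E _; by rewrite big_distrr.
Qed.

(** Fubini for disjoint ground sets, the source of the independence statements below. *)
Lemma expect_split A B f : [disjoint A & B] ->
  expect (A :|: B) f = expect A (fun E => expect B (fun F => f (E :|: F))).
Proof.
move=> dAB; rewrite /expect.
under [RHS]eq_bigr do rewrite big_distrr /=.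
rewrite pair_big /=.
rewrite (reindex_onto (fun P : {set T} * {set T} => P.1 :|: P.2) (fun E => (E :&: A, E :&: B))) /=; last first.
  by move=> E EAB; rewrite -setIUr; apply/setIidPl.
have IAB : A :&: B = set0 by apply/eqP; rewrite setI_eq0.
apply: eq_big => [[E F] /=|[E F] /=].
  apply/andP/andP => [[EF /eqP[e1 e2]]|[EA FB]].
    by rewrite -e1 -e2 !subsetIr.
  split; first by rewrite setUSS.
  rewrite !setIUl (setIidPl EA) (setIidPl FB).
  have -> : F :&: A = set0 by apply/eqP; rewrite -subset0 -IAB setIC; apply: setIS.
  have -> : E :&: B = set0 by apply/eqP; rewrite -subset0 -IAB; apply: setSI.
  by rewrite setU0 set0U.
move=> /andP[EF /eqP[e1 e2]].
have EA : E \subset A by rewrite -e1 subsetIr.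
have FB : F \subset B by rewrite -e2 subsetIr.
have cEF : #|E :|: F| = (#|E| + #|F|)%N.
  rewrite cardsU (_ : E :&: F = set0) ?cards0 ?subn0 //.
  by apply/eqP; rewrite -subset0 -IAB setISS.
have cAB : #|A :|: B| = (#|A| + #|B|)%N by rewrite cardsU IAB cards0 subn0.
rewrite cEF cAB.
have lE := subset_leq_card EA; have lF := subset_leq_card FB.
have -> : (#|A| + #|B| - (#|E| + #|F|) = (#|A| - #|E|) + (#|B| - #|F|))%N.
  by move: lE lF; clear; lia.
rewrite !exprD; ring.
Qed.

Lemma expect_card A (g : nat -> R) :
  expect A (fun E => g #|E|) = \sum_(i < #|A|.+1) bin #|A| i * g i.
Proof.
rewrite /expect.
rewrite (partition_big (fun E : {set T} => inord #|E| : 'I_#|A|.+1) xpredT) //=.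
apply: eq_bigr => i _.
rewrite (eq_bigr (fun _ => p ^+ i * (1 - p) ^+ (#|A| - i) * g i)); last first.
  by move=> E /andP[EA /eqP <-]; rewrite inordK // ltnS subset_leq_card.
rewrite sumr_const -mulr_natl /bin -!mulrA; congr (_%:R * _).
rewrite -(cards_draws A i) -[RHS]cardsE; apply: eq_card => E; rewrite !inE.
rewrite /in_mem /=; case EA : (E \subset A) => //=.
by rewrite -val_eqE /= inordK // ltnS subset_leq_card.
Qed.

Lemma expect_expr A (x : R) : expect A (fun E => x ^+ #|E|) = (1 - p + p * x) ^+ #|A|.
Proof.
rewrite expect_card exprDn; apply: eq_bigr => i _.
rewrite /bin exprMn -mulr_natl; ring.
Qed.

Lemma expect_const A c : expect A (fun=> c) = c.
Proof.
have -> : expect A (fun=> c) = c * expect A (fun E => 1 ^+ #|E|).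
  by rewrite -expectZ; apply: eq_expect => E _; rewrite expr1n mulr1.
by rewrite expect_expr mulr1 subrK expr1n mulr1.
Qed.

Lemma expect_cdf A j : expect A (fun E => (#|E| < j)%:R) = cdf #|A| j.
Proof.
rewrite (expect_card A (fun i => (i < j)%:R)) /cdf.
rewrite (eq_bigr (fun i : 'I_#|A|.+1 => if (i < j)%N then bin #|A| i else 0)); last first.
  by move=> i _; case: ifP; rewrite (mulr1, mulr0).
rewrite -(big_mkord xpredT (fun i => if (i < j)%N then bin #|A| i else 0)) -[RHS](big_mkord xpredT).
(* Both sums are compared with one up to [m]: beyond [#|A|] the binomial coefficients vanish, beyond
   [j] the indicator does. *)
set m := maxn #|A|.+1 j.
transitivity (\sum_(0 <= i < m) (if (i < j)%N then bin #|A| i else 0)).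
  rewrite [RHS](big_cat_nat (n := #|A|.+1)) ?leq_maxl //= [X in _ = _ + X]big_nat_cond.
  rewrite [X in _ = _ + X]big1 ?addr0 // => i /andP[/andP[Ai _] _].
  by rewrite /bin bin_small // !mul0r; case: ifP.
rewrite (big_cat_nat (n := j)) ?leq_maxr //= [X in _ + X]big_nat_cond.
rewrite [X in _ + X]big1 ?addr0 => [|i /andP[/andP[ji _] _]]; last by rewrite ltnNge ji.
by rewrite big_nat_cond [RHS]big_nat_cond; apply: eq_bigr => i /andP[/andP[_ ->]].
Qed.

Lemma expect_restrict A B f : B \subset A -> expect A (fun E => f (E :&: B)) = expect B f.
Proof.
move=> BA; have -> : A = B :|: (A :\: B).
  by apply/setP => x; rewrite !inE; case xB : (x \in B) => //=; rewrite (subsetP BA).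
have dB : [disjoint B & A :\: B].
  by rewrite -setI_eq0; apply/eqP/setP => x; rewrite !inE; case: (x \in B).
rewrite expect_split //; apply: eq_expect => E EB; rewrite -[RHS](expect_const (A :\: B)); apply: eq_expect => F FA.
rewrite setIUl (setIidPl EB) (_ : F :&: B = set0) ?setU0 //.
apply/eqP; rewrite setI_eq0; apply: disjointWl FA _.
by rewrite disjoint_sym.
Qed.

Hypothesis p01 : 0 <= p <= 1.

Lemma ler_expect A f g : (forall E, E \subset A -> f E <= g E) -> expect A f <= expect A g.
Proof.
move=> fg; apply: ler_sum => E EA; apply: ler_wpM2l (fg E EA).
by case/andP: p01 => p0 p1; rewrite mulr_ge0 // exprn_ge0 // subr_ge0.
Qed.

Lemma expect_ge0 A f : (forall E, E \subset A -> 0 <= f E) -> 0 <= expect A f.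
Proof. by move=> f0; rewrite -(expect_const A 0); apply: ler_expect. Qed.

(** In the applications [A0] holds the edges required to be present, and [A1], [A2] are what remains
    of two stars. *)
Lemma expect_indep A A0 A1 A2 f g : A0 \subset A -> A1 \subset A -> A2 \subset A ->
  [disjoint A0 & A1] -> [disjoint A0 & A2] -> [disjoint A1 & A2] ->
  expect A (fun E => (A0 \subset E)%:R * f (E :&: A1) * g (E :&: A2)) =
  p ^+ #|A0| * expect A1 f * expect A2 g.
Proof.
move=> s0 s1 s2 d01 d02 d12.
pose h (E : {set T}) := (A0 \subset E)%:R * f (E :&: A1) * g (E :&: A2).
pose B := A0 :|: (A1 :|: A2).
rewrite (@eq_expect _ _ (fun E => h (E :&: B))); last first.
  move=> E _; rewrite /h -!setIA (setIidPr (_ : A1 \subset B)) ?(setIidPr (_ : A2 \subset B)).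
  - by rewrite subsetI subsetUl andbT.
  - by rewrite /B setUA subsetUr.
  - by rewrite /B setUC -setUA subsetUl.
rewrite expect_restrict; last by rewrite !subUset s0 s1.
have I0 (X Y : {set T}) : [disjoint X & Y] -> X :&: Y = set0 by move=> d; apply/eqP; rewrite setI_eq0.
rewrite /B expect_split; last by rewrite -setI_eq0 setIUr !I0 // setU0.
have -> : p ^+ #|A0| = expect A0 (fun E => (A0 \subset E)%:R).
  rewrite /expect (bigD1 A0) //= subxx subnn mulr1 expr0 mulr1 big1 ?addr0 // => E /andP[EA].
  by rewrite eqEsubset EA /= => /negbTE ->; rewrite mulr0.
transitivity (expect A0 (fun E0 => expect A1 (fun E1 => expect A2 (fun E2 =>
    (A0 \subset E0)%:R * f E1 * g E2)))); last first.
  transitivity (expect A0 (fun E0 => (expect A1 f * expect A2 g) * (A0 \subset E0)%:R)); last by rewrite expectZ; ring.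
  apply: eq_expect => E0 _; set c := _%:R.
  transitivity (expect A1 (fun E1 => (c * expect A2 g) * f E1)); last by rewrite expectZ; ring.
  by apply: eq_expect => E1 _; rewrite expectZ; ring.
apply: eq_expect => E0 sE0; rewrite expect_split //; apply: eq_expect => E1 sE1; apply: eq_expect => E2 sE2.
have sub0 (X Y X' Y' : {set T}) : [disjoint X & Y] -> X' \subset X -> Y' \subset Y -> X' :&: Y' = set0.
  by move=> d sX sY; apply/eqP; rewrite setI_eq0; apply: disjointWl sX _; apply: disjointWr sY _.
have e1 : (E0 :|: (E1 :|: E2)) :&: A1 = E1.
  by rewrite !setIUl (sub0 _ _ _ _ d01) // (setIidPl sE1) [E2 :&: A1]setIC (sub0 _ _ _ _ d12) // setU0 set0U.
have e2 : (E0 :|: (E1 :|: E2)) :&: A2 = E2.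
  by rewrite !setIUl (sub0 _ _ _ _ d02) // (setIidPl sE2) (sub0 _ _ _ _ d12) // !set0U.
have e0 : (A0 \subset E0 :|: (E1 :|: E2)) = (A0 \subset E0).
  apply/idP/idP => [h0|h0]; last by apply: subset_trans h0 (subsetUl _ _).
  apply/subsetP => x xA; have := subsetP h0 x xA; rewrite !inE => /orP[//|/orP[x1|x2]].
    by have := disjointFr d01 xA; rewrite (subsetP sE1).
  by have := disjointFr d02 xA; rewrite (subsetP sE2).
by rewrite /h e0 e1 e2.
Qed.

(** The moment generating function is exactly a power of [1 + p * (expR l - 1)], and
    [1 + y <= expR y]. *)
Lemma expect_expR A S (l : R) : S \subset A ->
  expect A (fun E => expR (l * #|E :&: S|%:R)) <= expR (#|S|%:R * p * (expR l - 1)).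
Proof.
move=> SA; rewrite (@eq_expect _ _ (fun E => (fun F : {set T} => expR l ^+ #|F|) (E :&: S))); last first.
  by move=> E _; rewrite mulrC expRM_natl.
rewrite (expect_restrict (fun F : {set T} => expR l ^+ #|F|) SA) expect_expr -mulrA expRM_natl.
case/andP: p01 => p0 p1; apply: lerXn2r; rewrite ?nnegrE ?expR_ge0 //.
  by rewrite addr_ge0 ?subr_ge0 // mulr_ge0 ?expR_ge0.
have := expR_ge1Dx (p * (expR l - 1)); lra.
Qed.

(** Markov's inequality for the exponential moment; the tilt [l] stays free, to be chosen at each
    use. *)
Lemma chernoff_ge A S (l a : R) : S \subset A -> 0 <= l ->
  expect A (fun E => (a <= #|E :&: S|%:R :> R)%R%:R) <= expR (- l * a + #|S|%:R * p * (expR l - 1)).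
Proof.
move=> SA l0; rewrite expRD.
apply: le_trans (_ : expect A (fun E => expR (- l * a) * expR (l * #|E :&: S|%:R)) <= _).
  apply: ler_expect => E _; rewrite -expRD; have [aE|_] := boolP (a <= #|E :&: S|%:R); last exact: expR_ge0.
  rewrite -[X in X <= _]expR0 ler_expR; have := ler_wpM2l l0 aE; lra.
by rewrite expectZ; apply: ler_wpM2l; [exact: expR_ge0|exact: expect_expR].
Qed.

Lemma chernoff_le A S (l a : R) : S \subset A -> 0 <= l ->
  expect A (fun E => (#|E :&: S|%:R <= a :> R)%R%:R) <= expR (l * a + #|S|%:R * p * (expR (- l) - 1)).
Proof.
move=> SA l0; rewrite expRD.
apply: le_trans (_ : expect A (fun E => expR (l * a) * expR (- l * #|E :&: S|%:R)) <= _).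
  apply: ler_expect => E _; rewrite -expRD; have [aE|_] := boolP (#|E :&: S|%:R <= a); last exact: expR_ge0.
  rewrite -[X in X <= _]expR0 ler_expR; have := ler_wpM2l l0 aE; lra.
by rewrite expectZ; apply: ler_wpM2l; [exact: expR_ge0|exact: expect_expR].
Qed.

End General.

Lemma cdf0 N : cdf N 0 = 0. Proof. by rewrite /cdf big_ord0. Qed.

Lemma cdfS N j : cdf N j.+1 = cdf N j + bin N j.
Proof. by rewrite /cdf big_ord_recr. Qed.

Lemma bin0 N : bin N 0 = (1 - p) ^+ N. Proof. by rewrite /bin bin0 expr0 subn0 !mul1r. Qed.

Lemma binS N i : bin N.+1 i.+1 = (1 - p) * bin N i.+1 + p * bin N i.
Proof.
rewrite /bin binS natrD subSS; have [iN|Ni] := ltnP i N.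
  have -> : (N - i = (N - i.+1).+1)%N by lia.
  rewrite !exprS; ring.
rewrite bin_small // !exprS; ring.
Qed.

(** Conditioning on one trial. The truncated [j.-1] is correct at [j = 0] too, where all terms
    vanish. *)
Lemma cdf_rec N j : cdf N.+1 j = (1 - p) * cdf N j + p * cdf N j.-1.
Proof.
case: j => [|j]; first by rewrite !cdf0 !mulr0 addr0.
elim: j => [|j IH]; first by rewrite !cdfS /= !cdf0 !bin0 exprS; ring.
by rewrite cdfS IH /= binS [cdf N j.+2]cdfS [X in _ = _ + p * X]cdfS; ring.
Qed.

Hypothesis p01 : 0 <= p <= 1.

Lemma bin_ge0 N i : 0 <= bin N i.
Proof. by case/andP: p01 => p0 p1; rewrite /bin !mulr_ge0 ?exprn_ge0 ?subr_ge0. Qed.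

Lemma cdf_ge0 N j : 0 <= cdf N j.
Proof. by apply: sumr_ge0 => i _; apply: bin_ge0. Qed.

Lemma cdf_le N i j : (i <= j)%N -> cdf N i <= cdf N j.
Proof.
move=> /subnK <-; elim: (_ - _)%N => // k IH; rewrite addSn cdfS.
by apply: le_trans IH _; rewrite lerDl bin_ge0.
Qed.

Lemma cdf_leN N j : cdf N.+1 j <= cdf N j.
Proof.
case/andP: p01 => p0 p1; rewrite cdf_rec.
have := ler_wpM2l p0 (cdf_le N (leq_pred j)); lra.
Qed.

Lemma cdf_geN N j : (1 - p) * cdf N j <= cdf N.+1 j.
Proof. by case/andP: p01 => p0 p1; rewrite cdf_rec lerDl mulr_ge0 ?cdf_ge0. Qed.

Lemma cdf_chernoff N j (l : R) : 0 <= l ->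
  cdf N j.+1 <= expR (l * j%:R + N%:R * p * (expR (- l) - 1)).
Proof.
move=> l0; have := @chernoff_le 'I_N p01 setT setT l j%:R (subxx _) l0.
rewrite cardsT card_ord; apply: le_trans.
have := expect_cdf [set: 'I_N] j.+1; rewrite cardsT card_ord => <-.
by apply: ler_expect => // E _; rewrite setIT (ler_nat R #|E| j) lexx.
Qed.

End Bernoulli.

(** * The random graph *)

Section RandomGraph.
Variables (R : realType) (p : R) (n : nat).
Hypothesis p01 : 0 <= p <= 1.
Implicit Types (E : {set {set 'I_n}}) (X : {set 'I_n}) (u v w : 'I_n).

Definition star v : {set {set 'I_n}} := [set e in pairs n | v \in e].
Definition inside X : {set {set 'I_n}} := [set e in pairs n | e \subset X].

Lemma star_sub v : star v \subset pairs n.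
Proof. by apply/subsetP => e; rewrite inE => /andP[]. Qed.

Lemma inside_sub X : inside X \subset pairs n.
Proof. by apply/subsetP => e; rewrite inE => /andP[]. Qed.

Lemma deg_star E v : E \subset pairs n -> deg E v = #|E :&: star v|.
Proof.
move=> /subsetP sE; apply: eq_card => e; rewrite !inE.
by case eE : (e \in E) => //=; have := sE e eE; rewrite inE => ->.
Qed.

Lemma ind_inside E X : E \subset pairs n -> ind E X = #|E :&: inside X|.
Proof.
move=> /subsetP sE; apply: eq_card => e; rewrite !inE.
by case eE : (e \in E) => //=; have := sE e eE; rewrite inE => ->.
Qed.

Lemma card_inside X : #|inside X| = 'C(#|X|, 2).
Proof. by rewrite -cards_draws; apply: eq_card => e; rewrite !inE andbC. Qed.

Lemma card_pairs : #|pairs n| = 'C(n, 2).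
Proof. by rewrite -[in RHS](card_ord n) -card_draws; apply: eq_card => e; rewrite !inE. Qed.

Definition prob (P : pred {set {set 'I_n}}) : R := expect p (pairs n) (fun E => (P E)%:R).

Lemma Pr_prob (P : pred {set {set 'I_n}}) : Pr p P = prob P.
Proof.
rewrite /Pr big_mkcondr /prob /expect; apply: eq_bigr => E _.
by case: (P E); rewrite ?mulr1 ?mulr0.
Qed.

Lemma prob_le (P Q : pred {set {set 'I_n}}) :
  (forall E, E \subset pairs n -> P E -> Q E) -> prob P <= prob Q.
Proof.
move=> PQ; apply: ler_expect => // E sE; case PE : (P E); last by rewrite ler0n.
by rewrite (PQ E sE PE) lexx.
Qed.

Lemma prob_ge0 (P : pred {set {set 'I_n}}) : 0 <= prob P.
Proof. by apply: expect_ge0 => // E _; rewrite ler0n. Qed.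

Lemma prob_exists (I : finType) (D : pred I) (P : I -> pred {set {set 'I_n}}) :
  prob (fun E => [exists (i | D i), P i E]) <= \sum_(i | D i) prob (P i).
Proof.
rewrite /prob -expect_sum; apply: ler_expect => // E _.
case: existsP => [[i /andP[Di Pi]]|_]; last by apply: sumr_ge0 => i _; rewrite ler0n.
by rewrite (bigD1 i) //= Pi lerDl; apply: sumr_ge0 => j _; rewrite ler0n.
Qed.

Lemma prob_or (P Q : pred {set {set 'I_n}}) : prob (fun E => P E || Q E) <= prob P + prob Q.
Proof.
rewrite /prob -expectD; apply: ler_expect => // E _.
by case: (P E); case: (Q E); rewrite /= ?addr0 ?add0r ?lexx // lerDl.
Qed.

Lemma prob_not (P : pred {set {set 'I_n}}) : prob P = 1 - prob (fun E => ~~ P E).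
Proof.
apply/eqP; rewrite eq_sym subr_eq eq_sym; apply/eqP.
rewrite -(expect_const p (pairs n) 1) /prob -expectD; apply: eq_expect => E _.
by case: (P E); rewrite ?addr0 ?add0r.
Qed.

Lemma prob_deg v j : prob (fun E => (deg E v < j)%N) = cdf p n.-1 j.
Proof.
rewrite -(card_star v) -[[set e in _ | _]]/(star v) -expect_cdf -(expect_restrict p _ (star_sub v)).
by apply: eq_expect => E sE; rewrite deg_star.
Qed.

Lemma star_pair u v w : u != v -> [set u; v] \in star w = (w == u) || (w == v).
Proof. by move=> uv; rewrite !inE cards2 uv. Qed.

Lemma starI u v : u != v -> star u :&: star v = [set [set u; v]].
Proof.
move=> uv; apply/setP => e; rewrite !inE; apply/idP/eqP => [/andP[/andP[ce ue] /andP[_ ve]]|->].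
  apply/eqP; rewrite eq_sym eqEcard (eqP ce) cards2 uv subUset !sub1set ue ve //.
by rewrite cards2 uv !inE !eqxx orbT.
Qed.

(** The two degrees depend on each other only through the edge [uv]. Given its state, the remaining
    degrees are independent binomials with [n.-2] trials. *)
Lemma prob_deg2 u v j : u != v ->
  prob (fun E => (deg E u < j)%N && (deg E v < j)%N) =
  (1 - p) * cdf p n.-2 j ^+ 2 + p * cdf p n.-2 j.-1 ^+ 2.
Proof.
move=> uv; set e := [set u; v].
have eu : e \in star u by rewrite star_pair // eqxx.
have ev : e \in star v by rewrite star_pair // eqxx orbT.
pose A1 := star u :\ e; pose A2 := star v :\ e.
have c1 : #|A1| = n.-2 by have := cardsD1 e (star u); rewrite card_star eu => ->.
have c2 : #|A2| = n.-2 by have := cardsD1 e (star v); rewrite card_star ev => ->.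
have s1 : A1 \subset pairs n by apply: subset_trans (star_sub u); apply: subsetDl.
have s2 : A2 \subset pairs n by apply: subset_trans (star_sub v); apply: subsetDl.
have se : [set e] \subset pairs n by rewrite sub1set (subsetP (star_sub u)).
have d12 : [disjoint A1 & A2].
  rewrite -setI_eq0 /A1 /A2; apply/eqP/setP => f; have /setP/(_ f) := starI uv.
  by rewrite !inE; case: (f == e) => //=.
have de1 : [disjoint [set e] & A1] by rewrite disjoints1 !inE eqxx.
have de2 : [disjoint [set e] & A2] by rewrite disjoints1 !inE eqxx.
have d01 : [disjoint set0 & A1] by rewrite -setI_eq0 set0I.
have d02 : [disjoint set0 & A2] by rewrite -setI_eq0 set0I.
pose f i (F : {set {set 'I_n}}) : R := (#|F| < i)%:R.
pose g (A0 : {set {set 'I_n}}) i E := (A0 \subset E)%:R * f i (E :&: A1) * f i (E :&: A2).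
(* Inclusion-exclusion on [e]: when [e] is present, the bound [j] on both remaining degrees is
   traded for [j.-1]. *)
transitivity (expect p (pairs n) (fun E => g set0 j E + (-1 * g [set e] j E + g [set e] j.-1 E))).
  apply: eq_expect => E sE; rewrite /g sub0set sub1set !deg_star // /f.
  have -> : #|E :&: star u| = ((e \in E) + #|E :&: A1|)%N.
    by rewrite (cardsD1 e) inE eu andbT; congr (_ + _)%N; apply: eq_card => h; rewrite !inE; case: (h == e); rewrite ?andbF.
  have -> : #|E :&: star v| = ((e \in E) + #|E :&: A2|)%N.
    by rewrite (cardsD1 e) inE ev andbT; congr (_ + _)%N; apply: eq_card => h; rewrite !inE; case: (h == e); rewrite ?andbF.
  case: (e \in E); rewrite ?add1n ?add0n; last first.
    by rewrite !mul0r mulr0 !addr0 mul1r -natrM mulnb.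
  case: j => [|j] /=; rewrite ?ltn0 ?mulr0 ?addr0 // ?ltnS.
  by rewrite !mul1r -!natrM !mulnb mulN1r addrA subrr add0r.
rewrite expectD expectD expectZ !expect_indep ?sub0set // cards0 cards1 !expect_cdf c1 c2; ring.
Qed.

(** Chebyshev for the number [Xf] of vertices of degree below [j]. The diagonal contributes [n q];
    each pair has covariance at most [2 p q^2], since only the shared edge correlates the
    degrees. *)
Lemma second_moment j : 0 < cdf p n.-1 j -> (0 < n)%N -> p <= 2^-1 ->
  prob (fun E => [forall v, j <= deg E v]%N) <= (n%:R * cdf p n.-1 j)^-1 + 2 * p.
Proof.
set q := cdf p n.-1 j => q0 n0 p2; have /andP[p0 p1] := p01.
pose Xf E : R := \sum_v (deg E v < j)%:R.
pose J := (1 - p) * cdf p n.-2 j ^+ 2 + p * cdf p n.-2 j.-1 ^+ 2.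
have nR : 0 < n%:R :> R by rewrite ltr0n.
have EX : expect p (pairs n) Xf = n%:R * q.
  rewrite expect_sum (eq_bigr (fun=> q)) => [|v _]; last exact: prob_deg.
  by rewrite sumr_const card_ord mulr_natl.
have J0 : 0 <= J.
  by rewrite addr_ge0 // mulr_ge0 ?subr_ge0 // exprn_ge0 // cdf_ge0.
have EX2 : expect p (pairs n) (fun E => Xf E ^+ 2) <= n%:R * q + n%:R * n%:R * J.
  rewrite (@eq_expect _ _ _ _ _ (fun E => \sum_u \sum_v ((deg E u < j)%N && (deg E v < j)%N)%:R)); last first.
    move=> E _; rewrite expr2 big_distrl; apply: eq_bigr => u _ /=.
    by rewrite big_distrr; apply: eq_bigr => v _ /=; rewrite -natrM mulnb.
  rewrite expect_sum; under eq_bigr do rewrite expect_sum.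
  apply: le_trans (_ : \sum_(u < n) (q + n%:R * J) <= _); last first.
    rewrite sumr_const card_ord -mulr_natl; lra.
  apply: ler_sum => u _; rewrite (bigD1 u) //=; apply: lerD.
    by rewrite /q -(prob_deg u j); apply: ler_expect => // E _; rewrite andbb.
  rewrite (eq_bigr (fun=> J)) => [|v vu]; last by rewrite -[LHS]/(prob _) prob_deg2 // eq_sym.
  rewrite sumr_const -[_ *+ #|_|]mulr_natl; apply: ler_wpM2r => //; rewrite ler_nat.
  by apply: leq_trans (max_card _) _; rewrite card_ord.
have Jq : J - q ^+ 2 <= 2 * p * q ^+ 2.
  (* For [n = 1] the predecessors [n.-1] and [n.-2] coincide and [cdf_rec] does not link them. *)
  case: (posnP n.-1) => [n1|n1].
    have qJ : cdf p n.-2 j = q by rewrite /q; congr (cdf _ _ _); lia.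
    rewrite /J qJ; have c1 : cdf p n.-2 j.-1 <= q by rewrite -qJ; apply: cdf_le => //; apply: leq_pred.
    have c0 : 0 <= cdf p n.-2 j.-1 by apply: cdf_ge0.
    have : cdf p n.-2 j.-1 ^+ 2 <= q ^+ 2 by rewrite ler_sqr // nnegrE // ltW.
    move=> h; have := ler_wpM2l p0 h; have : 0 <= p * q ^+ 2 by rewrite mulr_ge0 ?exprn_ge0 // ltW.
    lra.
  have -> : q = (1 - p) * cdf p n.-2 j + p * cdf p n.-2 j.-1.
    by rewrite -cdf_rec /q; congr (cdf _ _ _); lia.
  rewrite /J; have := cdf_le p01 n.-2 (leq_pred j); have := cdf_ge0 p01 n.-2 j.-1.
  move: (cdf p n.-2 j.-1) (cdf p n.-2 j) => a b a0 ab.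
  (* covariance [p (1 - p) (b - a)^2], with [(1 - p) b <= q] *)
  have -> : (1 - p) * b ^+ 2 + p * a ^+ 2 - ((1 - p) * b + p * a) ^+ 2 = p * ((1 - p) * (b - a) ^+ 2) by ring.
  rewrite -mulrA [2 * _]mulrCA; apply: ler_wpM2l => //.
  have h1 : (b - a) ^+ 2 <= b ^+ 2 by rewrite ler_sqr ?nnegrE; lra.
  have h2 : ((1 - p) * b) ^+ 2 <= ((1 - p) * b + p * a) ^+ 2.
    have pb : 0 <= (1 - p) * b by apply: mulr_ge0; lra.
    have pa : 0 <= p * a by apply: mulr_ge0; lra.
    by rewrite ler_sqr ?nnegrE; lra.
  have h3 : (1 - p) * (b - a) ^+ 2 <= (1 - p) * b ^+ 2 by apply: ler_wpM2l; lra.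
  have b2 : 0 <= b ^+ 2 by apply: sqr_ge0.
  have h4 : 2 * ((1 - p) * b) ^+ 2 = 2 * (1 - p) * ((1 - p) * b ^+ 2) by ring.
  have h5 : 0 <= (1 - 2 * p) * ((1 - p) * b ^+ 2) by rewrite mulr_ge0 ?mulr_ge0; lra.
  nra.
(* On the event that [Xf] vanishes, the squared deviation of [Xf] from its mean is the squared
   mean. *)
have key : (n%:R * q) ^+ 2 * prob (fun E => [forall v, j <= deg E v]%N) <=
           n%:R * q + n%:R ^+ 2 * (2 * p * q ^+ 2).
  rewrite -expectZ; apply: le_trans (_ : expect p (pairs n) (fun E => Xf E ^+ 2 + (- (2 * (n%:R * q)) * Xf E + (n%:R * q) ^+ 2)) <= _).
    apply: ler_expect => // E _; case: forallP => [h|_].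
      rewrite mulr1 /Xf big1 => [|v _]; last by rewrite ltnNge h.
      by rewrite expr0n /= mulr0 !add0r.
    rewrite mulr0; have -> : Xf E ^+ 2 + (- (2 * (n%:R * q)) * Xf E + (n%:R * q) ^+ 2) = (Xf E - n%:R * q) ^+ 2 by ring.
    exact: sqr_ge0.
  rewrite !expectD expectZ expect_const EX.
  have := ler_wpM2l (sqr_ge0 n%:R) Jq; lra.
have nq0 : 0 < n%:R * q by rewrite mulr_gt0.
have nq2 : 0 < (n%:R * q) ^+ 2 by rewrite exprn_gt0.
rewrite -(ler_pM2l nq2); apply: le_trans key _.
rewrite mulrDr expr2 -[X in _ <= X + _]mulrA mulfV ?gt_eqF // mulr1 lerD2l; lra.
Qed.

(** Deleting the edge [uv] from both stars only relaxes the degree conditions and makes all three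
    events independent. *)
Lemma prob_adj_low u v j : u != v ->
  prob (fun E => [&& (deg E u < j)%N, (deg E v < j)%N & [set u; v] \in E]) <=
  p * cdf p n.-2 j ^+ 2.
Proof.
move=> uv; set e := [set u; v].
have eu : e \in star u by rewrite star_pair // eqxx.
have ev : e \in star v by rewrite star_pair // eqxx orbT.
pose A1 := star u :\ e; pose A2 := star v :\ e.
have c1 : #|A1| = n.-2 by have := cardsD1 e (star u); rewrite card_star eu => ->.
have c2 : #|A2| = n.-2 by have := cardsD1 e (star v); rewrite card_star ev => ->.
pose f (F : {set {set 'I_n}}) : R := (#|F| < j)%:R.
have -> : p * cdf p n.-2 j ^+ 2 =
    expect p (pairs n) (fun E => ([set e] \subset E)%:R * f (E :&: A1) * f (E :&: A2)).
  rewrite expect_indep ?disjoints1 ?inE ?eqxx //; last first.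
  - rewrite -setI_eq0 /A1 /A2; apply/eqP/setP => h; have /setP/(_ h) := starI uv.
    by rewrite !inE; case: (h == e) => //=.
  - by apply: subset_trans (star_sub v); apply: subsetDl.
  - by apply: subset_trans (star_sub u); apply: subsetDl.
  - by rewrite sub1set (subsetP (star_sub u)).
  by rewrite cards1 !expect_cdf c1 c2; ring.
apply: ler_expect => // E sE; rewrite sub1set !deg_star //.
have l1 : (#|E :&: A1| <= #|E :&: star u|)%N by rewrite subset_leq_card // setIS // subsetDl.
have l2 : (#|E :&: A2| <= #|E :&: star v|)%N by rewrite subset_leq_card // setIS // subsetDl.
rewrite /f -!natrM !mulnb ler_nat.
case: (e \in E); rewrite ?andbF //= andbT; case: ltnP => //= h1; case: ltnP => //= h2.
by rewrite (leq_ltn_trans l1 h1) (leq_ltn_trans l2 h2).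
Qed.

(** As for adjacent vertices, but each star loses the possible edge [uv] as well as its required
    edge to [w], which leaves [n.-2.-1] trials. *)
Lemma prob_common_low u v w j : u != v -> u != w -> v != w ->
  prob (fun E => [&& (deg E u < j)%N, (deg E v < j)%N, [set u; w] \in E & [set v; w] \in E]) <=
  p ^+ 2 * cdf p n.-2.-1 j ^+ 2.
Proof.
move=> uv uw vw; pose e := [set u; v]; pose eu := [set u; w]; pose ev := [set v; w].
pose A1 := star u :\ e :\ eu; pose A2 := star v :\ e :\ ev.
have euev : eu != ev.
  by apply/eqP => /setP/(_ u); rewrite !inE eqxx /= (negbTE uv) (negbTE uw).
have eeu : eu != e.
  by apply/eqP => /setP/(_ w); rewrite !inE eqxx orbT !(eq_sym w) (negbTE uw) (negbTE vw).
have eev : ev != e.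
  by apply/eqP => /setP/(_ w); rewrite !inE eqxx orbT !(eq_sym w) (negbTE uw) (negbTE vw).
have c1 : #|A1| = n.-2.-1.
  have := cardsD1 e (star u); rewrite card_star star_pair // eqxx add1n => h1.
  have := cardsD1 eu (star u :\ e); rewrite !inE eeu cards2 uw eqxx /= add1n => h2.
  by move: h1 h2; rewrite -/A1 => -> /= ->.
have c2 : #|A2| = n.-2.-1.
  have := cardsD1 e (star v); rewrite card_star star_pair // eqxx orbT add1n => h1.
  have := cardsD1 ev (star v :\ e); rewrite !inE eev cards2 vw eqxx /= add1n => h2.
  by move: h1 h2; rewrite -/A2 => -> /= ->.
have eu_pair : eu \in pairs n by rewrite inE cards2 uw.
have ev_pair : ev \in pairs n by rewrite inE cards2 vw.
have eu_v : eu \notin star v by rewrite star_pair // negb_or eq_sym uv vw.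
have ev_u : ev \notin star u by rewrite star_pair // negb_or uv uw.
pose f (F : {set {set 'I_n}}) : R := (#|F| < j)%:R.
have -> : p ^+ 2 * cdf p n.-2.-1 j ^+ 2 =
    expect p (pairs n) (fun E => ([set eu; ev] \subset E)%:R * f (E :&: A1) * f (E :&: A2)).
  rewrite expect_indep //.
  - by rewrite cards2 euev !expect_cdf c1 c2; ring.
  - by rewrite subUset !sub1set eu_pair ev_pair.
  - by apply: subset_trans (star_sub u); apply: subset_trans (subsetDl _ _) (subsetDl _ _).
  - by apply: subset_trans (star_sub v); apply: subset_trans (subsetDl _ _) (subsetDl _ _).
  - rewrite -setI_eq0; apply/eqP/setP => h; rewrite /A1 /A2 in_setI in_set2 in_set0 !in_setD !in_set1.
    case: (eqVneq h eu) => [->|_] //=; case: (eqVneq h ev) => [->|_] //=.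
    by rewrite (negbTE ev_u) !andbF.
  - rewrite -setI_eq0; apply/eqP/setP => h; rewrite /A1 /A2 in_setI in_set2 in_set0 !in_setD !in_set1.
    case: (eqVneq h ev) => [->|_]; rewrite ?andbF //= orbF.
    by case: (eqVneq h eu) => [->|_] //=; rewrite (negbTE eu_v) !andbF.
  - rewrite -setI_eq0 /A1 /A2; apply/eqP/setP => h; have /setP/(_ h) := starI uv.
    rewrite !in_setI !in_set1 -/e in_set0 !in_setD !in_set1.
    case: (h == e); rewrite ?andbF //= => /andP h'.
    by apply/negP => /andP[/andP[_ a] /andP[_ b]]; apply: h'.
apply: ler_expect => // E sE; rewrite subUset !sub1set !deg_star //.
have l1 : (#|E :&: A1| <= #|E :&: star u|)%N.
  by rewrite subset_leq_card // setIS //; apply: subset_trans (subsetDl _ _) (subsetDl _ _).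
have l2 : (#|E :&: A2| <= #|E :&: star v|)%N.
  by rewrite subset_leq_card // setIS //; apply: subset_trans (subsetDl _ _) (subsetDl _ _).
rewrite /f -!natrM !mulnb ler_nat -/eu -/ev.
case: (_ && (ev \in E)); rewrite ?andbF //= andbT; case: ltnP => //= h1; case: ltnP => //= h2.
by rewrite (leq_ltn_trans l1 h1) (leq_ltn_trans l2 h2).
Qed.

End RandomGraph.

(** * Union bounds *)

Section UnionBounds.
Variables (R : realType) (p : R) (n : nat).
Hypothesis p01 : 0 <= p <= 1.
Implicit Types (E : {set {set 'I_n}}) (X : {set 'I_n}) (u v w : 'I_n).

Definition adj_low j E := [exists uv : 'I_n * 'I_n, (uv.1 != uv.2) &&
  [&& (deg E uv.1 < j)%N, (deg E uv.2 < j)%N & [set uv.1; uv.2] \in E]].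

Definition common_low j E := [exists t : 'I_n * 'I_n * 'I_n,
  [&& t.1.1 != t.1.2, t.1.1 != t.2 & t.1.2 != t.2] &&
  [&& (deg E t.1.1 < j)%N, (deg E t.1.2 < j)%N, [set t.1.1; t.2] \in E & [set t.1.2; t.2] \in E]].

Lemma isolated_lowP j E : E \subset pairs n -> ~~ adj_low j E -> ~~ common_low j E ->
  isolated_low E j.
Proof.
move=> sE /existsPn h1 /existsPn h2; split=> [u v du dv uv|u v w du dv uv uw].
  by have := h1 (u, v); rewrite /= uv du dv /=.
apply/negP => vw.
have ne x y : [set x; y] \in E -> x != y.
  by move=> /(subsetP sE); rewrite inE cards2; case: (x != y).
by have := h2 (u, v, w); rewrite /= uv du dv uw vw !ne.
Qed.

Lemma prob_low_conflict j : prob p (fun E => adj_low j E || common_low j E) <=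
  (n%:R ^+ 2 * p + n%:R ^+ 3 * p ^+ 2) * cdf p n.-2.-1 j ^+ 2.
Proof.
have /andP[p0 p1] := p01.
have c2 : cdf p n.-2 j ^+ 2 <= cdf p n.-2.-1 j ^+ 2.
  rewrite ler_sqr ?nnegrE ?cdf_ge0 //; case: n.-2 => [|m] //=; exact: cdf_leN.
apply: le_trans (prob_or _ _ _) _ => //; rewrite mulrDl; apply: lerD.
  apply: le_trans (prob_exists _ _ _) _ => //.
  apply: le_trans (_ : \sum_(uv : 'I_n * 'I_n) p * cdf p n.-2 j ^+ 2 <= _).
    rewrite [X in X <= _]big_mkcond; apply: ler_sum => uv _; case: ifP => [ne|_].
      exact: prob_adj_low.
    by rewrite mulr_ge0 ?sqr_ge0.
  rewrite sumr_const card_prod !card_ord -[_ *+ _]mulr_natl natrM expr2 -!mulrA.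
  by do 2 (apply: ler_wpM2l => //); apply: ler_wpM2l.
apply: le_trans (prob_exists _ _ _) _ => //.
apply: le_trans (_ : \sum_(t : 'I_n * 'I_n * 'I_n) p ^+ 2 * cdf p n.-2.-1 j ^+ 2 <= _).
  rewrite [X in X <= _]big_mkcond; apply: ler_sum => t _; case: ifP => [/and3P[n1 n2 n3]|_].
    exact: prob_common_low.
  by rewrite mulr_ge0 ?sqr_ge0.
rewrite sumr_const !card_prod !card_ord -[_ *+ _]mulr_natl !natrM; lra.
Qed.

Lemma bin2R s : 2 * 'C(s, 2)%:R = s%:R * (s%:R - 1) :> R.
Proof.
have := mul_bin_diag s 1; rewrite bin1; case: s => [|s] /=; first by rewrite bin0n mulr0 mul0r.
by move=> /(congr1 (fun k => k%:R : R)); rewrite !natrM => <-; rewrite -[s.+1%:R]natr1 addrK.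
Qed.

Lemma sum_exp_card (z : R) : \sum_(X : {set 'I_n}) z ^+ #|X| = (1 + z) ^+ n.
Proof.
rewrite addrC exprDn (partition_big (fun X : {set 'I_n} => inord #|X| : 'I_n.+1) xpredT) //=.
have cX X : (#|X| < n.+1)%N by rewrite ltnS -[X in (_ <= X)%N](card_ord n) max_card.
apply: (eq_trans (y := \sum_(i < n.+1) 'C(n, n - i)%:R * z ^+ i)).
  apply: eq_bigr => i _; rewrite bin_sub ?leq_ord //.
  rewrite (eq_bigr (fun=> z ^+ i)) => [|X /eqP <-]; last by rewrite inordK.
  rewrite sumr_const -[_ *+ #|_|]mulr_natl; congr (_%:R * _).
  rewrite -[X in 'C(X, _)](card_ord n) -card_draws; apply: eq_card => X.
  have e : (inord #|X| == i :> 'I_n.+1) = (#|X| == i) by rewrite -val_eqE /= inordK.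
  by rewrite [RHS]inE; exact: e.
rewrite (reindex_inj rev_ord_inj) /=; apply: eq_bigr => i _.
by rewrite subSS expr1n mulr1 mulr_natl; congr (_ *+ 'C(_, _)); rewrite subKn // leq_ord.
Qed.

(** Chernoff bounds each [X] by [z ^+ #|X|], because ['C(#|X|, 2) <= #|X| * s0]. Summing over all
    nonempty sets gives [(1 + z) ^+ n - 1]. *)
Lemma small_sets (l : R) t s0 : 0 <= l ->
  prob p (fun E => [exists (X : {set 'I_n} | (X != set0) && (#|X| <= s0)%N), (t * #|X| <= ind E X)%N])
  <= expR (n%:R * expR (- l * t%:R + s0%:R * p * (expR l - 1))) - 1.
Proof.
move=> l0; set z := expR (- l * _ + _); have /andP[p0 p1] := p01.
have el : 0 <= expR l - 1 by have := expR_ge1Dx l; lra.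
apply: le_trans (prob_exists _ _ _) _ => //.
apply: le_trans (_ : \sum_(X : {set 'I_n} | X != set0) z ^+ #|X| <= _); last first.
  have := sum_exp_card z; rewrite (bigD1 set0) //= cards0 expr0 => h.
  have : (1 + z) ^+ n <= expR (n%:R * z).
    by rewrite expRM_natl lerXn2r ?nnegrE ?expR_ge0 ?expR_ge1Dx // addr_ge0 ?expR_ge0.
  by rewrite -h; lra.
rewrite big_mkcondr; apply: ler_sum => X X0; case: ifP => [Xs|_]; last by rewrite exprn_ge0 ?expR_ge0.
have := chernoff_ge p01 (t * #|X|)%:R (inside_sub X) l0.
rewrite card_inside => h; apply: le_trans (le_trans _ h) _.
  by apply: ler_expect => // E sE; rewrite ind_inside // (ler_nat R (t * #|X|)) lexx.
rewrite /z -expRM_natl ler_expR natrM mulrDr.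
have b1 : ('C(#|X|, 2)%:R : R) <= #|X|%:R * s0%:R.
  apply: le_trans (_ : 2 * 'C(#|X|, 2)%:R <= _); first by rewrite ler_peMl // ler1n.
  by rewrite bin2R; apply: ler_wpM2l => //; have := Xs; rewrite -(ler_nat R); lra.
have := ler_wpM2r (mulr_ge0 p0 el) b1; lra.
Qed.

Lemma expR_le (l : R) : 0 <= l -> l <= 2^-1 -> expR l - 1 <= l + 2 * l ^+ 2.
Proof.
move=> l0 l2; have := expR_ge1Dx (- l); rewrite expRN => h.
have e0 := expR_gt0 l.
have : (1 - l) * expR l <= 1.
  by have := ler_wpM2r (ltW e0) h; rewrite mulVf ?gt_eqF.
have : 1 <= (1 + l + 2 * l ^+ 2) * (1 - l).
  have : 0 <= l ^+ 2 * (1 - 2 * l) by rewrite mulr_ge0 ?sqr_ge0 //; lra.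
  nra.
move=> h1 h2.
have l1 : 0 < 1 - l by lra.
have : (1 - l) * (1 + l + 2 * l ^+ 2 - expR l) >= 0 by lra.
by rewrite pmulr_rge0 //; lra.
Qed.

Lemma expRN_le (l : R) : 0 <= l -> expR (- l) - 1 <= - l + l ^+ 2.
Proof.
move=> l0; rewrite expRN; have := expR_ge1Dx l => h.
have e0 : 0 < 1 + l by lra.
apply: le_trans (_ : (1 + l)^-1 - 1 <= _).
  by rewrite lerD2r lef_pV2 ?posrE ?expR_gt0.
rewrite -(ler_pM2l e0) mulrBr mulfV ?gt_eqF // mulr1.
have : 0 <= l ^+ 3 by rewrite exprn_ge0.
nra.
Qed.

(** Here [kappa] is the Chernoff gain per unit of [#|X| - 1], which is at least [s0]; the crude
    count [2 ^+ n] of sets is affordable. *)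
Lemma mid_sets (l c kappa : R) s0 s1 : 0 <= l -> (0 < s0)%N ->
  s1%:R * p / 2 * (expR l - 1) + kappa <= l * c -> 0 <= kappa ->
  prob p (fun E => [exists (X : {set 'I_n} | (s0 < #|X|)%N && (#|X| <= s1)%N),
     c * (#|X|%:R - 1) <= (ind E X)%:R])
  <= 2 ^+ n * expR (- kappa * s0%:R).
Proof.
move=> l0 s00 hc k0; have /andP[p0 p1] := p01.
have el : 0 <= expR l - 1 by have := expR_ge1Dx l; lra.
apply: le_trans (prob_exists _ _ _) _ => //.
apply: le_trans (_ : \sum_(X : {set 'I_n}) expR (- kappa * s0%:R) <= _); last first.
  rewrite (eq_bigr (fun X : {set 'I_n} => expR (- kappa * s0%:R) * 1 ^+ #|X|)); last first.
    by move=> X _; rewrite expr1n mulr1.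
  by rewrite -big_distrr /= sum_exp_card mulrC lexx.
rewrite [X in X <= _]big_mkcond; apply: ler_sum => X _; case: ifP => [/andP[X0 X1]|_]; last exact: expR_ge0.
have := chernoff_ge p01 (c * (#|X|%:R - 1)) (inside_sub X) l0.
rewrite card_inside => h; apply: le_trans (le_trans _ h) _.
  by apply: ler_expect => // E sE; rewrite ind_inside // lexx.
rewrite ler_expR.
have -> : 'C(#|X|, 2)%:R = (#|X|%:R * (#|X|%:R - 1)) / 2 :> R.
  by rewrite -bin2R mulrC mulKf.
have Xs1 : #|X|%:R <= s1%:R :> R by rewrite ler_nat.
have Xs0 : s0%:R <= #|X|%:R - 1 :> R by rewrite lerBrDr natr1 ler_nat.
have s0R : 0 < s0%:R :> R by rewrite ltr0n.
move: Xs1 Xs0; move: (#|X|%:R : R) => x Xs1 Xs0.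
have h1 : x * p / 2 * (expR l - 1) + kappa <= l * c.
  have := ler_wpM2r (mulr_ge0 p0 el) Xs1; lra.
have x1 : 0 <= x - 1 by lra.
have := ler_wpM2r x1 h1; have := ler_wpM2l k0 Xs0; lra.
Qed.

(** For [l] up to 1/2 both exponential moments are quadratic in [l] beyond the linear term, so one
    exponent serves both tails. *)
Lemma edges_concentrated (l tau : R) : 0 <= l -> l <= 2^-1 ->
  prob p (fun E => (tau <= `|#|E|%:R - 'C(n, 2)%:R * p|)) <=
  2 * expR (- l * tau + 2 * ('C(n, 2)%:R * p) * l ^+ 2).
Proof.
move=> l0 l2; have /andP[p0 p1] := p01; set mu := 'C(n, 2)%:R * p.
have mu0 : 0 <= mu by rewrite mulr_ge0.
apply: le_trans (_ : prob p (fun E => (mu + tau <= #|E|%:R) || (#|E|%:R <= mu - tau)) <= _).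
  apply: prob_le => // E _; case: (lerP 0 (#|E|%:R - mu)) => h; [rewrite ger0_norm|rewrite ltr0_norm] => // h'.
    by apply/orP; left; lra.
  by apply/orP; right; lra.
apply: le_trans (prob_or _ _ _) _ => //; rewrite [2 * _]mulr_natl mulr2n; apply: lerD.
  have := chernoff_ge p01 (mu + tau) (subxx (pairs n)) l0; rewrite card_pairs -/mu => h.
  apply: le_trans (le_trans _ h) _.
    by apply: ler_expect => // E /setIidPl sE; rewrite sE lexx.
  rewrite ler_expR; have := ler_wpM2l mu0 (expR_le l0 l2); lra.
have := chernoff_le p01 (mu - tau) (subxx (pairs n)) l0; rewrite card_pairs -/mu => h.
apply: le_trans (le_trans _ h) _.
  by apply: ler_expect => // E /setIidPl sE; rewrite sE lexx.
rewrite ler_expR; have := ler_wpM2l mu0 (expRN_le l0); have := mulr_ge0 mu0 (sqr_ge0 l); lra.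
Qed.

End UnionBounds.

(** * Stirling bounds *)

Section Stirling.
Variable R : realType.
Implicit Types (t x : R).

Lemma is_derive_inv (t : R) : 0 < t -> is_derive t 1 (fun s : R => s^-1) (- t ^- 2).
Proof.
move=> t0; have tn0 : t != 0 by rewrite gt_eqF.
have := @is_deriveV R id t 1 1 tn0 (is_derive_id _ _).
by move=> /is_derive_eq; apply; rewrite /GRing.scale /= mulr1.
Qed.

Lemma is_derive_inv1 (t : R) : 0 < t -> is_derive t 1 (fun s : R => (s + 1)^-1) (- (t + 1) ^- 2).
Proof.
move=> t0; have tn0 : t + 1 != 0 by rewrite gt_eqF // addr_gt0.
have d1 : is_derive t 1 (fun s : R => s + 1) 1.
  have := is_deriveD (is_derive_id t (1:R)) (is_derive_cst (1:R) t (1:R)).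
  by move=> /is_derive_eq; apply; rewrite addr0 //.
have := @is_deriveV R (fun s : R => s + 1) t 1 1 tn0 d1.
by move=> /is_derive_eq; apply; rewrite /GRing.scale /= mulr1.
Qed.

Lemma ge_at1 (f df : R -> R) t : 1 <= t ->
  (forall s : R, 1 <= s -> is_derive s 1 f (df s)) -> (forall s : R, 1 <= s -> 0 <= df s) -> f 1 <= f t.
Proof.
move=> t1 fd df0.
have [||c] := @MVT_segment R f df 1 t t1.
- by move=> s; rewrite in_itv /= => /andP[/ltW s1 _]; apply: fd.
- apply: derivable_within_continuous => s; rewrite in_itv /= => /andP[s1 _].
  by apply: ex_derive; apply: fd.
rewrite in_itv /= => /andP[c1 _] e.
by rewrite -subr_ge0 e mulr_ge0 ?df0 // subr_ge0.
Qed.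

(** This and the next bound agree with [ln] to second order at 1. At [t = (j + 1) / j] this one
    equals [1 / (j + 1/2)], just what cancels the main term of Stirling's formula. *)
Lemma ln_ge_pade t : 1 <= t -> 2 * (t - 1) / (t + 1) <= ln t.
Proof.
move=> t1.
have := @ge_at1 (fun s : R => ln s + 4 * (s + 1)^-1) (fun s => s^-1 - 4 * (s + 1) ^- 2) t t1.
have h (s : R) : 1 <= s -> is_derive s 1 (fun s : R => ln s + 4 * (s + 1)^-1) (s^-1 - 4 * (s + 1) ^- 2).
  move=> s1; have s0 : 0 < s by lra.
  have := is_deriveD (is_derive1_ln s0) (is_deriveZ 4 (is_derive_inv1 s0)).
  by move=> /is_derive_eq; apply; rewrite /GRing.scale /= mulrN.
move=> /(_ h) {h}.
have h (s : R) : 1 <= s -> 0 <= s^-1 - 4 * (s + 1) ^- 2.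
  move=> s1; have s0 : 0 < s by lra.
  have -> : s^-1 - 4 * (s + 1) ^- 2 = (s - 1) ^+ 2 * (s^-1 * (s + 1) ^- 2).
    by field; rewrite !gt_eqF //; lra.
  by rewrite mulr_ge0 ?sqr_ge0 // mulr_ge0 // ?invr_ge0 ?exprn_ge0 //; lra.
move=> /(_ h) {h}; rewrite ln1 => h.
have -> : 2 * (t - 1) / (t + 1) = 2 - 4 * (t + 1)^-1 by field; rewrite gt_eqF //; lra.
have h2 : 4 * (1 + 1)^-1 = 2 :> R by field.
lra.
Qed.

Lemma ln_le_pade t : 1 <= t -> ln t <= (t - t^-1) / 2.
Proof.
move=> t1.
have := @ge_at1 (fun s : R => (2^-1 * s + (- 2^-1) * s^-1) + (-1) * ln s)
  (fun s => (2^-1 + 2^-1 * s ^- 2) - s^-1) t t1.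
have h (s : R) : 1 <= s -> is_derive s 1 (fun s : R => (2^-1 * s + (- 2^-1) * s^-1) + (-1) * ln s)
    ((2^-1 + 2^-1 * s ^- 2) - s^-1).
  move=> s1; have s0 : 0 < s by lra.
  have := is_deriveD (is_deriveD (is_deriveZ 2^-1 (is_derive_id s (1:R))) (is_deriveZ (- 2^-1) (is_derive_inv s0))) (is_deriveZ (-1) (is_derive1_ln s0)).
  by move=> /is_derive_eq; apply; rewrite /GRing.scale /= mulr1 mulrNN mulN1r.
move=> /(_ h) {h}.
have h (s : R) : 1 <= s -> 0 <= (2^-1 + 2^-1 * s ^- 2) - s^-1.
  move=> s1; have s0 : 0 < s by lra.
  have -> : (2^-1 + 2^-1 * s ^- 2) - s^-1 = 2^-1 * (1 - s^-1) ^+ 2.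
    by field; rewrite !gt_eqF //; lra.
  by rewrite mulr_ge0 ?sqr_ge0.
move=> /(_ h) {h}; rewrite ln1 invr1; lra.
Qed.

(* [stir j = log (j! e^j / j^(j + 1/2))] for [j > 0] *)
Definition stir (j : nat) : R := ln j`!%:R + j%:R - (j%:R + 2^-1) * ln j%:R.

(** The decrement of [stir] is [(j + 1/2) ln((j + 1) / j) - 1]. The two bounds on [ln] place it
    between 0 and the telescoping difference of [1 / (4 j)]. *)
Lemma stir_step (j : nat) : (0 < j)%N ->
  stir j.+1 <= stir j /\ stir j - (4 * j%:R)^-1 <= stir j.+1 - (4 * j.+1%:R)^-1.
Proof.
move=> j0; have jR : 1 <= j%:R :> R by rewrite ler1n.
have e : stir j - stir j.+1 = (j%:R + 2^-1) * ln (j.+1%:R / j%:R) - 1.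
  rewrite /stir factS natrM lnM ?posrE ?ltr0n ?fact_gt0 // ln_div ?posrE ?ltr0n // -[j.+1%:R]natr1; ring.
have t1 : 1 <= j.+1%:R / j%:R :> R by rewrite ler_pdivlMr; [rewrite mul1r ler_nat|lra].
have := ln_ge_pade t1; have := ln_le_pade t1.
move: e; have -> : j.+1%:R = j%:R + 1 :> R by rewrite natr1.
set L := ln _.
set S := stir j; set S' := stir j.+1; move: (j%:R : R) jR => x x1 e h1 h2.
have x0 : 0 < x by lra.
have e1 : 2 * ((x + 1) / x - 1) / ((x + 1) / x + 1) = (x + 2^-1)^-1.
  by field; rewrite !gt_eqF //; lra.
have e2 : ((x + 1) / x - ((x + 1) / x)^-1) / 2 = (x + 2^-1)^-1 * (1 + ((4 * x)^-1 - (4 * (x + 1))^-1)).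
  by field; rewrite !gt_eqF //; lra.
rewrite e1 in h2; rewrite e2 in h1.
have y0 : 0 < x + 2^-1 by lra.
have := ler_wpM2l (ltW y0) h2; have := ler_wpM2l (ltW y0) h1.
rewrite mulrA !mulfV ?gt_eqF // mul1r => k1 k2; split; lra.
Qed.

Lemma stir_bounds (j : nat) : (0 < j)%N -> 0 <= stir j <= 1.
Proof.
have s1 : stir 1 = 1 by rewrite /stir ln1 mulr0 subr0 add0r.
move=> j0; suff : stir 1 - (4 * 1%:R)^-1 <= stir j - (4 * j%:R)^-1 /\ stir j <= 1.
  rewrite s1 => -[h1 h2]; rewrite h2 andbT.
  have : 0 <= (4 * j%:R)^-1 :> R by rewrite invr_ge0 mulr_ge0.
  have : (4 * 1%:R)^-1 = 4^-1 :> R by rewrite mulr1.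
  lra.
elim: j j0 => // -[|j] IH _; first by rewrite s1; split; lra.
have [h1 h2] := IH isT; have [k1 k2] := stir_step (ltn0Sn j); by split; [exact: le_trans h1 k2|exact: le_trans k1 h2].
Qed.

End Stirling.

(** * Binomial estimates *)

Section BinomialEstimates.
Variables (R : realType) (p : R) (N : nat).
Hypothesis p01 : 0 <= p <= 1.
Let d : R := p * N%:R.

Lemma bin_step l : (l.+1)%:R * (1 - p) * bin p N l.+1 = (N%:R - l%:R) * p * bin p N l.
Proof.
rewrite /bin; have [lN|Nl] := ltnP l N; last first.
  rewrite bin_small // !(mulr0, mul0r); have [->|lN] := eqVneq l N; first by rewrite subrr !mul0r.
  by rewrite bin_small ?mul0r ?mulr0 // ltn_neqAle eq_sym lN.
have -> : (N - l = (N - l.+1).+1)%N by lia.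
have := mul_bin_left N l => /(congr1 (fun k => k%:R : R)).
rewrite !natrM natrB 1?ltnW // => h.
have -> : l.+1%:R * (1 - p) * ('C(N, l.+1)%:R * p ^+ l.+1 * (1 - p) ^+ (N - l.+1)) =
  (l.+1%:R * 'C(N, l.+1)%:R) * (p ^+ l.+1 * (1 - p) ^+ (N - l.+1).+1) by rewrite !exprS; ring.
by rewrite h !exprS; ring.
Qed.

Lemma bin_succ l : p <= 2^-1 -> bin p N l.+1 <= 2 * d / l.+1%:R * bin p N l.
Proof.
move=> p2; have /andP[p0 p1] := p01; have b0 := bin_ge0 p01 N l.+1; have b1 := bin_ge0 p01 N l.
have l0 : 0 < l.+1%:R :> R by rewrite ltr0n.
rewrite mulrAC ler_pdivlMr // mulrC.
have := bin_step l.
have h1 : l.+1%:R * bin p N l.+1 <= 2 * (l.+1%:R * (1 - p) * bin p N l.+1).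
  have : 0 <= (1 - 2 * p) * (l.+1%:R * bin p N l.+1) by apply: mulr_ge0; [lra|apply: mulr_ge0 => //; exact: ltW].
  lra.
have h2 : (N%:R - l%:R) * p * bin p N l <= d * bin p N l.
  rewrite /d; have : 0 <= l%:R * (p * bin p N l) by apply: mulr_ge0 => //; apply: mulr_ge0.
  lra.
lra.
Qed.

(** The ratio is at most [y^r / r!] times [exp(x r)] with [y = 2 d exp(-x)], and
    [y^r / r! <= exp(y)]. For large [x], moving up by a small fraction of [d] thus costs only a
    small exponent. *)
Lemma bin_growth j r (x : R) : p <= 2^-1 -> 0 <= x ->
  bin p N (j + r) <= bin p N j * expR (2 * d * expR (- x) + x * r%:R).
Proof.
move=> p2 x0; have /andP[p0 p1] := p01; have b0 := bin_ge0 p01 N j.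
have d0 : 0 <= d by rewrite mulr_ge0.
have h : bin p N (j + r) <= bin p N j * ((2 * d) ^+ r / r`!%:R).
  elim: r => [|r IH]; first by rewrite addn0 expr0 fact0 divr1 mulr1.
  rewrite addnS; apply: le_trans (bin_succ _ p2) _.
  apply: le_trans (_ : 2 * d / r.+1%:R * (bin p N j * ((2 * d) ^+ r / r`!%:R)) <= _); last first.
    by rewrite factS natrM exprS invfM le_eqVlt; apply/orP; left; apply/eqP; ring.
  apply: ler_pM => //; first by rewrite !mulr_ge0 // invr_ge0.
    exact: bin_ge0.
  rewrite ler_wpM2l ?mulr_ge0 // lef_pV2 ?posrE ?ltr0n // ler_nat ltnS leq_addl //.
apply: le_trans h _; apply: ler_wpM2l => //.
rewrite expRD; have e0 := expR_gt0 (- x).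
have -> : (2 * d) ^+ r / r`!%:R = ((2 * d * expR (- x)) ^+ r / r`!%:R) * expR (x * r%:R).
  have hx : expR (- x) ^+ r * expR (x * r%:R) = 1.
    by rewrite -expRM_natl -expRD mulrN mulrC addNr expR0.
  rewrite (exprMn _ (2 * d)) -[LHS]mulr1 -[X in _ * X = _]hx; ring.
apply: ler_wpM2r; first exact: expR_ge0.
have y0 : 0 <= 2 * d * expR (- x) by rewrite !mulr_ge0 // expR_ge0.
case: r => [|r]; first by rewrite expr0 fact0 divr1 -[X in X <= _]expR0 ler_expR.
have := expR_ge1Dxn r y0; lra.
Qed.

Lemma cdf_growth j i (x : R) : p <= 2^-1 -> 0 <= x ->
  cdf p N (j + i) <= cdf p N j + i%:R * (bin p N j * expR (2 * d * expR (- x) + x * i%:R)).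
Proof.
move=> p2 x0; have b0 := bin_ge0 p01 N j.
suff H r : (r <= i)%N -> cdf p N (j + r) <= cdf p N j + r%:R * (bin p N j * expR (2 * d * expR (- x) + x * i%:R)).
  exact: H.
elim: r => [|r IH] ri; first by rewrite addn0 mul0r addr0.
rewrite addnS cdfS -natr1 mulrDl mul1r addrA; apply: lerD; first exact/IH/ltnW.
apply: le_trans (bin_growth j r p2 x0) _; apply: ler_wpM2l => //.
by rewrite ler_expR lerD2l ler_wpM2l // ler_nat ltnW.
Qed.

Lemma expR_oneB : p <= 2^-1 -> expR (- p - 2 * p ^+ 2) <= 1 - p.
Proof.
move=> p2; have /andP[p0 p1] := p01.
have h := expR_ge1Dx (p + 2 * p ^+ 2).
have -> : - p - 2 * p ^+ 2 = - (p + 2 * p ^+ 2) by ring.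
rewrite expRN; have q0 : 0 < 1 - p by lra.
rewrite -[X in _ <= X]invrK lef_pV2 ?posrE ?invr_gt0 ?expR_gt0 //.
apply: le_trans h; rewrite -(ler_pM2l q0) mulfV ?gt_eqF //.
have : 0 <= p ^+ 2 * (1 - 2 * p) by rewrite mulr_ge0 ?sqr_ge0 //; lra.
nra.
Qed.

Lemma oneB_pow : p <= 2^-1 -> d * p <= 2^-1 -> expR (- d - 1) <= (1 - p) ^+ N.
Proof.
move=> p2 dp; have := expR_oneB p2 => h.
apply: le_trans (_ : expR (- p - 2 * p ^+ 2) ^+ N <= _).
  rewrite -expRM_natl ler_expR; rewrite /d in dp *; nra.
by apply: lerXn2r => //; rewrite nnegrE ?expR_ge0 //; have /andP[p0 p1] := p01; lra.
Qed.

Lemma oneB_pow_le k : (1 - p) ^+ k <= expR (- p * k%:R).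
Proof.
have /andP[p0 p1] := p01; rewrite mulrC expRM_natl; apply: lerXn2r; rewrite ?nnegrE ?expR_ge0 //; first lra.
exact: expR_ge1Dx.
Qed.

(** Bernoulli's inequality: [(1 - j / N)^j >= 1 - j^2 / N >= 1/2]. *)
Lemma bin_fact_ge j : (2 * j ^ 2 <= N)%N -> N%:R ^+ j <= 2 * ('C(N, j)%:R * j`!%:R) :> R.
Proof.
move=> jN; rewrite -natrM bin_ffact.
have jN' : (j <= N)%N by nia.
have h1 : (N%:R - j%:R) ^+ j <= (N ^_ j)%:R :> R.
  rewrite ffact_prod natr_prod -(card_ord j) -[X in _ ^+ X]card_ord -prodr_const.
  have -> : \prod_(i in 'I_#|'I_j|) (N%:R - #|'I_j|%:R) = \prod_(i < j) (N%:R - j%:R) :> R by rewrite !card_ord.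
  rewrite card_ord; apply: ler_prod => i _; rewrite natrB; last by have := ltn_ord i; lia.
  rewrite subr_ge0 ler_nat jN' lerD2l lerN2 ler_nat ltnW //.
have [->|j0] := posnP j; first by rewrite !expr0 ffactn0; lra.
have N0 : 0 < N%:R :> R by rewrite ltr0n; nia.
have bern : forall k (u : R), 0 <= u -> u <= 1 -> 1 - k%:R * u <= (1 - u) ^+ k.
  move=> k u u0 u1; elim: k => [|k IH]; first by rewrite mul0r subr0 expr0.
  rewrite exprS -natr1; have v0 : 0 <= 1 - u by lra.
  have := ler_wpM2l v0 IH; have : 0 <= k%:R * u ^+ 2 by rewrite mulr_ge0 ?sqr_ge0.
  nra.
have hb : 2^-1 <= (1 - j%:R / N%:R) ^+ j :> R.
  have u1 : j%:R / N%:R <= 1 :> R by rewrite ler_pdivrMr // mul1r ler_nat.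
  have u0 : 0 <= j%:R / N%:R :> R by rewrite divr_ge0.
  apply: le_trans (bern j _ u0 u1).
  have : 2 * (j%:R * (j%:R / N%:R)) <= 1 :> R.
    rewrite mulrA mulrA ler_pdivrMr // mul1r -!natrM ler_nat -mulnA; exact: jN.
  lra.
have -> : N%:R ^+ j = 2 * (N%:R ^+ j * 2^-1) :> R by rewrite mulrC -mulrA mulVf ?mulr1.
rewrite ler_pM2l //; apply: le_trans h1.
have -> : N%:R - j%:R = N%:R * (1 - j%:R / N%:R) :> R by rewrite mulrBr mulr1 mulrC mulfVK // gt_eqF.
by rewrite exprMn ler_wpM2l // exprn_ge0 // ltW.
Qed.

Lemma ffact_le_exp (m k : nat) : (m ^_ k <= m ^ k)%N.
Proof. by elim: k => // k IH; rewrite ffactnSr expnSr leq_mul // leq_subr. Qed.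

Lemma ln_fact_stir j : ln j`!%:R = stir R j - j%:R + (j%:R + 2^-1) * ln j%:R :> R.
Proof. by rewrite /stir; ring. Qed.

Lemma powfact_expR j : (0 < j)%N -> 0 < d ->
  d ^+ j / j`!%:R = expR (j%:R * ln (d / j%:R) + j%:R - stir R j - 2^-1 * ln j%:R).
Proof.
move=> j0 d0; have jR : 0 < j%:R :> R by rewrite ltr0n.
have fR : 0 < j`!%:R :> R by rewrite ltr0n fact_gt0.
rewrite -[LHS]lnK ?posrE ?divr_gt0 ?exprn_gt0 //; congr expR.
rewrite ln_div ?posrE ?exprn_gt0 // lnXn // ln_fact_stir ln_div ?posrE // -mulr_natl; ring.
Qed.

Lemma ln2_ge0 : 0 <= ln 2 :> R.
Proof. by apply: ln_ge0; lra. Qed.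

Lemma ln2_le1 : ln 2 <= 1 :> R.
Proof. have := @le_ln1Dx R 1; rewrite (_ : 1 + 1 = 2) //; apply; lra. Qed.

(** Comparison with the Poisson weight. The constant 7 collects 1 from [oneB_pow], 1 from [stir], at
    most 4 from [j] being up to 2 below [d / 2], and 1 for the factor 2 of [bin_fact_ge]. *)
Lemma bin_lower j : (0 < j)%N -> p <= 2^-1 -> d * p <= 2^-1 -> (2 * j ^ 2 <= N)%N ->
  j%:R <= d / 2 -> d / 2 - 2 <= j%:R ->
  expR (- 7 - d * ((1 - ln 2) / 2) - 2^-1 * ln d) <= bin p N j.
Proof.
move=> j0 p2 dp jN jd dj; have /andP[p0 p1] := p01.
have jR : 1 <= j%:R :> R by rewrite ler1n.
have d0 : 0 < d by lra.
have fR : 0 < j`!%:R :> R by rewrite ltr0n fact_gt0.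
have h1 : d ^+ j / j`!%:R * (1 - p) ^+ N <= 2 * bin p N j.
  apply: le_trans (_ : d ^+ j / j`!%:R * (1 - p) ^+ (N - j) <= _).
    apply: ler_wpM2l; first by rewrite divr_ge0 ?exprn_ge0 // ltW.
    by apply: ler_wiXn2l; [lra|lra|rewrite leq_subr].
  have -> : 2 * bin p N j = 2 * ('C(N, j)%:R * p ^+ j) * (1 - p) ^+ (N - j) by rewrite /bin; ring.
  apply: ler_wpM2r; first by rewrite exprn_ge0 //; lra.
  rewrite ler_pdivrMr // /d exprMn.
  have := ler_wpM2l (exprn_ge0 j p0) (bin_fact_ge jN); lra.
have h2 := oneB_pow p2 dp.
have e1 : 2 <= expR 1 :> R by have := expR_ge1Dx (1 : R); lra.
have h3 : expR (- 6 - d * ((1 - ln 2) / 2) - 2^-1 * ln d) <= d ^+ j / j`!%:R * (1 - p) ^+ N.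
  apply: le_trans (_ : d ^+ j / j`!%:R * expR (- d - 1) <= _); last first.
    by apply: ler_wpM2l h2; rewrite divr_ge0 ?exprn_ge0 // ltW.
  rewrite powfact_expR // -expRD ler_expR.
  have := stir_bounds R j0 => /andP[_ s1].
  have l1 : ln 2 <= ln (d / j%:R).
    rewrite ler_ln ?posrE ?divr_gt0 //; try lra.
    by rewrite ler_pdivlMr; lra.
  have l2 : ln j%:R <= ln d by rewrite ler_ln ?posrE; lra.
  have := ln2_le1; have := ln2_ge0; move: (ln 2) (ln (d / _)) l1 => a b ab a0 a1.
  have jp : 0 <= j%:R :> R by lra.
  have := ler_wpM2l jp ab.
  have : (d / 2 - 2) * (a + 1) <= j%:R * (a + 1) by apply: ler_wpM2r; lra.
  lra.
have : 2 * expR (- 7 - d * ((1 - ln 2) / 2) - 2^-1 * ln d) <= expR (- 6 - d * ((1 - ln 2) / 2) - 2^-1 * ln d).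
  have -> : - 6 - d * ((1 - ln 2) / 2) - 2^-1 * ln d = 1 + (- 7 - d * ((1 - ln 2) / 2) - 2^-1 * ln d) by ring.
  by rewrite [X in _ <= X]expRD; apply: ler_wpM2r => //; exact: expR_ge0.
lra.
Qed.

(** The same comparison from above. Here 6 covers 1 from [p * j <= 1], at most 4 from the excess of
    [j] over [d / 2], and the [ln 2] lost in replacing [ln j] by [ln d]. *)
Lemma bin_upper j : (0 < j)%N -> d / 2 <= j%:R -> j%:R <= d / 2 + 2 -> p * j%:R <= 1 -> 16 <= d ->
  bin p N j <= expR (6 - d * ((1 - ln 2) / 2) - 2^-1 * ln d).
Proof.
move=> j0 dj jd pj d16; have /andP[p0 p1] := p01.
have jR : 1 <= j%:R :> R by rewrite ler1n.
have d0 : 0 < d by lra.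
have fR : 0 < j`!%:R :> R by rewrite ltr0n fact_gt0.
have h1 : bin p N j <= d ^+ j / j`!%:R * expR (1 - d).
  rewrite /bin; have [jN|Nj] := leqP j N; last first.
    by rewrite bin_small // !mul0r mulr_ge0 ?expR_ge0 // divr_ge0 ?exprn_ge0 // ltW.
  apply: ler_pM.
  - by rewrite mulr_ge0 ?exprn_ge0.
  - by rewrite exprn_ge0 //; lra.
  - rewrite ler_pdivlMr // /d exprMn mulrAC mulrC; apply: ler_wpM2l; first exact: exprn_ge0.
    by rewrite -natrM bin_ffact -natrX ler_nat ffact_le_exp.
  - apply: le_trans (oneB_pow_le _) _; rewrite ler_expR natrB // /d; lra.
apply: le_trans h1 _; rewrite powfact_expR // -expRD ler_expR.
have := stir_bounds R j0 => /andP[s0 _].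
have l1 : ln (d / j%:R) <= ln 2.
  rewrite ler_ln ?posrE ?divr_gt0 //; try lra.
  by rewrite ler_pdivrMr; lra.
have l2 : ln d - ln 2 <= ln j%:R by rewrite -ln_div ?posrE // ler_ln ?posrE ?divr_gt0 //; lra.
have := ln2_le1; have := ln2_ge0; move: (ln 2) (ln (d / _)) l1 l2 => a b ab l2 a0 a1.
have jp : 0 <= j%:R :> R by lra.
have := ler_wpM2l jp ab.
have : j%:R * (a + 1) <= (d / 2 + 2) * (a + 1) by apply: ler_wpM2r; lra.
lra.
Qed.

(* Below [d / 2 + 2] consecutive binomial probabilities grow by a factor at least [3 / 2]. *)
Lemma cdf_le_bin j : j%:R <= d / 2 + 2 -> p * j%:R <= 1 -> 16 <= d ->
  cdf p N j.+1 <= 3 * bin p N j.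
Proof.
move=> jd pj d16; have /andP[p0 p1] := p01.
elim: j jd pj => [|j IH] jd pj; first by rewrite cdfS cdf0 add0r; have := bin_ge0 p01 N 0; lra.
have jj : j%:R <= j.+1%:R :> R by rewrite ler_nat.
have pjj := ler_wpM2l p0 jj.
rewrite cdfS; have := IH (le_trans jj jd) (le_trans pjj pj).
have b0 := bin_ge0 p01 N j; have b1 := bin_ge0 p01 N j.+1.
have st := bin_step j.
have h1 : (d - 1) * bin p N j <= j.+1%:R * bin p N j.+1.
  apply: le_trans (_ : (N%:R - j%:R) * p * bin p N j <= _).
    apply: ler_wpM2r => //; rewrite /d; lra.
  rewrite -st; have : 0 <= p * (j.+1%:R * bin p N j.+1) by apply: mulr_ge0 => //; apply: mulr_ge0.
  lra.
have h2 : j.+1%:R * bin p N j.+1 <= (d / 2 + 2) * bin p N j.+1 by apply: ler_wpM2r.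
have h3 : 3 * ((d - 1) * bin p N j) <= 2 * ((d - 1) * bin p N j.+1).
  have : 3 * ((d / 2 + 2) * bin p N j.+1) <= 2 * ((d - 1) * bin p N j.+1).
    have : 0 <= (d / 2 - 8) * bin p N j.+1 by rewrite mulr_ge0 //; lra.
    lra.
  lra.
have d1 : 0 < d - 1 by lra.
have h4 : 3 * bin p N j <= 2 * bin p N j.+1.
  rewrite -(ler_pM2l d1); lra.
lra.
Qed.

End BinomialEstimates.

(** * Typical graphs *)

Section Typical.
Variable R : realType.

Variables eta eps : R.
Hypotheses (eta_gt0 : 0 < eta) (eta_le : eta <= 100^-1) (eps_gt0 : 0 < eps) (eps_le : eps <= eta).

Section Fixed.
Variables (p : R) (n : nat).
Hypothesis p01 : 0 <= p <= 1.
Hypothesis n1 : (1 < n)%N.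
Let d : R := p * n.-1%:R.

(** The number of edges per vertex tolerated in a set of at most [ssmall] vertices. *)
Definition tmult : nat := (Num.truncn (eta * (p * n.-1%:R))).+1.
Definition ssmall : nat := (Num.truncn (eps * n%:R)).+1.

Lemma tmult_bounds : 0 <= d -> eta * d <= tmult%:R <= eta * d + 1.
Proof.
move=> d0; have h : 0 <= eta * d by rewrite mulr_ge0 // ltW.
have /andP[h1 h2] := truncn_itv h.
by rewrite (ltW h2) /= /tmult -natr1 lerD2r.
Qed.

Lemma ssmall_bounds : eps * n%:R <= ssmall%:R <= eps * n%:R + 1.
Proof.
have h : 0 <= eps * n%:R by rewrite mulr_ge0 // ltW.
have /andP[h1 h2] := truncn_itv h.
by rewrite (ltW h2) /= /ssmall -natr1 lerD2r.
Qed.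

Definition edges_off (tau : R) (E : {set {set 'I_n}}) := tau <= `|#|E|%:R - 'C(n, 2)%:R * p|.

Definition dense_small (E : {set {set 'I_n}}) :=
  [exists (X : {set 'I_n} | (X != finset.set0) && (#|X| <= ssmall)%N), (tmult * #|X| <= ind E X)%N].

Definition dense_mid (E : {set {set 'I_n}}) :=
  [exists (X : {set 'I_n} | (ssmall < #|X|)%N && (#|X| <= n - ssmall)%N),
     (1 - eps / 8) * d / 2 * (#|X|%:R - 1) <= (ind E X)%:R].

Lemma mean_edges : 'C(n, 2)%:R * p = d * n%:R / 2.
Proof.
have := bin2R R n; rewrite /d -subn1 natrB 1?ltnW // => h.
have -> : 'C(n, 2)%:R * p = (2 * 'C(n, 2)%:R) * p / 2 by field.
rewrite h; ring.
Qed.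

Lemma typical_packing (E : {set {set 'I_n}}) k th : E \subset pairs n -> 100 <= d ->
  ~~ edges_off (eps / 16 * d * n%:R) E -> ~~ dense_small E -> ~~ dense_mid E ->
  ~~ (adj_low th E || common_low th E) ->
  (k * n.-1 <= #|E|)%N -> (forall v, k <= deg E v)%N -> (k + 2 * tmult + 2 <= th)%N ->
  has_disj_trees E k.
Proof.
move=> sE d100; rewrite /edges_off -ltNge mean_edges => few sm md.
rewrite negb_or => /andP[al cl] km kdeg kth.
have e0 := eps_gt0; have e1 := eps_le; have e2 := eta_le.
have d0 : 0 <= d by lra.
have n0 : 0 < n%:R :> R by rewrite ltr0n ltnW.
have nn : n.-1%:R = n%:R - 1 :> R by rewrite -subn1 natrB 1?ltnW.
(* The deviation [eps / 16] is matched to the factor [1 - eps / 8] in [dense_mid], so a set that is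
   not dense stays below the actual edge density. *)
have mlow : (1 - eps / 8) * d / 2 * n%:R <= #|E|%:R.
  move: few; rewrite ltr_norml => /andP[h _].
  have -> : (1 - eps / 8) * d / 2 * n%:R = d * n%:R / 2 - eps / 16 * d * n%:R by field.
  lra.
have sm' X : X != finset.set0 -> (#|X| <= ssmall)%N -> (ind E X < tmult * #|X|)%N.
  move=> X0 Xs; rewrite ltnNge; apply: contra sm => h; apply/existsP; exists X.
  by rewrite X0 Xs.
apply: (@packing_criterion n E k tmult ssmall) => //.
- move=> X Xs; have [->|X0] := eqVneq X finset.set0; last by rewrite ltnW // sm'.
  rewrite cards0 muln0 leqn0 cards_eq0; apply/eqP/setP => e; rewrite !inE.
  apply/negP => /andP[/(subsetP sE)]; rewrite inE => /eqP ce.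
  by move=> /subset_leq_card; rewrite cards0 ce.
- move=> X X0 Xs; have cX : (0 < #|X|)%N by rewrite card_gt0.
  have cR : #|X|.-1%:R = #|X|%:R - 1 :> R by rewrite -subn1 natrB.
  rewrite -(ler_nat R) !natrM cR.
  (* The density condition also covers small sets: from two vertices on, [#|X| <= 2 * (#|X| - 1)],
     and [2 * tmult] is far below [d / 2] as [eta] is at most 1/100. *)
  have [Xss|Xss] := leqP #|X| ssmall.
    have [X1|X1] := eqVneq #|X| 1%N.
      have /eqP/cards1P[v Xv] := X1.
      by rewrite Xv ind1 // cards1 subrr mulr0 mul0r.
    have cX2 : 2 <= #|X|%:R :> R by rewrite ler_nat; move: cX X1; case: #|X| => [|[]].
    have := sm' X X0 Xss; rewrite -(ltr_nat R) natrM => h.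
    have /andP[_ tb] := tmult_bounds d0.
    have h1 : (ind E X)%:R <= 2 * tmult%:R * (#|X|%:R - 1) :> R.
      have : 0 <= tmult%:R * (#|X|%:R - 2) :> R by rewrite mulr_ge0 //; lra.
      lra.
    have h2 : 2 * tmult%:R * n.-1%:R <= #|E|%:R :> R.
      apply: le_trans mlow; rewrite nn.
      apply: le_trans (_ : 2 * tmult%:R * n%:R <= _); first by rewrite ler_wpM2l // ?mulr_ge0 //; lra.
      rewrite ler_pM2r //.
      have : eta * d <= 100^-1 * d by rewrite ler_wpM2r.
      have : eps * d <= 100^-1 * d by rewrite ler_wpM2r //; lra.
      lra.
    have c1 : 0 <= #|X|%:R - 1 :> R by lra.
    have n1R : 0 <= n.-1%:R :> R by [].
    have := ler_wpM2r n1R h1; have := ler_wpM2r c1 h2; lra.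
  have h : (ind E X)%:R < (1 - eps / 8) * d / 2 * (#|X|%:R - 1).
    rewrite ltNge; apply: contra md => h; apply/existsP; exists X.
    by rewrite Xss Xs.
  have c1 : 0 <= #|X|%:R - 1 :> R by rewrite subr_ge0 ler1n.
  have n1R : 0 <= n.-1%:R :> R by [].
  have c0 : 0 <= (1 - eps / 8) * d / 2 by rewrite divr_ge0 // mulr_ge0 //; lra.
  have := ler_wpM2r n1R (ltW h); have := ler_wpM2r c1 mlow.
  have := mulr_ge0 c0 c1; rewrite nn; lra.
- have [h1 h2] := isolated_lowP sE al cl.
  by split => [u v du dv|u v w du dv]; [apply: h1|apply: h2]; apply: leq_trans kth.
Qed.

End Fixed.
End Typical.

(** * Probability estimates for large [x = ln n], uniform in [p] *)

Section Whp.
Variable R : realType.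
Implicit Types (x : R) (n k : nat).
Local Open Scope classical_set_scope.

Lemma pinfty_ge (c : R) : \forall x \near +oo, c <= x.
Proof. by apply: nbhs_pinfty_ge; rewrite num_real. Qed.

Lemma poly_expR_near k (K a e : R) : 0 < a -> 0 < e ->
  \forall x \near +oo, K * x ^+ k * expR (- (a * x)) <= e.
Proof.
move=> a0 e0; pose c : R := a ^+ k.+1 / k.+1`!%:R.
have c0 : 0 < c by rewrite divr_gt0 ?exprn_gt0 ?ltr0n ?fact_gt0.
have ce : 0 < c * e by rewrite mulr_gt0.
near=> x.
have x1 : 1 <= x by near: x; exact: pinfty_ge.
have xK : `|K| / (c * e) <= x by near: x; exact: pinfty_ge.
have ax : 0 <= a * x by rewrite mulr_ge0 //; lra.
have h := expR_ge1Dxn k ax.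
have h' : c * x ^+ k.+1 <= expR (a * x).
  by apply: le_trans h; rewrite /c mulrAC -exprMn lerDr.
rewrite expRN ler_pdivrMr ?expR_gt0 //.
have xk : 0 < x ^+ k by rewrite exprn_gt0 //; lra.
apply: le_trans (_ : e * (c * x ^+ k.+1) <= _); last by rewrite ler_wpM2l // ltW.
rewrite exprS mulrA mulrA [e * c]mulrC ler_pM2r //.
rewrite ler_pdivrMr // in xK.
have := ler_norm K; lra.
Unshelve. all: by end_near. Qed.

Lemma expR_near (K a e : R) : 0 < a -> 0 < e -> \forall x \near +oo, K * expR (- (a * x)) <= e.
Proof.
move=> a0 e0; have := poly_expR_near 0 K a0 e0; apply: filterS => x.
by rewrite expr0 mulr1.
Qed.

Lemma ln_natE n : 0 < ln n%:R :> R -> (1 < n)%N /\ n%:R = expR (ln n%:R) :> R.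
Proof.
move=> l0; have n1 : (1 < n)%N.
  case: n l0 => [|[|//]]; last by rewrite ln1 ltxx.
  by rewrite ln0 // ltxx.
by split=> //; rewrite lnK // posrE ltr0n ltnW.
Qed.

Section Eta.
Variable eta : R.
Hypotheses (eta_gt0 : 0 < eta) (eta_le : eta <= 100^-1).

(** With the tilt [8 / eta] for small sets, [4 * eps * d * expR (8 / eta)] is exactly [d], against a
    gain of at least [8 * d]. *)
Definition eps : R := expR (- (8 / eta)) / 4.

Lemma eps_gt0 : 0 < eps. Proof. by rewrite divr_gt0 ?expR_gt0. Qed.

Lemma eps_le : eps <= eta.
Proof.
rewrite /eps expRN; have h := expR_ge1Dx (8 / eta).
have e8 : 0 < 8 / eta by rewrite divr_gt0.
have : (expR (8 / eta))^-1 <= eta / 8.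
  rewrite -[X in _ <= X]invrK lef_pV2 ?posrE ?expR_gt0 ?invr_gt0 ?divr_gt0 // invf_div; lra.
have := eta_gt0; lra.
Qed.

(** The tilt [eps / 32] minimises the exponent of [edges_concentrated] for this deviation. *)
Lemma edges_off_small (e : R) : 0 < e -> \forall x \near +oo, forall n (p : R),
  0 <= p <= 1 -> ln n%:R = x -> x / 2 <= p * n.-1%:R ->
  prob p (edges_off p (eps / 16 * (p * n.-1%:R) * n%:R) (n := n)) <= e.
Proof.
move=> e0; have ep0 := eps_gt0; have ep1 := eps_le; have et1 := eta_le.
have a1 : 0 < (eps / 32) ^+ 2 by rewrite exprn_gt0 // divr_gt0.
near=> x => n p p01 lnx dx; have /andP[p0 p1] := p01; set d := p * n.-1%:R in dx *.
have x2 : 2 <= x by near: x; exact: pinfty_ge.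
have [n1 nE] : (1 < n)%N /\ n%:R = expR x by rewrite -lnx; apply: ln_natE; rewrite lnx; lra.
have nx : 1 + x <= n%:R by rewrite nE expR_ge1Dx.
have d1 : 1 <= d by lra.
have l0 : 0 <= eps / 32 by lra.
have l1 : eps / 32 <= 2^-1 by lra.
rewrite /edges_off; apply: le_trans (edges_concentrated n p01 (eps / 16 * d * n%:R) l0 l1) _.
apply: le_trans (_ : 2 * expR (- ((eps / 32) ^+ 2 * x)) <= _); last first.
  by near: x; exact: expR_near.
rewrite ler_pM2l // ler_expR mean_edges // -/d.
have -> : - (eps / 32) * (eps / 16 * d * n%:R) + 2 * (d * n%:R / 2) * (eps / 32) ^+ 2 =
          - ((eps / 32) ^+ 2 * (d * n%:R)) by field.
rewrite lerN2 ler_pM2l //.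
have : 0 <= (d - 1) * n%:R by rewrite mulr_ge0 //; lra.
lra.
Unshelve. all: by end_near. Qed.

Lemma dense_small_whp (e : R) : 0 < e -> \forall x \near +oo, forall n (p : R),
  0 <= p <= 1 -> ln n%:R = x -> x / 2 <= p * n.-1%:R ->
  prob p (dense_small eta eps p (n := n)) <= e.
Proof.
move=> e0; have ep0 := eps_gt0; have ep1 := eps_le; have et1 := eta_le.
near=> x => n p p01 lnx dx; have /andP[p0 p1] := p01; set d := p * n.-1%:R in dx *.
have x2 : 2 <= x by near: x; exact: pinfty_ge.
have [n1 nE] : (1 < n)%N /\ n%:R = expR x by rewrite -lnx; apply: ln_natE; rewrite lnx; lra.
have nx : 1 + x <= n%:R by rewrite nE expR_ge1Dx.
have d1 : 1 <= d by lra.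
have nn : n.-1%:R = n%:R - 1 :> R by rewrite -subn1 natrB 1?ltnW.
have ed : 2 / eps <= x by near: x; exact: pinfty_ge.
have pd : p <= eps / 2 * d.
  rewrite /d nn; rewrite ler_pdivrMr // in ed.
  have : 0 <= p * ((n%:R - 1 - x) * eps) by apply: mulr_ge0 => //; apply: mulr_ge0; lra.
  have := ler_wpM2l p0 ed; lra.
have l0 : 0 <= 8 / eta by rewrite divr_ge0 // ltW.
rewrite /dense_small; apply: le_trans (small_sets n p01 (tmult eta p n) (ssmall eps n) l0) _.
(* The exponent is at most [- 8 d + d = - 7 d], and [d >= x / 2]. *)
have zle : expR (- (8 / eta) * (tmult eta p n)%:R + (ssmall eps n)%:R * p * (expR (8 / eta) - 1)) <= expR (- (7 / 2 * x)).
  rewrite ler_expR.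
  have d0 : 0 <= d by lra.
  have /andP[t0 _] := tmult_bounds eta_gt0 d0.
  have /andP[_ s0] := ssmall_bounds ep0 n.
  have k1 : 8 * d <= 8 / eta * (tmult eta p n)%:R.
    have := ler_wpM2l l0 t0; have -> : 8 / eta * (eta * d) = 8 * d by field; rewrite gt_eqF.
      by [].
  have k2 : (ssmall eps n)%:R * p <= 4 * eps * d.
    apply: le_trans (ler_wpM2r p0 s0) _.
    have -> : (eps * n%:R + 1) * p = eps * d + eps * p + p by rewrite /d nn; ring.
    have : eps * p <= 1 * p by apply: ler_wpM2r; lra.
    lra.
  have k3 : (ssmall eps n)%:R * p * (expR (8 / eta) - 1) <= d.
    have er : 0 <= expR (8 / eta) by apply: expR_ge0.
    have sp : 0 <= (ssmall eps n)%:R * p by rewrite mulr_ge0.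
    apply: le_trans (_ : 4 * eps * d * expR (8 / eta) <= _).
      have := ler_wpM2r er k2; lra.
    rewrite /eps expRN; have u0 := expR_gt0 (8 / eta).
    move: (expR (8 / eta)) u0 => u u0.
    by rewrite [X in X <= _](_ : _ = d) //; field; rewrite gt_eqF.
  lra.
apply: le_trans (_ : expR (expR (- (5 / 2 * x))) - 1 <= _).
  rewrite lerD2r ler_expR; apply: le_trans (ler_wpM2l _ zle) _ => //.
  by rewrite nE -expRD ler_expR; lra.
have z2 : 2 * expR (- (5 / 2 * x)) <= 1 by near: x; apply: expR_near => //; lra.
have zz := expR_ge0 (- (5 / 2 * x)).
have zh : expR (- (5 / 2 * x)) <= 2^-1 by lra.
apply: le_trans (expR_le zz zh) _.
have ze : 3 * expR (- (5 / 2 * x)) <= e by near: x; apply: expR_near => //; lra.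
have : 0 <= expR (- (5 / 2 * x)) * (1 - expR (- (5 / 2 * x))) by rewrite mulr_ge0 //; lra.
lra.
Unshelve. all: by end_near. Qed.

Lemma dense_mid_whp (e : R) : 0 < e -> \forall x \near +oo, forall n (p : R),
  0 <= p <= 1 -> ln n%:R = x -> x / 2 <= p * n.-1%:R ->
  prob p (dense_mid eps p (n := n)) <= e.
Proof.
move=> e0; have ep0 := eps_gt0; have ep1 := eps_le; have et1 := eta_le.
near=> x => n p p01 lnx dx; have /andP[p0 p1] := p01; set d := p * n.-1%:R in dx *.
have x2 : 2 <= x by near: x; exact: pinfty_ge.
have [n1 nE] : (1 < n)%N /\ n%:R = expR x by rewrite -lnx; apply: ln_natE; rewrite lnx; lra.
have nx : 1 + x <= n%:R by rewrite nE expR_ge1Dx.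
have d1 : 1 <= d by lra.
have nn : n.-1%:R = n%:R - 1 :> R by rewrite -subn1 natrB 1?ltnW.
have ed : 2 / eps <= x by near: x; exact: pinfty_ge.
have pd : p <= eps / 2 * d.
  rewrite /d nn; rewrite ler_pdivrMr // in ed.
  have : 0 <= p * ((n%:R - 1 - x) * eps) by apply: mulr_ge0 => //; apply: mulr_ge0; lra.
  have := ler_wpM2l p0 ed; lra.
have l0 : 0 <= eps / 16 by lra.
have l1 : eps / 16 <= 2^-1 by lra.
have /andP[s0 _] := ssmall_bounds ep0 n.
have k0 : 0 <= d * eps ^+ 2 / 128 by rewrite divr_ge0 // mulr_ge0 ?sqr_ge0 //; lra.
(* The mean density is at most [(1 - eps / 2) * d / 2] since [ssmall] vertices are missing. Its gap
   to [(1 - eps / 8) * d / 2] yields an exponent of order [d * eps ^+ 2]. *)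
have hc : (n - ssmall eps n)%:R * p / 2 * (expR (eps / 16) - 1) + d * eps ^+ 2 / 128 <= eps / 16 * ((1 - eps / 8) * d / 2).
  have m1 : (n - ssmall eps n)%:R * p <= (1 - eps / 2) * d.
    have m2 : (n - ssmall eps n)%:R <= (1 - eps) * n%:R.
      have [sn|ns] := leqP (ssmall eps n) n; first by rewrite natrB //; lra.
      by rewrite (eqP (ltnW ns : (n - ssmall eps n == 0)%N)) mulr_ge0 //; lra.
    apply: le_trans (ler_wpM2r p0 m2) _.
    have -> : (1 - eps) * n%:R * p = (1 - eps) * (d + p) by rewrite /d nn; ring.
    have : (1 - eps) * p <= 1 * (eps / 2 * d).
      by apply: ler_pM => //; lra.
    lra.
  have m3 := expR_le l0 l1.
  have m4 : 0 <= expR (eps / 16) - 1 by have := expR_ge1Dx (eps / 16); lra.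
  have m5 : 0 <= (1 - eps / 2) * d by rewrite mulr_ge0 //; lra.
  have m6 : (n - ssmall eps n)%:R * p * (expR (eps / 16) - 1) <= (1 - eps / 2) * d * (eps / 16 + 2 * (eps / 16) ^+ 2).
    apply: ler_pM => //; by rewrite mulr_ge0.
  have m7 : 0 <= d * eps ^+ 3 by rewrite mulr_ge0 ?exprn_ge0 //; lra.
  have -> : (n - ssmall eps n)%:R * p / 2 * (expR (eps / 16) - 1) = ((n - ssmall eps n)%:R * p * (expR (eps / 16) - 1)) / 2 by ring.
  have : (1 - eps / 2) * d * (eps / 16 + 2 * (eps / 16) ^+ 2) = d * eps / 16 - 3 / 128 * (d * eps ^+ 2) - d * eps ^+ 3 / 256 by field.
  have : eps / 16 * ((1 - eps / 8) * d / 2) = d * eps / 32 - d * eps ^+ 2 / 256 by field.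
  lra.
rewrite /dense_mid; apply: le_trans (mid_sets n p01 l0 _ hc k0) _ => //.
have ex : 1 * expR (- (1 * x)) <= e by near: x; apply: expR_near.
rewrite mul1r mul1r in ex; apply: le_trans ex.
(* Once [d * eps ^+ 3 >= 256], the Chernoff gain is at least [2 n] and beats the number of sets. *)
apply: le_trans (_ : expR n%:R * expR (- (d * eps ^+ 2 / 128) * (ssmall eps n)%:R) <= _).
  rewrite ler_wpM2r ?expR_ge0 // -[n%:R]mulr1 expRM_natl lerXn2r ?nnegrE ?expR_ge0 //.
  by have := expR_ge1Dx (1 : R); lra.
rewrite -expRD ler_expR.
have xe : 512 / eps ^+ 3 <= x by near: x; exact: pinfty_ge.
rewrite ler_pdivrMr ?exprn_gt0 // in xe.
have de : 256 <= d * eps ^+ 3.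
  have := ler_wpM2r (exprn_ge0 3 (ltW ep0)) dx; lra.
have k1 : d * eps ^+ 2 / 128 * (eps * n%:R) <= d * eps ^+ 2 / 128 * (ssmall eps n)%:R by apply: ler_wpM2l.
have nR : 0 <= n%:R :> R by [].
have := ler_wpM2r nR de; lra.
Unshelve. all: by end_near. Qed.

Lemma typical_whp (e : R) : 0 < e -> \forall x \near +oo, forall n (p : R),
  0 <= p <= 1 -> ln n%:R = x -> x / 2 <= p * n.-1%:R ->
  prob p (fun E : {set {set 'I_n}} => [|| edges_off p (eps / 16 * (p * n.-1%:R) * n%:R) E,
    dense_small eta eps p E | dense_mid eps p E]) <= e.
Proof.
move=> e0; have e3 : 0 < e / 3 by rewrite divr_gt0.
move: (edges_off_small e3) (dense_small_whp e3) (dense_mid_whp e3).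
apply: filterS3 => x h1 h2 h3 n p p01 lnx dx.
have k1 := h1 n p p01 lnx dx; have k2 := h2 n p p01 lnx dx; have k3 := h3 n p p01 lnx dx.
apply: le_trans (prob_or p01 _ _) _.
have k23 : prob p (fun E : {set {set 'I_n}} => dense_small eta eps p E || dense_mid eps p E) <= e / 3 + e / 3.
  by apply: le_trans (prob_or p01 _ _) _; apply: lerD.
have -> : e = e / 3 + (e / 3 + e / 3) by field.
exact: lerD.
Qed.

End Eta.

(** A deviation of [n / 2] moves [m / (n - 1)] by about 1/2 only, precise enough for comparison with
    a degree near [d / 2]. *)
Lemma edges_off_whp (e : R) : 0 < e -> \forall x \near +oo, forall n (p : R),
  0 <= p <= 1 -> ln n%:R = x -> x / 2 <= p * n.-1%:R -> p * n.-1%:R <= 20 * x ->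
  prob p (fun E : {set {set 'I_n}} => edges_off p (n%:R / 2) E) <= e.
Proof.
move=> e0; near=> x => n p p01 lnx dx d20; have /andP[p0 p1] := p01; set d := p * n.-1%:R in dx d20 *.
have x4 : 4 <= x by near: x; exact: pinfty_ge.
have [n1 nE] : (1 < n)%N /\ n%:R = expR x by rewrite -lnx; apply: ln_natE; rewrite lnx; lra.
have d2 : 2 <= d by lra.
have d0 : 0 < 4 * d by lra.
have l0 : 0 <= (4 * d)^-1 by rewrite invr_ge0 ltW.
have l1 : (4 * d)^-1 <= 2^-1 by rewrite lef_pV2 ?posrE //; lra.
apply: le_trans (edges_concentrated n p01 _ l0 l1) _.
apply: le_trans (_ : 2 * expR (- (1 * x)) <= _); last by near: x; apply: expR_near.
rewrite ler_pM2l // ler_expR mean_edges // -/d.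
have -> : - (4 * d)^-1 * (n%:R / 2) + 2 * (d * n%:R / 2) * (4 * d)^-1 ^+ 2 = - (n%:R / (16 * d)).
  by field; rewrite gt_eqF //; lra.
rewrite lerN2 mul1r ler_pdivlMr; last by lra.
have h : 320 * x ^+ 2 * expR (- (1 * x)) <= 1 by near: x; apply: poly_expR_near.
rewrite mul1r expRN ler_pdivrMr ?expR_gt0 // mul1r -nE in h.
have : 0 <= x * (20 * x - d) by rewrite mulr_ge0 //; lra.
lra.
Unshelve. all: by end_near. Qed.

End Whp.

(** * Minimum degree near and above the threshold *)

Section Cases.
Variable R : realType.
Implicit Types (x : R) (n k : nat).
Local Open Scope classical_set_scope.

Definition inv_beta : R := (1 - ln 2) / 2.

Lemma ln2_le : ln 2 <= 8 / 10 :> R.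
Proof.
rewrite -[X in _ <= X]expRK ler_ln ?posrE ?expR_gt0 //.
have -> : 8 / 10 = 8%:R * (1 / 10) :> R by field.
rewrite expRM_natl; have h := expR_ge1Dx (1 / 10 : R).
apply: le_trans (_ : (1 + 1 / 10) ^+ 8 <= _); first by lra.
by apply: lerXn2r; rewrite // nnegrE ?expR_ge0 //; lra.
Qed.

Lemma inv_beta_bounds : 10^-1 <= inv_beta <= 2^-1.
Proof. by rewrite /inv_beta; have := ln2_le; have := ln2_ge0 R; move=> h1 h2; apply/andP; split; lra. Qed.

Lemma betaE : beta R = inv_beta^-1.
Proof.
rewrite /beta ln_div ?posrE ?expR_gt0 // expRK /inv_beta invf_div //.
Qed.

(** Lets decay in [d] be used where [d >= x] has no upper bound. *)
Lemma near_up (P : R -> Prop) : (\forall x \near +oo, P x) ->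
  \forall x \near +oo, forall y : R, x <= y -> P y.
Proof.
move=> [M [Mr h]]; exists M; split=> // x Mx y xy; apply: h; exact: lt_le_trans xy.
Qed.

(** Used to make [p], [d * p] and [p * j] small for [j] of order [d]. *)
Lemma p_small (e : R) : 0 < e -> \forall x \near +oo, forall n (p : R),
  0 <= p -> ln n%:R = x -> p * n.-1%:R <= 20 * x -> 20 * x * p <= e.
Proof.
move=> e0; near=> x => n p p0 lnx d20.
have x1 : 1 <= x by near: x; exact: pinfty_ge.
have [n1 nE] : (1 < n)%N /\ n%:R = expR x by rewrite -lnx; apply: ln_natE; rewrite lnx; lra.
have nn : n.-1%:R = n%:R - 1 :> R by rewrite -subn1 natrB 1?ltnW.
have nx := expR_ge1Dx x; rewrite -nE in nx.
have h : 800 * x ^+ 2 * expR (- (1 * x)) <= e by near: x; apply: poly_expR_near.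
rewrite mul1r expRN -nE ler_pdivrMr in h; last by lra.
have h2 : p * n%:R <= 40 * x.
  have : p * n%:R <= 2 * (p * n.-1%:R).
    have : 0 <= p * (n%:R - 2) by rewrite mulr_ge0 //; lra.
    rewrite nn; lra.
  lra.
have n0 : 0 < n%:R :> R by lra.
rewrite -(ler_pM2r n0); apply: le_trans h.
have x20 : 0 <= 20 * x by lra.
have := ler_wpM2l x20 h2; lra.
Unshelve. all: by end_near. Qed.

Lemma low_conflict_le n (p q : R) : 0 <= p -> (1 < n)%N -> 1 <= p * n.-1%:R ->
  (n%:R ^+ 2 * p + n%:R ^+ 3 * p ^+ 2) * q ^+ 2 <= 6 * n%:R * (p * n.-1%:R) ^+ 2 * q ^+ 2.
Proof.
move=> p0 n1 d1; apply: ler_wpM2r; first exact: sqr_ge0.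
have nn : n.-1%:R = n%:R - 1 :> R by rewrite -subn1 natrB 1?ltnW.
have n2 : 2 <= n%:R :> R by rewrite ler_nat.
have np : p * n%:R <= 2 * (p * n.-1%:R).
  have : 0 <= p * (n%:R - 2) by rewrite mulr_ge0 //; lra.
  rewrite nn; lra.
move: np d1; move: (p * n.-1%:R) => d np d1.
have np0 : 0 <= p * n%:R by rewrite mulr_ge0.
have h1 : (p * n%:R) ^+ 2 <= (2 * d) ^+ 2 by apply: lerXn2r; rewrite ?nnegrE //; lra.
have h2 : p * n%:R <= 2 * d ^+ 2.
  apply: le_trans np _; have : 0 <= d * (d - 1) by rewrite mulr_ge0; lra.
  lra.
have -> : n%:R ^+ 2 * p + n%:R ^+ 3 * p ^+ 2 = n%:R * (p * n%:R + (p * n%:R) ^+ 2) by ring.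
have -> : 6 * n%:R * d ^+ 2 = n%:R * (6 * d ^+ 2) by ring.
apply: ler_wpM2l => //; lra.
Qed.

Lemma prob_exists_low n (p : R) j : 0 <= p <= 1 ->
  prob p (fun E : {set {set 'I_n}} => [exists v, deg E v < j]%N) <= n%:R * cdf p n.-1 j.
Proof.
move=> p01; apply: le_trans (_ : \sum_(v : 'I_n | true) prob p (fun E : {set {set 'I_n}} => (deg E v < j)%N) <= _).
  exact: (prob_exists p01 predT (fun v (E : {set {set 'I_n}}) => (deg E v < j)%N)).
by rewrite (eq_bigr (fun=> cdf p n.-1 j)) => [|v _]; rewrite ?prob_deg // sumr_const card_ord mulr_natl.
Qed.

(** Chernoff with tilt [ln 2], optimal at half the mean; for [y = d / 2] and [d] the mean the
    exponent is [- inv_beta * d]. *)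
Lemma cdf_half N (p y : R) : 0 <= p <= 1 -> 0 <= y ->
  cdf p N (Num.truncn y).+1 <= expR (ln 2 * y - N%:R * p / 2).
Proof.
move=> p01 y0; apply: le_trans (cdf_chernoff p01 N (Num.truncn y) (ln2_ge0 R)) _.
rewrite expRN lnK ?posrE //; rewrite ler_expR.
have /andP[ty _] := truncn_itv y0.
have := ler_wpM2l (ln2_ge0 R) ty; lra.
Qed.

(** Small enough that shifting a degree bound by a few multiples of [eta * d] changes tail exponents
    only by a small fraction of [ln n]. *)
Definition eta : R := 100^-1 / 100.

Lemma eta_gt0 : 0 < eta. Proof. by rewrite divr_gt0. Qed.
Lemma eta_le : eta <= 100^-1. Proof. by rewrite /eta; lra. Qed.

Section AboveThreshold.

(** The margin [5 * eta] covers a degree bound up to [(2^-1 + eta) * d], the surplus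
    [2 * tmult + 2], and rounding. *)
Definition theta2 (p : R) n : nat := (Num.truncn ((2^-1 + 5 * eta) * (p * n.-1%:R))).+1.

(** Each tail is roughly [exp(- inv_beta d)], at most about [n^(-0.9)]; two of them beat the factor
    [n d^2] with an exponential in [d] to spare. *)
Lemma low_conflict2_whp (e : R) : 0 < e -> \forall x \near +oo, forall n (p : R),
  0 <= p <= 1 -> ln n%:R = x -> 9 / 10 * x <= inv_beta * (p * n.-1%:R) ->
  prob p (fun E : {set {set 'I_n}} => adj_low (theta2 p n) E || common_low (theta2 p n) E) <= e.
Proof.
move=> e0; have /andP[c1 c2] := inv_beta_bounds.
have H : \forall x \near +oo, forall y : R, x <= y -> 6 * expR 2 * y ^+ 2 * expR (- (20^-1 * y)) <= e.
  by apply: near_up; apply: poly_expR_near.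
near=> x => n p p01 lnx cd; have /andP[p0 p1] := p01.
have x3 : 3 <= x by near: x; exact: pinfty_ge.
have [n1 nE] : (1 < n)%N /\ n%:R = expR x by rewrite -lnx; apply: ln_natE; rewrite lnx; lra.
have nx := expR_ge1Dx x; rewrite -nE in nx.
apply: le_trans (prob_low_conflict n p01 _) _.
set d := p * n.-1%:R in cd *.
have n3 : (3 <= n)%N by rewrite -(ler_nat R); lra.
have dx : x <= d.
  have : inv_beta * d <= 2^-1 * d by apply: ler_wpM2r; rewrite // mulr_ge0.
  lra.
apply: le_trans (low_conflict_le _ p0 n1 _) _; first by rewrite -/d; lra.
rewrite -/d; have d0 : 0 <= d by lra.
have y0 : 0 <= (2^-1 + 5 * eta) * d by rewrite mulr_ge0 // addr_ge0 // mulr_ge0 // ltW // eta_gt0.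
have := cdf_half n.-2.-1 p01 y0; rewrite -/(theta2 p n) => hq.
have nN : n.-2.-1%:R * p = d - 2 * p.
  rewrite /d; have -> : n.-1%:R = n.-2.-1%:R + 2 :> R by rewrite -natrD; congr (_%:R); clear - n3; case: n n3 => [|[|[|m]]] // _; rewrite addn2.
  ring.
have q0 := cdf_ge0 p01 n.-2.-1 (theta2 p n).
have hq' : cdf p n.-2.-1 (theta2 p n) <= expR (1 - (inv_beta - 5 * eta) * d).
  apply: le_trans hq _; rewrite ler_expR nN.
  have : ln 2 * ((2^-1 + 5 * eta) * d) = ln 2 * d / 2 + ln 2 * (5 * eta * d) by ring.
  have : ln 2 * (5 * eta * d) <= 1 * (5 * eta * d).
    by apply: ler_wpM2r (ln2_le1 R); rewrite !mulr_ge0 // ltW // eta_gt0.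
  rewrite /inv_beta; lra.
have hq2 : cdf p n.-2.-1 (theta2 p n) ^+ 2 <= expR (2 - 2 * (inv_beta - 5 * eta) * d).
  have -> : 2 - 2 * (inv_beta - 5 * eta) * d = 2%:R * (1 - (inv_beta - 5 * eta) * d) by ring.
  by rewrite expRM_natl; apply: lerXn2r; rewrite ?nnegrE ?expR_ge0.
have dn : 6 * n%:R * d ^+ 2 >= 0 by rewrite !mulr_ge0 ?sqr_ge0.
apply: le_trans (ler_wpM2l dn hq2) _.
have fin : 6 * expR 2 * d ^+ 2 * expR (- (20^-1 * d)) <= e.
  by move: d dx {cd y0 hq nN hq' hq2 dn d0}; near: x; exact: H.
apply: le_trans fin.
have -> : 6 * n%:R * d ^+ 2 * expR (2 - 2 * (inv_beta - 5 * eta) * d) = 6 * d ^+ 2 * expR (x + (2 - 2 * (inv_beta - 5 * eta) * d)).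
  by rewrite expRD nE; ring.
have -> : 6 * expR 2 * d ^+ 2 * expR (- (20^-1 * d)) = 6 * d ^+ 2 * expR (2 + - (20^-1 * d)) by rewrite [in RHS]expRD; ring.
apply: ler_wpM2l; first by rewrite mulr_ge0 ?sqr_ge0.
rewrite ler_expR; have : 10^-1 * d <= inv_beta * d by apply: ler_wpM2r.
rewrite /eta; lra.
Unshelve. all: by end_near. Qed.

(* By [cdf_le_bin] and Stirling, [n P(Bin < d / 2 + 2)] is of order [n exp (- d / beta) / sqrt d];
   here [inv_beta] is [1 / beta]. *)
Lemma min_degree_near (W : R) : \forall x \near +oo, forall n (p : R),
  0 <= p <= 1 -> ln n%:R = x -> x <= p * n.-1%:R -> p * n.-1%:R <= 20 * x ->
  x - 2^-1 * ln x + inv_beta * W <= inv_beta * (p * n.-1%:R) ->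
  prob p (fun E : {set {set 'I_n}} => [exists v, deg E v < (Num.truncn (p * n.-1%:R / 2)).+2]%N)
  <= 3 * expR (6 - inv_beta * W).
Proof.
near=> x => n p p01 lnx dx d20 cd; have /andP[p0 p1] := p01.
have x16 : 16 <= x by near: x; exact: pinfty_ge.
have [n1 nE] : (1 < n)%N /\ n%:R = expR x by rewrite -lnx; apply: ln_natE; rewrite lnx; lra.
have ps : 20 * x * p <= 1 by move: n p p0 lnx d20 {p01 dx cd p1 n1 nE}; near: x; exact: p_small.
apply: le_trans (prob_exists_low _ _ p01) _.
set d := p * n.-1%:R in dx d20 cd *.
have d0 : 0 <= d / 2 by lra.
have /andP[j1 j2] := truncn_itv d0.
set j := (Num.truncn (d / 2)).+1 in j2 *.
have j3 : j%:R <= d / 2 + 2 by rewrite /j -natr1; lra.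
have pj : p * j%:R <= 1.
  apply: le_trans ps; rewrite mulrC; apply: ler_wpM2r => //; lra.
have d16 : 16 <= d by lra.
have h1 := cdf_le_bin p01 j3 pj d16.
have h2 := bin_upper p01 (ltn0Sn _ : (0 < j)%N) (ltW j2) j3 pj d16.
rewrite -/d -/inv_beta in h2.
have -> : 3 * expR (6 - inv_beta * W) = n%:R * (3 * expR (6 - inv_beta * W - x)) by rewrite nE mulrCA -expRD; congr (_ * expR _); ring.
apply: ler_wpM2l => //; apply: le_trans h1 _; rewrite ler_pM2l //; apply: le_trans h2 _.
rewrite ler_expR; have : ln x <= ln d by rewrite ler_ln ?posrE //; lra.
lra.
Unshelve. all: by end_near. Qed.

(** As [inv_beta] is at least 1/10, for [d >= 20 x] the union bound is strong enough to reach beyond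
    [d / 2] by a proportional margin. *)
Lemma min_degree_far (e : R) : 0 < e -> \forall x \near +oo, forall n (p : R),
  0 <= p <= 1 -> ln n%:R = x -> 20 * x <= p * n.-1%:R ->
  prob p (fun E : {set {set 'I_n}} => [exists v, deg E v < (Num.truncn ((2^-1 + eta) * (p * n.-1%:R))).+1]%N)
  <= e.
Proof.
move=> e0; have /andP[c1 c2] := inv_beta_bounds.
near=> x => n p p01 lnx dx; have /andP[p0 p1] := p01.
have x1 : 1 <= x by near: x; exact: pinfty_ge.
have [n1 nE] : (1 < n)%N /\ n%:R = expR x by rewrite -lnx; apply: ln_natE; rewrite lnx; lra.
apply: le_trans (prob_exists_low _ _ p01) _.
set d := p * n.-1%:R in dx *.
have d0 : 0 <= d by lra.
have y0 : 0 <= (2^-1 + eta) * d by rewrite mulr_ge0 // addr_ge0 // ltW // eta_gt0.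
have nR : 0 <= n%:R :> R by [].
apply: le_trans (ler_wpM2l nR (cdf_half n.-1 p01 y0)) _.
apply: le_trans (_ : 1 * expR (- (2^-1 * x)) <= _); last by near: x; apply: expR_near.
rewrite mul1r [in X in X <= _]nE -expRD ler_expR [n.-1%:R * p]mulrC -/d.
have : ln 2 * ((2^-1 + eta) * d) = ln 2 * d / 2 + ln 2 * (eta * d) by ring.
have : ln 2 * (eta * d) <= 1 * (eta * d).
  by apply: ler_wpM2r (ln2_le1 R); rewrite mulr_ge0 // ltW // eta_gt0.
have : 10^-1 * d <= inv_beta * d by apply: ler_wpM2r.
rewrite /inv_beta /eta; lra.
Unshelve. all: by end_near. Qed.

End AboveThreshold.
End Cases.

(** * The case above the threshold *)

Section Threshold.
Variable R : realType.
Implicit Types (x : R) (n k : nat).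
Local Open Scope classical_set_scope.
Let eta := eta R.
Let eps := eps eta.

Lemma ln_small (a : R) : 0 < a -> \forall x \near +oo, ln x <= a * x.
Proof.
move=> a0; near=> x.
have x1 : 1 <= x by near: x; exact: pinfty_ge.
have h : 1 * x ^+ 1 * expR (- (a * x)) <= 1 by near: x; apply: poly_expR_near.
rewrite mul1r expr1 expRN ler_pdivrMr ?expR_gt0 // mul1r in h.
by rewrite -(@expRK R (a * x)) ler_ln ?posrE ?expR_gt0 //; lra.
Unshelve. all: by end_near. Qed.

Lemma prob_or_le n (p a b : R) (P Q : pred {set {set 'I_n}}) : 0 <= p <= 1 ->
  prob p P <= a -> prob p Q <= b -> prob p (fun E => P E || Q E) <= a + b.
Proof. by move=> p01 Pa Qb; apply: le_trans (prob_or p01 _ _) _; apply: lerD. Qed.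

Definition atypical (p : R) n (E : {set {set 'I_n}}) :=
  [|| edges_off p (eps / 16 * (p * n.-1%:R) * n%:R) E, dense_small eta eps p E | dense_mid eps p E].

Lemma typical_trees n (p : R) (E : {set {set 'I_n}}) k th : 0 <= p <= 1 -> (1 < n)%N -> E \subset pairs n ->
  100 <= p * n.-1%:R -> ~~ atypical p E -> ~~ (adj_low th E || common_low th E) ->
  (k * n.-1 <= #|E|)%N -> (forall v, k <= deg E v)%N -> (k + 2 * tmult eta p n + 2 <= th)%N ->
  has_disj_trees E k.
Proof.
move=> p01 n1 sE d100; rewrite /atypical negb_or => /andP[t1]; rewrite negb_or => /andP[t2 t3].
exact: (typical_packing (eta_gt0 R) (eta_le R) (eps_gt0 eta) (eps_le (eta_gt0 R)) n1 sE d100 t1 t2 t3).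
Qed.

Lemma event_ii_intro n (p : R) (E : {set {set 'I_n}}) j th : 0 <= p <= 1 -> (1 < n)%N -> E \subset pairs n ->
  100 <= p * n.-1%:R -> ~~ atypical p E -> ~~ (adj_low th E || common_low th E) ->
  (#|E| %/ n.-1 <= j)%N -> ~~ [exists v, deg E v < j.+1]%N -> (j + 2 * tmult eta p n + 2 <= th)%N ->
  event_ii E.
Proof.
move=> p01 n1 sE d100 ty lo kj /existsPn dj jth.
set k := (#|E| %/ n.-1)%N in kj *.
have kdeg v : (k < deg E v)%N by have := dj v; rewrite -leqNgt; apply: leq_trans.
have kn : (k < n)%N by apply: ltn_trans (kdeg (Ordinal n1)) (deg_lt _ sE).
apply/andP; split; first exact: mindeg_ge.
rewrite eqn_leq Tnum_le_density //=; apply: Tnum_ge => //.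
apply: (typical_trees p01 n1 sE d100 ty lo); first exact: leq_divM.
  by move=> v; exact: ltnW (kdeg v).
by apply: leq_trans jth; rewrite !leq_add2r; exact: kj.
Qed.

Lemma case_ii (e W : R) : 0 < e -> 0 <= W -> \forall x \near +oo, forall n (p : R),
  0 <= p <= 1 -> ln n%:R = x -> x - 2^-1 * ln x + inv_beta R * W <= inv_beta R * (p * n.-1%:R) ->
  prob p (fun E : {set {set 'I_n}} => ~~ event_ii E) <= e + 3 * expR (6 - inv_beta R * W).
Proof.
move=> e0 W0; have /andP[c1 c2] := inv_beta_bounds R.
have e4 : 0 < e / 4 by rewrite divr_gt0.
have eta0 : 0 < eta := eta_gt0 R.
have eps0 : 0 < eps := eps_gt0 eta.
have epse : eps <= eta := eps_le (eta_gt0 R).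
near=> x => n p p01 lnx cd; have /andP[p0 p1] := p01.
have x100 : 100 <= x by near: x; exact: pinfty_ge.
have xeta : 4 / eta <= x by near: x; exact: pinfty_ge.
have lx : ln x <= 10^-1 * x by near: x; apply: ln_small; rewrite invr_gt0.
have [n1 nE] : (1 < n)%N /\ n%:R = expR x by rewrite -lnx; apply: ln_natE; rewrite lnx; lra.
have nn : n.-1%:R = n%:R - 1 :> R by rewrite -subn1 natrB 1?ltnW.
have nx := expR_ge1Dx x; rewrite -nE in nx.
set d := p * n.-1%:R in cd *.
have d0 : 0 <= d by rewrite mulr_ge0.
have cW : 0 <= inv_beta R * W by rewrite mulr_ge0 //; lra.
have cd9 : 9 / 10 * x <= inv_beta R * d by lra.
have dx : x <= d.
  have : inv_beta R * d <= 2^-1 * d by apply: ler_wpM2r.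
  lra.
have d100 : 100 <= d by lra.
have dx2 : x / 2 <= d by lra.
have H1 : prob p (@atypical p n) <= e / 4.
  move: n p p01 lnx {p0 p1 cd n1 nE nn nx d0 cd9 dx d100} @d dx2; near: x.
  exact: (typical_whp (eta_gt0 R) (eta_le R)).
have H2 : prob p (fun E : {set {set 'I_n}} => adj_low (theta2 p n) E || common_low (theta2 p n) E) <= e / 4.
  move: n p p01 lnx {p0 p1 cd n1 nE nn nx d0 dx d100 dx2 H1} @d cd9; near: x.
  exact: low_conflict2_whp.
have t1 := tmult_bounds (eta_gt0 R) d0.
have {t1} /andP[_ t2] := t1.
have th : (2^-1 + 5 * eta) * d < (theta2 p n)%:R.
  have y0 : 0 <= (2^-1 + 5 * eta) * d by rewrite mulr_ge0 // addr_ge0 // mulr_ge0 // ltW.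
  by have /andP[_] := truncn_itv y0.
have etad : 4 <= eta * d.
  rewrite ler_pdivrMr // in xeta; apply: le_trans xeta _; rewrite mulrC; apply: ler_wpM2l => //; exact: ltW.
have thj j : j%:R <= (2^-1 + eta) * d -> (j + 2 * tmult eta p n + 2 <= theta2 p n)%N.
  move=> hj; rewrite -(ler_nat R) !natrD natrM; rewrite -/eta -/d in t2 th; clear - t2 th hj etad; lra.
have n0 : 0 < n.-1%:R :> R by clear - nn nx x100; lra.
have divk (E : {set {set 'I_n}}) : ((#|E| %/ n.-1)%N%:R : R) * n.-1%:R <= #|E|%:R.
  by rewrite -natrM ler_nat leq_divM.
(* Up to [20 x] the floor of [m / (n - 1)] is known within a unit and the sharp tail bound is used;
   beyond, the margin [eta * d] separates it from the degrees. *)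
have [d20|d20] := lerP d (20 * x).
  have H3 : prob p (fun E : {set {set 'I_n}} => edges_off p (n%:R / 2) E) <= e / 4.
    move: n p p01 lnx {p0 p1 cd n1 nE nn nx d0 dx d100 H1 cd9 H2 t2 th etad thj n0 divk} @d dx2 d20; near: x.
    exact: edges_off_whp.
  have H4 : prob p (fun E : {set {set 'I_n}} => [exists v, deg E v < (Num.truncn (d / 2)).+2]%N) <= 3 * expR (6 - inv_beta R * W).
    move: n p p01 lnx {p0 p1 n1 nE nn nx d0 dx2 d100 H1 cd9 H2 t2 th etad thj n0 divk H3} @d dx d20 cd; near: x.
    exact: min_degree_near.
  apply: le_trans (_ : prob p (fun E : {set {set 'I_n}} => atypical p E || ((adj_low (theta2 p n) E || common_low (theta2 p n) E) ||
     (edges_off p (n%:R / 2) E || [exists v, deg E v < (Num.truncn (d / 2)).+2]%N))) <= _).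
    apply: prob_le => // E sE; apply: contraR; rewrite negb_or negb_or [~~ (_ || [exists _, _])]negb_or.
    move=> /and3P[ty lo /andP[off dg]].
    have dd0 : 0 <= d / 2 by rewrite divr_ge0.
    have /andP[j1 j2] := truncn_itv dd0.
    apply: (event_ii_intro p01 n1 sE d100 ty lo) dg _; last first.
      by apply: thj; rewrite -natr1; clear - j1 etad; lra.
    rewrite -ltnS -(ltr_nat R).
    move: off; rewrite /edges_off -ltNge mean_edges // -/d ltr_norml => /andP[_ off].
    have := divk E; set k := (_ %/ _)%N => hk.
    rewrite -natr1; have hk' : k%:R < d / 2 + 1.
      rewrite -(ltr_pM2r n0); apply: le_lt_trans hk _.
      (* Exactly what gives [(d n + n) / 2 <= (d / 2 + 1) (n - 1)]. *)
      have d2 : d <= n%:R - 2.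
        have h : 1 * x ^+ 1 * expR (- (2^-1 * x)) <= 20^-1 / 2 by near: x; apply: poly_expR_near.
        rewrite mul1r expr1 expRN ler_pdivrMr ?expR_gt0 // in h.
        have hE : expR (2^-1 * x) <= n%:R by rewrite nE ler_expR; clear - x100; lra.
        by clear - h hE d20 nx x100; lra.
      by rewrite nn; clear - off d2; lra.
    by clear - j2 hk'; lra.
  apply: le_trans (prob_or_le p01 H1 (prob_or_le p01 H2 (prob_or_le p01 H3 H4))) _.
  by clear - e0; lra.
have H3 : prob p (fun E : {set {set 'I_n}} => [exists v, deg E v < (Num.truncn ((2^-1 + eta) * d)).+1]%N) <= e / 4.
  move: n p p01 lnx {p0 p1 cd n1 nE nn nx d0 dx d100 H1 cd9 H2 t2 th etad thj n0 divk dx2} @d {d20} (ltW d20); near: x.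
  exact: min_degree_far.
have y0 : 0 <= (2^-1 + eta) * d by rewrite mulr_ge0 // addr_ge0 // ltW.
have /andP[j1 j2] := truncn_itv y0.
apply: le_trans (_ : prob p (fun E : {set {set 'I_n}} => atypical p E || ((adj_low (theta2 p n) E || common_low (theta2 p n) E) ||
     [exists v, deg E v < (Num.truncn ((2^-1 + eta) * d)).+1]%N)) <= _).
  apply: prob_le => // E sE; apply: contraR; rewrite negb_or [~~ (_ || [exists _, _])]negb_or.
  move=> /and3P[ty lo dg].
  apply: (event_ii_intro p01 n1 sE d100 ty lo) dg _; last exact: thj.
  move: ty; rewrite /atypical negb_or => /andP[off _].
  move: off; rewrite /edges_off -ltNge mean_edges // -/d ltr_norml => /andP[_ off].
  have := divk E; set k := (_ %/ _)%N => hk.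
  rewrite -ltnS -(ltr_nat R); apply: le_lt_trans j2.
  rewrite -(ler_pM2r n0); apply: le_trans hk _.
  (* The edge deviation and the passage from [n] to [n.-1] are both absorbed by [eta * d]. *)
  have nd : 4 * (d * eta) <= d * eta * n%:R.
    by rewrite mulrC; apply: ler_wpM2l; [rewrite mulr_ge0 // ltW|clear - nx x100; lra].
  have nd2 : d * 4 <= d * eta * n%:R.
    rewrite -mulrA; apply: ler_wpM2l => //; apply: le_trans (_ : eta * x <= _).
      by rewrite ler_pdivrMr // in xeta; rewrite mulrC.
    by apply: ler_wpM2l; [exact: ltW|clear - nx; lra].
  have ee : eps * (d * n%:R) <= eta * (d * n%:R) by apply: ler_wpM2r; rewrite // mulr_ge0.
  by rewrite nn; clear - off nd nd2 ee d0; lra.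
apply: le_trans (prob_or_le p01 H1 (prob_or_le p01 H2 H3)) _.
by have := expR_ge0 (6 - inv_beta R * W); clear - e0; lra.
Unshelve. all: by end_near. Qed.

End Threshold.

(** * Below the threshold *)

Section BelowThreshold.
Variable R : realType.
Implicit Types (x : R) (n k : nat).
Local Open Scope classical_set_scope.
Let eta := eta R.
Let eps := eps eta.

Lemma event_i_isolated n (E : {set {set 'I_n}}) : (1 < n)%N -> E \subset pairs n ->
  ~~ [forall v, 1 <= deg E v]%N -> event_i E.
Proof.
move=> n1 sE /forallPn[v]; rewrite -ltnNge ltnS leqn0 => /eqP dv.
have m0 : mindeg E = 0%N by apply/eqP; rewrite -leqn0 -dv mindeg_le.
have := Tnum_le_mindeg n1 sE; rewrite m0 leqn0 => /eqP T0.
by apply/andP; rewrite m0 T0.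
Qed.

(** The packing number is [mindeg E] itself. The degree [j] only bounds it from above, and so places
    the conflict level [th] in advance. *)
Lemma event_i_intro n (p : R) (E : {set {set 'I_n}}) j th : 0 <= p <= 1 -> (1 < n)%N -> E \subset pairs n ->
  100 <= p * n.-1%:R -> ~~ atypical p E -> ~~ (adj_low th E || common_low th E) ->
  (j * n.-1 <= #|E|)%N -> ~~ [forall v, j < deg E v]%N -> (j + 2 * tmult eta p n + 2 <= th)%N ->
  event_i E.
Proof.
move=> p01 n1 sE d100 ty lo jE /forallPn[v]; rewrite -leqNgt => dv jth.
have kj : (mindeg E <= j)%N by apply: leq_trans (mindeg_le E v) dv.
have kE : (mindeg E * n.-1 <= #|E|)%N by apply: leq_trans jE; rewrite leq_mul2r kj orbT.
have n0 : (0 < n.-1)%N by case: (n) n1 => [|[]].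
apply/andP; split; first by rewrite leq_divRL.
rewrite eqn_leq Tnum_le_mindeg //=; apply: Tnum_ge => //.
apply: (typical_trees p01 n1 sE d100 ty lo) => //; first by move=> u; apply: mindeg_le.
by apply: leq_trans jth; rewrite !leq_add2r.
Qed.

(** The expected number of isolated vertices is at least about [exp(x - d)], hence at least of order
    [n^(1/5)]. *)
Lemma isolated_whp (e : R) : 0 < e -> \forall x \near +oo, forall n (p : R),
  0 <= p <= 1 -> ln n%:R = x -> p * n.-1%:R <= 8 / 10 * x ->
  prob p (fun E : {set {set 'I_n}} => [forall v, 1 <= deg E v]%N) <= e.
Proof.
move=> e0; have e2 : 0 < e / 2 by rewrite divr_gt0.
have m2 : 0 < Num.min 2^-1 (e / 4) :> R by rewrite lt_min invr_gt0 ltr0n divr_gt0.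
near=> x => n p p01 lnx dx; have /andP[p0 p1] := p01.
have x1 : 1 <= x by near: x; exact: pinfty_ge.
have d20 : p * n.-1%:R <= 20 * x by lra.
have ps : 20 * x * p <= Num.min 2^-1 (e / 4) by move: n p p0 lnx d20 {p01 p1 dx}; near: x; exact: p_small.
have {ps} /andP[ps1 ps2] : (20 * x * p <= 2^-1) && (20 * x * p <= e / 4) by rewrite -le_min.
have [n1 nE] : (1 < n)%N /\ n%:R = expR x by rewrite -lnx; apply: ln_natE; rewrite lnx; lra.
set d := p * n.-1%:R in dx d20 *.
have d0 : 0 <= d by rewrite mulr_ge0.
have px : p <= 20 * x * p.
  suff : 0 <= (20 * x - 1) * p by clear; lra.
  by rewrite mulr_ge0 //; clear - x1; lra.
have p2 : p <= 2^-1 by apply: le_trans px _.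
have dp : d * p <= 2^-1 by apply: le_trans ps1; apply: ler_wpM2r.
have q1 := oneB_pow p01 p2 dp.
have qe : cdf p n.-1 1 = (1 - p) ^+ n.-1 by rewrite cdfS cdf0 add0r bin0.
have q0 : 0 < cdf p n.-1 1 by rewrite qe; apply: lt_le_trans q1; exact: expR_gt0.
apply: le_trans (second_moment p01 q0 (ltnW n1) p2) _.
have nq : expR (5^-1 * x - 1) <= n%:R * cdf p n.-1 1.
  rewrite qe nE; apply: le_trans (ler_wpM2l (expR_ge0 x) q1).
  rewrite -expRD ler_expR -/d; lra.
have h1 : (n%:R * cdf p n.-1 1)^-1 <= e / 2.
  apply: le_trans (_ : (expR (5^-1 * x - 1))^-1 <= _).
    by rewrite lef_pV2 ?posrE ?expR_gt0 // (lt_le_trans _ nq) // expR_gt0.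
  rewrite -expRN; have -> : - (5^-1 * x - 1) = 1 + - (5^-1 * x) by ring.
  by rewrite expRD; near: x; apply: expR_near.
lra.
Unshelve. all: by end_near. Qed.

(* [j] is the least degree whose [cdf] value reaches [n ^ - 0.9], capped just below [d / 2]: it makes
   the expected number of vertices of degree at most [j] large while those vertices stay sparse. *)
Lemma choose_degree (e W : R) : 0 < e -> 0 <= W -> \forall x \near +oo, forall n (p : R),
  0 <= p <= 1 -> ln n%:R = x -> 8 / 10 * x <= p * n.-1%:R ->
  inv_beta R * (p * n.-1%:R) <= x - 2^-1 * ln x - inv_beta R * W ->
  exists j : nat, [/\ j%:R <= p * n.-1%:R / 2 - 1,
    0 < cdf p n.-1 j.+1, (n%:R * cdf p n.-1 j.+1)^-1 <= e + expR (12 - inv_beta R * W),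
    bin p n.-1 j <= expR (- (8 / 10 * x)) & cdf p n.-1 j <= expR (- (9 / 10 * x))].
Proof.
move=> e0 W0; have /andP[c1 c2] := inv_beta_bounds R.
near=> x => n p p01 lnx dx cd; have /andP[p0 p1] := p01.
have x16 : 16 <= x by near: x; exact: pinfty_ge.
have [n1 nE] : (1 < n)%N /\ n%:R = expR x by rewrite -lnx; apply: ln_natE; rewrite lnx; lra.
have nn : n.-1%:R = n%:R - 1 :> R by rewrite -subn1 natrB 1?ltnW.
set d := p * n.-1%:R in dx cd *.
have lx0 : 0 <= ln x by apply: ln_ge0; lra.
have cW : 0 <= inv_beta R * W by rewrite mulr_ge0 //; lra.
have d0 : 0 <= d by lra.
have d10 : d <= 10 * x by have : 10^-1 * d <= inv_beta R * d by [apply: ler_wpM2r]; lra.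
have d20 : d <= 20 * x by lra.
have ps : 20 * x * p <= 2^-1 by move: n p p0 lnx @d d20 {p01 p1 dx cd n1 nE nn d0 d10}; near: x; exact: p_small.
have px : p <= 20 * x * p.
  suff : 0 <= (20 * x - 1) * p by clear; lra.
  by rewrite mulr_ge0 //; clear - x16; lra.
have p2 : p <= 2^-1 by apply: le_trans px _.
have dp : d * p <= 2^-1 by apply: le_trans ps; apply: ler_wpM2r.
have y0 : 0 <= d / 2 - 1 by lra.
have /andP[J1 J2] := truncn_itv y0.
set J := Num.truncn (d / 2 - 1) in J1 J2.
have J3 : d / 2 - 1 < J%:R + 1 by rewrite natr1.
pose P j := (expR (- (9 / 10 * x)) <= cdf p n.-1 j.+1) || (J <= j)%N.
have exP : exists j, P j by exists J; rewrite /P leqnn orbT.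
have [j Pj minj] := ex_minnP exP.
have jJ : (j <= J)%N by apply: minj; rewrite /P leqnn orbT.
have jJR : j%:R <= J%:R :> R by rewrite ler_nat.
have nP i : (i < j)%N -> cdf p n.-1 i.+1 <= expR (- (9 / 10 * x)).
  move=> ij; rewrite leNgt; apply/negP => h; have : P i by rewrite /P (ltW h).
  by move=> /minj; rewrite leqNgt ij.
have cj : cdf p n.-1 j <= expR (- (9 / 10 * x)).
  case: (j) nP => [|i] nP; first by rewrite cdf0 expR_ge0.
  exact: nP.
(* The minimality of [j] controls the weight at [j - 1]; one further step costs a factor of at most
   [20 x], well within [n^(1/10)]. *)
have bj : bin p n.-1 j <= expR (- (8 / 10 * x)).
  case: (j) nP => [|i] nP.
    rewrite bin0; apply: le_trans (oneB_pow_le p01 _) _; rewrite ler_expR mulNr -/d; lra.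
  have b1 := bin_succ n.-1 p01 i p2; rewrite -/d in b1.
  have b2 : bin p n.-1 i <= expR (- (9 / 10 * x)).
    by apply: le_trans (nP i (ltnSn _)); rewrite cdfS lerDr cdf_ge0.
  have b3 : 2 * d / i.+1%:R <= 20 * x.
    rewrite ler_pdivrMr ?ltr0n //; apply: le_trans (_ : 20 * x * 1 <= _); first by lra.
    by apply: ler_wpM2l; [lra|rewrite ler1n].
  apply: le_trans b1 _.
  apply: le_trans (_ : 20 * x * expR (- (9 / 10 * x)) <= _).
    by apply: ler_pM => //; [rewrite divr_ge0 // mulr_ge0|exact: bin_ge0].
  have -> : - (9 / 10 * x) = - (10^-1 * x) + - (8 / 10 * x) by field.
  rewrite expRD mulrA -[X in _ <= X]mul1r; apply: ler_wpM2r; first exact: expR_ge0.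
  have : 20 * x ^+ 1 * expR (- (10^-1 * x)) <= 1 by near: x; apply: poly_expR_near.
  by rewrite expr1.
have n0 : 0 < n%:R :> R by rewrite nE expR_gt0.
have inv_le (q r : R) : expR r <= n%:R * q -> 0 < q /\ (n%:R * q)^-1 <= expR (- r).
  move=> h; have nq : 0 < n%:R * q by apply: lt_le_trans h; exact: expR_gt0.
  by split; [rewrite pmulr_rgt0 // in nq|rewrite expRN lef_pV2 ?posrE ?expR_gt0].
(* If the tail level is reached, the expected count is at least [n^(1/10)]. Otherwise [j] is the cap
   near [d / 2], where the Stirling lower bound and the distance [W] from the threshold apply. *)
case/orP: Pj => [hq|Jj].
  have [q0 q1] : 0 < cdf p n.-1 j.+1 /\ (n%:R * cdf p n.-1 j.+1)^-1 <= expR (- (10^-1 * x)).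
    apply: inv_le; rewrite nE; apply: le_trans (ler_wpM2l (expR_ge0 x) hq).
    by rewrite -expRD ler_expR; clear - x16; lra.
  exists j; split => //; first by clear - J1 jJR; lra.
  have q2 : 1 * expR (- (10^-1 * x)) <= e by near: x; apply: expR_near.
  have q3 := expR_ge0 (12 - inv_beta R * W); clear - q1 q2 q3; lra.
have jeq : j = J by apply/eqP; rewrite eqn_leq jJ Jj.
have j0 : (0 < j)%N by rewrite -(ltr_nat R) jeq; clear - J3 dx x16; lra.
have jd : j%:R <= d / 2 by clear - J1 jJR; lra.
have dj : d / 2 - 2 <= j%:R by rewrite jeq; clear - J3; lra.
have jN : (2 * j ^ 2 <= n.-1)%N.
  rewrite -(ler_nat R) natrM natrX nn.
  have h : 51 * x ^+ 2 * expR (- (1 * x)) <= 1 by near: x; apply: poly_expR_near.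
  rewrite mul1r expRN -nE ler_pdivrMr // mul1r in h.
  have h1 : j%:R ^+ 2 <= (5 * x) ^+ 2 :> R by apply: lerXn2r; rewrite ?nnegrE //; clear - jd d10 x16; lra.
  have h2 : 1 <= x ^+ 2 by rewrite expr_ge1 //; clear - x16; lra.
  by clear - h h1 h2; lra.
have bl := bin_lower p01 j0 p2 dp jN jd dj; rewrite -/d -/(inv_beta R) in bl.
have [q0 q1] : 0 < cdf p n.-1 j.+1 /\ (n%:R * cdf p n.-1 j.+1)^-1 <= expR (- (inv_beta R * W - 12)).
  apply: inv_le; rewrite nE.
  have bc : bin p n.-1 j <= cdf p n.-1 j.+1 by rewrite cdfS lerDr cdf_ge0.
  apply: le_trans (ler_wpM2l (expR_ge0 x) (le_trans bl bc)).
  rewrite -expRD ler_expR.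
  (* Half of this 9 together with the 7 of [bin_lower] stays below 12. *)
  have ld : ln d <= 9 + ln x.
    apply: le_trans (_ : ln (10 * x) <= _); first by rewrite ler_ln ?posrE //; clear - dx d10 x16; lra.
    rewrite lnM ?posrE; [|by clear - x16; lra|by clear - x16; lra]; rewrite lerD2r.
    have -> : 10 = 1 + 9 :> R by ring.
    by apply: le_ln1Dx; clear - x16; lra.
  by clear - ld cd; lra.
exists j; split => //; first by clear - J1 jJR; lra.
apply: le_trans q1 _; rewrite opprB; clear - e0; lra.
Unshelve. all: by end_near. Qed.

Lemma expRN10 : expR (- 10) <= 100^-1 / 10 :> R.
Proof.
have h10 : (1 + 1) ^+ 10 <= expR 10 :> R.
  have -> : 10 = 10%:R * 1 :> R by rewrite mulr1.
  rewrite expRM_natl; have h := expR_ge1Dx (1 : R).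
  by apply: lerXn2r; rewrite ?nnegrE ?expR_ge0 ?addr_ge0.
rewrite expRN -[X in _ <= X]invrK lef_pV2 ?posrE ?expR_gt0 ?invr_gt0 ?divr_gt0 ?invr_gt0 //.
apply: le_trans h10; lra.
Qed.

(** Raising the bound from [j] to [j + i] keeps the tail below [n^(-0.7)], whose square [n^(-1.4)]
    beats [n d^2]. *)
Lemma low_conflict1_whp (e : R) : 0 < e -> \forall x \near +oo, forall n (p : R) (j : nat),
  0 <= p <= 1 -> ln n%:R = x -> 8 / 10 * x <= p * n.-1%:R -> p * n.-1%:R <= 10 * x ->
  bin p n.-1 j <= expR (- (8 / 10 * x)) -> cdf p n.-1 j <= expR (- (9 / 10 * x)) ->
  prob p (fun E : {set {set 'I_n}} => adj_low (j + (2 * tmult eta p n + 2))%N E ||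
    common_low (j + (2 * tmult eta p n + 2))%N E) <= e.
Proof.
move=> e0; near=> x => n p j p01 lnx dx d10 bj cj; have /andP[p0 p1] := p01.
have x16 : 16 <= x by near: x; exact: pinfty_ge.
have [n1 nE] : (1 < n)%N /\ n%:R = expR x by rewrite -lnx; apply: ln_natE; rewrite lnx; lra.
have nx := expR_ge1Dx x; rewrite -nE in nx.
have n3 : (3 <= n)%N by rewrite -(ler_nat R); lra.
apply: le_trans (prob_low_conflict n p01 _) _.
set d := p * n.-1%:R in dx d10 *.
have d0 : 0 <= d by lra.
have d20 : d <= 20 * x by lra.
have ps : 20 * x * p <= 2^-1 by move: n p p0 lnx @d d20 {p01 p1 dx n1 nE nx n3 d0 d10 bj cj}; near: x; exact: p_small.
have px : p <= 20 * x * p.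
  suff : 0 <= (20 * x - 1) * p by clear; lra.
  by rewrite mulr_ge0 //; clear - x16; lra.
have p2 : p <= 2^-1 by apply: le_trans px _.
apply: le_trans (low_conflict_le _ p0 n1 _) _; first by rewrite -/d; lra.
rewrite -/d; set i := (2 * tmult eta p n + 2)%N; set th := (j + i)%N.
have t1 := tmult_bounds (eta_gt0 R) d0.
have {t1} /andP[_ t2] := t1.
have ti : i%:R <= 2 * eta * d + 4 by rewrite /i natrD natrM; rewrite -/eta -/d in t2; lra.
have etae : eta = 100^-1 / 100 by [].
have ix : i%:R <= x by have : eta * d <= eta * (10 * x) by [apply: ler_wpM2l => //; exact: ltW (eta_gt0 R)]; rewrite etae in ti *; lra.
have N3 : n.-1 = n.-2.-1.+2 by clear - n3; case: n n3 => [|[|[|]]].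
(* Dropping two trials costs at most [(1 - p)^(-2) <= 4]. *)
have c4 : cdf p n.-2.-1 th <= 4 * cdf p n.-1 th.
  rewrite N3 /=; have g1 := cdf_geN p01 n.-2.-1 th; have g2 := cdf_geN p01 n.-2.-1.+1 th.
  have q0 := cdf_ge0 p01 n.-2.-1 th.
  have g3 : 2^-1 * cdf p n.-2.-1 th <= (1 - p) * cdf p n.-2.-1 th by apply: ler_wpM2r => //; lra.
  have q1 := cdf_ge0 p01 n.-2.-1.+1 th.
  have g4 : 2^-1 * cdf p n.-2.-1.+1 th <= (1 - p) * cdf p n.-2.-1.+1 th by apply: ler_wpM2r => //; lra.
  lra.
(* With tilt 10 both [2 d exp(-10)] and [10 i] are about [0.02 x], up to a constant. *)
have ten : 0 <= 10 :> R by lra.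
have gr := cdf_growth n.-1 p01 j i p2 ten; rewrite -/th -/d in gr.
have e10 := expRN10.
have ex : 2 * d * expR (- 10) + 10 * i%:R <= 4 / 100 * x + 40.
  have : d * expR (- 10) <= (10 * x) * (100^-1 / 10) by apply: ler_pM => //; exact: expR_ge0.
  have : eta * d <= eta * (10 * x) by apply: ler_wpM2l => //; exact: ltW (eta_gt0 R).
  rewrite etae in ti *; lra.
have b0 := bin_ge0 p01 n.-1 j.
have c7 : cdf p n.-1 th <= expR (- (7 / 10 * x)).
  apply: le_trans gr _.
  apply: le_trans (_ : expR (- (9 / 10 * x)) + x * (expR (- (8 / 10 * x)) * expR (4 / 100 * x + 40)) <= _).
    apply: lerD => //; apply: ler_pM => //; first by rewrite mulr_ge0 // expR_ge0.
    by apply: ler_pM => //; rewrite ?expR_ge0 // ler_expR.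
  have h1 : 2 * expR (- (5^-1 * x)) <= 1 by near: x; apply: expR_near.
  have h2 : 2 * expR 40 * x ^+ 1 * expR (- (6 / 100 * x)) <= 1.
    by near: x; apply: poly_expR_near => //; lra.
  have A1 : expR (- (9 / 10 * x)) <= 2^-1 * expR (- (7 / 10 * x)).
    have -> : expR (- (9 / 10 * x)) = expR (- (5^-1 * x)) * expR (- (7 / 10 * x)).
      by rewrite -expRD; congr expR; field.
    by apply: ler_wpM2r; [exact: expR_ge0|clear - h1; lra].
  have A2 : x * (expR (- (8 / 10 * x)) * expR (4 / 100 * x + 40)) <= 2^-1 * expR (- (7 / 10 * x)).
    have -> : expR (- (8 / 10 * x)) * expR (4 / 100 * x + 40) =
              expR 40 * expR (- (6 / 100 * x)) * expR (- (7 / 10 * x)).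
      by rewrite -!expRD; congr expR; field.
    rewrite !mulrA; apply: ler_wpM2r; first exact: expR_ge0.
    by rewrite expr1 in h2; clear - h2; lra.
  by apply: le_trans (lerD A1 A2) _; clear; lra.
have c8 : cdf p n.-2.-1 th ^+ 2 <= 16 * expR (- (14 / 10 * x)).
  pose u := expR (- (7 / 10 * x)).
  have u2 : expR (- (14 / 10 * x)) = u ^+ 2 by rewrite /u -expRM_natl; congr expR; field.
  have -> : 16 * expR (- (14 / 10 * x)) = (4 * u) ^+ 2 by rewrite u2; ring.
  apply: lerXn2r; rewrite ?nnegrE; [exact: cdf_ge0|by rewrite mulr_ge0 // expR_ge0|].
  by apply: le_trans c4 _; rewrite ler_pM2l.
have dn : 6 * n%:R * d ^+ 2 >= 0 by rewrite !mulr_ge0 ?sqr_ge0.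
apply: le_trans (ler_wpM2l dn c8) _.
have fin : 6 * 100 * 16 * x ^+ 2 * expR (- (4 / 10 * x)) <= e.
  by near: x; apply: poly_expR_near => //; lra.
apply: le_trans fin.
have -> : 6 * n%:R * d ^+ 2 * (16 * expR (- (14 / 10 * x))) = 6 * 16 * d ^+ 2 * expR (- (4 / 10 * x)).
  have -> : - (4 / 10 * x) = x + - (14 / 10 * x) by field.
  rewrite expRD nE; ring.
apply: ler_wpM2r; first exact: expR_ge0.
have hd : d ^+ 2 <= (10 * x) ^+ 2 by apply: lerXn2r; rewrite ?nnegrE //; clear - x16; lra.
by clear - hd; lra.
Unshelve. all: by end_near. Qed.

Lemma case_i (e W : R) : 0 < e -> 0 <= W -> \forall x \near +oo, forall n (p : R),
  0 <= p <= 1 -> ln n%:R = x -> inv_beta R * (p * n.-1%:R) <= x - 2^-1 * ln x - inv_beta R * W ->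
  prob p (fun E : {set {set 'I_n}} => ~~ event_i E) <= e + expR (12 - inv_beta R * W).
Proof.
move=> e0 W0; have /andP[c1 c2] := inv_beta_bounds R.
have e5 : 0 < e / 5 by rewrite divr_gt0.
have m2 : 0 < Num.min 2^-1 (e / 10) :> R by rewrite lt_min invr_gt0 ltr0n divr_gt0.
near=> x => n p p01 lnx cd; have /andP[p0 p1] := p01.
have x200 : 200 <= x by near: x; exact: pinfty_ge.
have [n1 nE] : (1 < n)%N /\ n%:R = expR x by rewrite -lnx; apply: ln_natE; rewrite lnx; lra.
have nn : n.-1%:R = n%:R - 1 :> R by rewrite -subn1 natrB 1?ltnW.
have eW := expR_ge0 (12 - inv_beta R * W).
set d := p * n.-1%:R in cd *.
have d0 : 0 <= d by rewrite mulr_ge0.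
(* Nothing bounds [d] from below, while the typical properties require [d >= x / 2]. *)
have [dlow|dhigh] := lerP d (8 / 10 * x).
  apply: le_trans (_ : prob p (fun E : {set {set 'I_n}} => [forall v, 1 <= deg E v]%N) <= _).
    by apply: prob_le => // E sE; apply: contraR; apply: event_i_isolated.
  apply: le_trans (_ : e / 5 <= _); last lra.
  move: n p p01 lnx {p0 p1 n1 nE nn cd d0} @d dlow; near: x; exact: isolated_whp.
have lx0 : 0 <= ln x by apply: ln_ge0; lra.
have cW : 0 <= inv_beta R * W by rewrite mulr_ge0 //; lra.
have d10 : d <= 10 * x by have : 10^-1 * d <= inv_beta R * d by [apply: ler_wpM2r]; lra.
have dx8 : 8 / 10 * x <= d by apply: ltW.
have [j [jd q0 qn bj cj]] : exists j : nat, [/\ j%:R <= d / 2 - 1,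
    0 < cdf p n.-1 j.+1, (n%:R * cdf p n.-1 j.+1)^-1 <= e / 5 + expR (12 - inv_beta R * W),
    bin p n.-1 j <= expR (- (8 / 10 * x)) & cdf p n.-1 j <= expR (- (9 / 10 * x))].
  move: n p p01 lnx {p0 p1 n1 nE nn d0 dhigh d10} @d dx8 cd; near: x; exact: choose_degree.
have H1 : prob p (@atypical R p n) <= e / 5.
  have dx2 : x / 2 <= d by lra.
  move: n p p01 lnx {p0 p1 cd n1 nE nn d0 d10 dx8 j jd q0 qn bj cj dhigh} @d dx2; near: x.
  exact: (typical_whp (eta_gt0 R) (eta_le R)).
have H2 : prob p (fun E : {set {set 'I_n}} => edges_off p (n%:R / 2) E) <= e / 5.
  have dx2 : x / 2 <= d by lra.
  have d20 : d <= 20 * x by lra.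
  move: n p p01 lnx {p0 p1 cd n1 nE nn d0 d10 dx8 j jd q0 qn bj cj dhigh H1} @d dx2 d20; near: x.
  exact: edges_off_whp.
have H3 : prob p (fun E : {set {set 'I_n}} => adj_low (j + (2 * tmult eta p n + 2))%N E ||
    common_low (j + (2 * tmult eta p n + 2))%N E) <= e / 5.
  move: n p j p01 lnx {p0 p1 cd n1 nE nn d0 jd q0 qn dhigh H1 H2} @d dx8 d10 bj cj; near: x.
  exact: low_conflict1_whp.
have d20 : d <= 20 * x by clear - d10 x200; lra.
have ps : 20 * x * p <= Num.min 2^-1 (e / 10).
  move: n p p0 lnx {p01 p1 n1 nE nn cd d0 jd q0 qn bj cj dhigh d10 dx8 H1 H2 H3} @d d20; near: x; exact: p_small.
have {ps} /andP[ps1 ps2] : (20 * x * p <= 2^-1) && (20 * x * p <= e / 10) by rewrite -le_min.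
have px : p <= 20 * x * p.
  suff : 0 <= (20 * x - 1) * p by clear; lra.
  by rewrite mulr_ge0 //; clear - x200; lra.
have p2 : p <= 2^-1 by apply: le_trans px _.
have H4 := second_moment p01 q0 (ltnW n1) p2.
apply: le_trans (_ : prob p (fun E : {set {set 'I_n}} => atypical p E || ((adj_low (j + (2 * tmult eta p n + 2)) E ||
    common_low (j + (2 * tmult eta p n + 2)) E) || (edges_off p (n%:R / 2) E || [forall v, j.+1 <= deg E v]%N))) <= _).
  apply: prob_le => // E sE; apply: contraR; rewrite negb_or negb_or [~~ (_ || [forall _, _])]negb_or.
  move=> /and3P[ty lo /andP[off dg]].
  apply: (event_i_intro p01 n1 sE _ ty lo _ dg); first by rewrite -/d; clear - x200 dx8; lra.
    (* The unit in [j <= d / 2 - 1] pays for the deviation [n / 2] in the number of edges. *)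
    rewrite -(ler_nat R) natrM.
    move: off; rewrite /edges_off -ltNge mean_edges // -/d ltr_norml => /andP[off _].
    have n0 : 0 <= n.-1%:R :> R by [].
    by have := ler_wpM2r n0 jd; rewrite nn; rewrite nn in n0; clear - off n0 dx8 x200; lra.
  by rewrite addnA.
apply: le_trans (prob_or_le p01 H1 (prob_or_le p01 H3 (prob_or_le p01 H2 H4))) _.
by clear - qn ps2 px e0; lra.
Unshelve. all: by end_near. Qed.

End BelowThreshold.

Local Open Scope classical_set_scope.
Local Open Scope ring_scope.

(** * Passage to the limit *)

Section Limits.
Variable R : realType.
Local Open Scope classical_set_scope.

Lemma ln_cvgn : ln (n%:R : R) @[n --> \oo] --> +oo.
Proof.
apply/cvgryPge => A; near=> n.
have h : expR A <= n%:R by near: n; exact: nbhs_infty_ger.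
have n0 : 0 < n%:R :> R by apply: lt_le_trans h; exact: expR_gt0.
by rewrite -[A]expRK ler_ln ?posrE ?expR_gt0.
Unshelve. all: by end_near. Qed.

Lemma prob_cvg1 (p : nat -> R) (Q : forall n, pred {set {set 'I_n}}) :
  (forall n, 0 <= p n <= 1) ->
  (forall e : R, 0 < e -> \forall n \near \oo, prob (p n) (fun E => ~~ Q n E) <= e) ->
  Pr (p n) (@Q n) @[n --> \oo] --> (1 : R).
Proof.
move=> p01 h; apply/cvgrPdist_le => e e0.
apply: filterS (h e e0) => n hn; rewrite Pr_prob prob_not opprB addrC subrK.
by rewrite ger0_norm // prob_ge0.
Qed.

End Limits.

Theorem theorem2p2 (R : realType) (w p : nat -> R) :
  w n @[n --> \oo] --> +oo ->
  (forall n, 0 <= p n <= 1) ->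
  ((\forall n \near \oo,
       p n * (n.-1)%:R = beta R * (ln n%:R - 2^-1 * ln (ln n%:R)) - w n) ->
     Pr (p n) (@event_i n) @[n --> \oo] --> (1 : R))
  /\
  ((\forall n \near \oo,
       p n * (n.-1)%:R = beta R * (ln n%:R - 2^-1 * ln (ln n%:R)) + w n) ->
     Pr (p n) (@event_ii n) @[n --> \oo] --> (1 : R)).
Proof.
move=> woo p01; have /andP[c1 c2] := inv_beta_bounds R.
have inv_beta_gt0 : 0 < inv_beta R by lra.
have cb : inv_beta R * beta R = 1 by rewrite betaE mulfV ?gt_eqF.
(* The witness makes the exponent [a - b] with [b = 3 exp(a) / e], and [b <= exp(b)] suffices. *)
have large_W (a e : R) : 0 < e -> exists2 W, 0 <= W & 3 * expR (a - inv_beta R * W) <= e.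
  move=> e0; pose b : R := 3 * expR a / e.
  have b0 : 0 < b by rewrite divr_gt0 // mulr_gt0 // expR_gt0.
  exists (b / inv_beta R); first by rewrite divr_ge0 // ltW.
  rewrite mulrCA mulfV ?gt_eqF // mulr1 expRD mulrA expRN ler_pdivrMr ?expR_gt0 //.
  have h : b <= expR b by have := expR_ge1Dx b; lra.
  by have := ler_wpM2l (ltW e0) h; rewrite /b mulrCA mulfV ?gt_eqF // mulr1.
split=> hp; apply: prob_cvg1 => // e e0.
- have e2 : 0 < e / 2 by rewrite divr_gt0.
  have [W W0 We] := large_W 12 _ e2.
  (* The uniform statement at large [x] is pulled back along [x = ln n]; its bound size [m] is then
     taken to be [n]. *)
  have L := @ln_cvgn R _ (case_i e2 W0).
  have /cvgryPge/(_ W) wn := woo.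
  near=> n.
  have wW : W <= w n by near: n; exact: wn.
  have pn : p n * n.-1%:R = beta R * (ln n%:R - 2^-1 * ln (ln n%:R)) - w n by near: n.
  have key : forall m (q : R), 0 <= q <= 1 -> ln m%:R = ln n%:R :> R ->
     inv_beta R * (q * m.-1%:R) <= ln n%:R - 2^-1 * ln (ln n%:R) - inv_beta R * W ->
     prob q (fun E : {set {set 'I_m}} => ~~ event_i E) <= e / 2 + expR (12 - inv_beta R * W).
    by near: n; exact: L.
  apply: le_trans (key n (p n) (p01 n) erefl _) _.
    rewrite pn mulrBr mulrA cb mul1r; have := ler_wpM2l (ltW inv_beta_gt0) wW; lra.
  have := expR_ge0 (12 - inv_beta R * W); lra.
- have e2 : 0 < e / 2 by rewrite divr_gt0.
  have [W W0 We] := large_W 6 _ e2.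
  have L := @ln_cvgn R _ (case_ii e2 W0).
  have /cvgryPge/(_ W) wn := woo.
  near=> n.
  have wW : W <= w n by near: n; exact: wn.
  have pn : p n * n.-1%:R = beta R * (ln n%:R - 2^-1 * ln (ln n%:R)) + w n by near: n.
  have key : forall m (q : R), 0 <= q <= 1 -> ln m%:R = ln n%:R :> R ->
     ln n%:R - 2^-1 * ln (ln n%:R) + inv_beta R * W <= inv_beta R * (q * m.-1%:R) ->
     prob q (fun E : {set {set 'I_m}} => ~~ event_ii E) <= e / 2 + 3 * expR (6 - inv_beta R * W).
    by near: n; exact: L.
  apply: le_trans (key n (p n) (p01 n) erefl _) _.
    rewrite pn mulrDr mulrA cb mul1r; have := ler_wpM2l (ltW inv_beta_gt0) wW; lra.
  lra.
Unshelve. all: by end_near. Qed.
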